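(* Let $m$ be a positive integer and let $\omega$ be a modulus of continuity. Let $K\subseteq\mathbb{R}$ be a compact set with finitely many isolated points and $\#K\geq m+2$, and let $\gamma:K\to\mathbb{H}$ be continuous. Then there is a horizontal curve $\Gamma\in C^{m,\omega}(\mathbb{R},\mathbb{R}^3)$ with $\Gamma|_K=\gamma$ if and only if there exists a constant $M>0$ such that, for every $X\subseteq K$ with $\#X=m+2$, there is a curve $\Gamma_X\in C^{m,\omega}(\mathbb{R},\mathbb{R}^3)$ with $\Gamma_X=\gamma$ on $X$, $\|\Gamma_X\|_{C^{m,\omega}(\mathbb{R},\mathbb{R}^3)}\leq M$, and $$|A^m(\Gamma_X;a,b)|\leq M\,V^m_\omega(\Gamma_X;a,b)\qquad\text{for all } a,b\in K\text{ with } a<b.$$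
   Context: A modulus of continuity is a continuous, increasing, concave function $\omega:[0,\infty]\to[0,\infty]$ with $\omega(0)=0$. $C^{m,\omega}(\mathbb{R})$ is the space of $C^m$ functions $f:\mathbb{R}\to\mathbb{R}$ for which the seminorm $\|f\|_{C^{m,\omega}(\mathbb{R})}=\sup_{x\neq y}\frac{|D^mf(x)-D^mf(y)|}{\omega(|x-y|)}$ is finite. $C^{m,\omega}(\mathbb{R},\mathbb{R}^3)$ is the space of maps $(f,g,h):\mathbb{R}\to\mathbb{R}^3$ with $f,g,h\in C^{m,\omega}(\mathbb{R})$, with seminorm $\|(f,g,h)\|_{C^{m,\omega}(\mathbb{R},\mathbb{R}^3)}=\|f\|_{C^{m,\omega}(\mathbb{R})}+\|g\|_{C^{m,\omega}(\mathbb{R})}+\|h\|_{C^{m,\omega}(\mathbb{R})}$. The Heisenberg group $\mathbb{H}$ is $\mathbb{R}^3$ with group law $(x,y,z)*(x',y',z')=(x+x',y+y',z+z'+2(yx'-xy'))$. With $X(p)=\partial_x+2y\,\partial_z$ and $Y(p)=\partial_y-2x\,\partial_z$ at $p=(x,y,z)$, an absolutely continuous curve $\gamma=(f,g,h):\mathbb{R}\to\mathbb{R}^3$ is horizontal if $\gamma'(t)\in\mathrm{span}\{X(\gamma(t)),Y(\gamma(t))\}$ for a.e. $t$; equivalently, $h'=2(f'g-fg')$ a.e. For $\gamma=(f,g,h)\in C^m(\mathbb{R},\mathbb{R}^3)$, let $T_af(x)=\sum_{k=0}^m\frac{D^kf(a)}{k!}(x-a)^k$ be the $m$-th order Taylor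 polynomial, and similarly $T_ag$. The area discrepancy is $$A^m(\gamma;a,b)=h(b)-h(a)-2\int_a^b\big((T_af)'T_ag-(T_ag)'T_af\big)+2f(a)\big(g(b)-T_ag(b)\big)-2g(a)\big(f(b)-T_af(b)\big),$$ and, for $a<b$, the $\omega$-velocity is $$V^m_\omega(\gamma;a,b)=\omega(b-a)^2(b-a)^{2m}+\omega(b-a)(b-a)^m\int_a^b\big(|(T_af)'|+|(T_ag)'|\big).$$ *)

(* Defs.v *)
From HB Require Import structures.
From mathcomp Require Import all_boot all_order all_algebra.
From mathcomp Require Import all_classical all_reals all_analysis.

Set Implicit Arguments.
Unset Strict Implicit.
Unset Printing Implicit Defensive.

Import Order.TTheory GRing.Theory Num.Theory.
Import numFieldNormedType.Exports.

Local Open Scope classical_set_scope.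
Local Open Scope ring_scope.

Section Moduli.
Variable R : realType.

(* "Increasing" is read in the weak sense; positivity off 0, automatic for a
   strictly increasing function, then only rules out the zero function, for
   which the quotients in the seminorm are undefined.  The behaviour of omega
   outside [0, +oo] is irrelevant.  Recall 0 * +oo = 0 in \bar R, so that the
   concavity inequality is trivial for l = 0 and l = 1. *)
Definition modulus_of_continuity (omega : \bar R -> \bar R) : Prop :=
  [/\ omega 0%E = 0%E /\ (forall t, (0 < t)%E -> (0 < omega t)%E),
      {within [set t | (0 <= t)%E], continuous omega},
      (forall s t, (0 <= s)%E -> (s <= t)%E -> (omega s <= omega t)%E) &
      (forall s t (l : R), (0 <= s)%E -> (0 <= t)%E -> 0 <= l <= 1 ->
        (l%:E * omega s + (1 - l)%:E * omega t <=
         omega (l%:E * s + (1 - l)%:E * t))%E)].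

(* No information is lost by [fine]: concavity together with continuity at 0
   forces a modulus of continuity to be finite on [0, +oo[. *)
Definition modval (omega : \bar R -> \bar R) (t : R) : R := fine (omega t%:E).

End Moduli.

Section Spaces.
Variable R : realType.

Definition Cm (m : nat) (f : R -> R) : Prop :=
  (forall k, (k < m)%N -> forall x, derivable (derive1n k f) x 1) /\
  continuous (derive1n m f).

Definition Cmo_seminorm (m : nat) (omega : \bar R -> \bar R) (f : R -> R)
    : \bar R :=
  ereal_sup [set (`|derive1n m f p.1 - derive1n m f p.2| /
                  modval omega `|p.1 - p.2|)%:E
            | p in [set p : R * R | p.1 != p.2]].

Definition Cmo (m : nat) (omega : \bar R -> \bar R) (f : R -> R) : Prop :=
  Cm m f /\ (Cmo_seminorm m omega f < +oo)%E.

(* A curve t |-> (f t, g t, h t) is a map R -> R * R * R; these are its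
   components f, g, h. *)
Definition cx (G : R -> R * R * R) (t : R) : R := (G t).1.1.
Definition cy (G : R -> R * R * R) (t : R) : R := (G t).1.2.
Definition cz (G : R -> R * R * R) (t : R) : R := (G t).2.

Definition Cmo3 (m : nat) (omega : \bar R -> \bar R) (G : R -> R * R * R)
    : Prop :=
  [/\ Cmo m omega (cx G), Cmo m omega (cy G) & Cmo m omega (cz G)].

Definition Cmo3_seminorm (m : nat) (omega : \bar R -> \bar R)
    (G : R -> R * R * R) : \bar R :=
  (Cmo_seminorm m omega (cx G) + Cmo_seminorm m omega (cy G)
   + Cmo_seminorm m omega (cz G))%E.

End Spaces.

Section Heisenberg.
Variable R : realType.

(* The Heisenberg group is R * R * R with
   (x,y,z)*(x',y',z') = (x+x', y+y', z+z'+2(yx'-xy')); its topology is the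
   product topology. Below are the values at p of its left-invariant fields
   d/dx + 2y d/dz and d/dy - 2x d/dz. *)
Definition heisX (p : R * R * R) : R * R * R := (1, 0, 2 * p.1.2).
Definition heisY (p : R * R * R) : R * R * R := (0, 1, - (2 * p.1.1)).

Definition abs_continuous_on (a b : R) (G : R -> R * R * R) : Prop :=
  forall e : R, 0 < e -> exists2 d : R, 0 < d &
    forall (n : nat) (s t : 'I_n -> R),
      (forall i, a <= s i /\ s i <= t i /\ t i <= b) ->
      (forall i j, i != j -> `]s i, t i[ `&` `]s j, t j[ = set0) ->
      \sum_(i < n) (t i - s i) < d ->
      \sum_(i < n) `|G (t i) - G (s i)| < e.

(* On the whole line, absolute continuity is understood on every compact
   interval. *)
Definition horizontal (G : R -> R * R * R) : Prop :=
  (forall a b : R, a < b -> abs_continuous_on a b G) /\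
  {ae lebesgue_measure, forall t : R, derivable G t 1 /\
    exists u v : R, derive1 G t = u *: heisX (G t) + v *: heisY (G t)}.

Definition taylor (m : nat) (f : R -> R) (a : R) : {poly R} :=
  \sum_(k < m.+1) (derive1n k f a / k`!%:R) *: ('X - a%:P) ^+ k.

(* The integrals are over [a, b]: the two definitions below are meant for
   a <= b only. *)
Definition area_discrepancy (m : nat) (G : R -> R * R * R) (a b : R) : R :=
  let f := cx G in let g := cy G in let h := cz G in
  let Tf := taylor m f a in let Tg := taylor m g a in
  h b - h a
  - 2 * \int[lebesgue_measure]_(x in `[a, b])
          ((deriv Tf).[x] * Tg.[x] - (deriv Tg).[x] * Tf.[x])
  + 2 * f a * (g b - Tg.[b]) - 2 * g a * (f b - Tf.[b]).

Definition omega_velocity (m : nat) (omega : \bar R -> \bar R)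
    (G : R -> R * R * R) (a b : R) : R :=
  let Tf := taylor m (cx G) a in let Tg := taylor m (cy G) a in
  modval omega (b - a) ^+ 2 * (b - a) ^+ (2 * m)
  + modval omega (b - a) * (b - a) ^+ m *
    \int[lebesgue_measure]_(x in `[a, b])
      (`|(deriv Tf).[x]| + `|(deriv Tg).[x]|).

End Heisenberg.

(* Main.v *)
Require Import Defs.
From mathcomp Require Import all_boot all_order all_algebra.
From mathcomp Require Import all_classical all_reals all_analysis.
From mathcomp Require Import finmap ring lra zify.
Import Order.TTheory GRing.Theory Num.Theory.
Import numFieldNormedType.Exports.

Set Implicit Arguments.
Unset Strict Implicit.
Unset Printing Implicit Defensive.

Local Open Scope classical_set_scope.
Local Open Scope ring_scope.

(* Write l = b - a.  A horizontal C^{m,w} curve differs from its Taylor polynomials at a by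
   O(w(l) l^m) on [a, b], and the height gained along [a, b] depends on the planar part with an
   error controlled by that distance: this is the bound on the area discrepancy.

   Conversely, two interpolants of f on (m+2)-point subsets of K that lie in an interval of length
   l can be joined by exchanging one point at a time; two consecutive ones agree at m+1 points, so
   by iterated Rolle their k-th derivatives differ by O(w(l) l^(m-k)).  Hence their derivatives
   converge at every limit point of K and define there a field of Taylor polynomials satisfying
   Whitney's conditions; the finitely many isolated points are at positive distance from the rest
   of K and get constant polynomials.  Two rays where everything vanishes are added to K, so that
   the complement becomes a union of bounded gaps.  Across a gap ]a, b[ one interpolates between
   the two Taylor polynomials and then adds m-flat perturbations of size w(l) l^m which correct
   the area swept by the planar curve: the correction needed is of the order of the w-velocity,
   and it is produced either linearly, by moving transversally to a Taylor polynomial with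
   nonconstant planar part, or quadratically, by a small loop.  The height is then the integral of
   2(f'g - g'f), which takes the prescribed values on K. *)

(** * Families of derivatives and moduli of continuity *)

(** Two interpolants whose sets differ in one of their m+2 points share m+1 points, just enough
    zeros for Rolle to reach order m: this fixes the size of the sets X. The area bound is known for
    the Taylor polynomials of an interpolant, not for the limiting jets, so the extension is
    formulated for any [T1], [T2] at distance O(w(l) l^m) from the jets. The integral in the
    w-velocity enters only through a common bound [B] of |T1'| and |T2'|; nothing is lost, because
    among polynomials of bounded degree a weighted L2 norm on an interval controls every derivative.
    After rescaling, this norm also decides between the two corrections: when it is large the linear
    one has a coefficient comparable to it, when it is small the required correction is itself
    bounded and a loop suffices. No jet is built for the height: its derivative along K is dictated
    by the planar curve, and its regularity comes from Leibniz' rule, which needs bounded factors.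
    The planar curve is therefore given compact support, a second use of the rays. Integrals are
    handled as increments of primitives, compared through their derivatives. *)

Section MeanValue.
Variable R : realType.

(* Unlike [is_derive], not a type class: no instance resolution when it is a side goal. *)
Definition has_deriv (f : R -> R) (x d : R) : Prop := is_derive x (1 : R) f d.

Lemma has_derivD (f g : R -> R) (x df dg : R) :
  has_deriv f x df -> has_deriv g x dg ->
  has_deriv (fun t => f t + g t) x (df + dg).
Proof. by move=> Hf Hg; apply: is_deriveD. Qed.

Lemma has_derivB (f g : R -> R) (x df dg : R) :
  has_deriv f x df -> has_deriv g x dg ->
  has_deriv (fun t => f t - g t) x (df - dg).
Proof. by move=> Hf Hg; apply: is_deriveB. Qed.

Lemma has_derivN (f : R -> R) (x df : R) :
  has_deriv f x df -> has_deriv (fun t => - f t) x (- df).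
Proof. by move=> Hf; apply: is_deriveN. Qed.

Lemma has_derivM (f g : R -> R) (x df dg : R) :
  has_deriv f x df -> has_deriv g x dg ->
  has_deriv (fun t => f t * g t) x (df * g x + f x * dg).
Proof.
move=> Hf Hg; rewrite addrC (mulrC df).
by have := @is_deriveM R R f g x 1 df dg Hf Hg; apply.
Qed.

Lemma has_derivZ (c : R) (f : R -> R) (x df : R) :
  has_deriv f x df -> has_deriv (fun t => c * f t) x (c * df).
Proof. by move=> Hf; apply: is_deriveZ. Qed.

Lemma has_deriv_cst (c x : R) : has_deriv (fun=> c) x 0.
Proof. exact: is_derive_cst. Qed.

Lemma has_deriv_id (x : R) : has_deriv id x 1.
Proof. exact: is_derive_id. Qed.

Lemma has_deriv_poly (p : {poly R}) (x : R) : has_deriv (horner p) x p^`().[x].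
Proof. exact: is_derive_poly. Qed.

Lemma has_deriv_cont f (x d : R) : has_deriv f x d -> {for x, continuous f}.
Proof.
by move=> H; apply: differentiable_continuous; apply/derivable1_diffP; case: H.
Qed.

Lemma le_of_eq (x y : R) : x = y -> x <= y.
Proof. by move->. Qed.

Implicit Types (f g : R -> R) (a b c d x y : R).

Lemma has_deriv_within f df a b :
  (forall x, a <= x <= b -> has_deriv f x (df x)) ->
  {within `[a, b], continuous f}.
Proof.
move=> H; apply: continuous_in_subspaceT => x.
move=> /set_mem; rewrite /= in_itv => xab.
exact: has_deriv_cont (H x xab).
Qed.

Lemma mvt f df a b : a <= b ->
  (forall x, a <= x <= b -> has_deriv f x (df x)) ->
  exists2 c, a <= c <= b & f b - f a = df c * (b - a).
Proof.
move=> ab H.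
have [||c] := @MVT_segment R f df a b ab.
- by move=> x; rewrite in_itv /= => /andP[/ltW ax /ltW xb]; apply: H; rewrite ax.
- exact: has_deriv_within H.
by rewrite in_itv /= => cab E; exists c.
Qed.

Lemma deriv_bound f df c d B x y :
  (forall z, c <= z <= d -> has_deriv f z (df z)) ->
  (forall z, c <= z <= d -> `|df z| <= B) ->
  c <= x <= d -> c <= y <= d -> `|f x - f y| <= B * `|x - y|.
Proof.
move=> Hd HB; wlog yx : x y / y <= x => [W|] xcd ycd.
  have [yx|/ltW xy] := leP y x; first exact: W.
  by rewrite distrC (distrC x); apply: W.
have [|z zxy ->] := @mvt f df y x yx.
  by move=> z zxy; apply: Hd; lra.
rewrite normrM ler_wpM2r// HB//; lra.
Qed.

Lemma deriv_le f g df dg a b : a <= b ->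
  (forall x, a <= x <= b -> has_deriv f x (df x)) ->
  (forall x, a <= x <= b -> has_deriv g x (dg x)) ->
  (forall x, a <= x <= b -> df x <= dg x) ->
  f b - f a <= g b - g a.
Proof.
move=> ab Hf Hg H.
have [|z zab] := @mvt (g \- f) (fun x => dg x - df x) a b ab.
  by move=> x xab; apply: has_derivB; [exact: Hg|exact: Hf].
rewrite /= => E; rewrite -subr_ge0.
suff -> : g b - g a - (f b - f a) = (g b - f b) - (g a - f a).
  by rewrite E mulr_ge0// subr_ge0// H.
by ring.
Qed.

(** Plays the part of bounding an integral by the integral of a bound, without integration. *)
Lemma deriv_norm_le f g df dg a b : a <= b ->
  (forall x, a <= x <= b -> has_deriv f x (df x)) ->
  (forall x, a <= x <= b -> has_deriv g x (dg x)) ->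
  (forall x, a <= x <= b -> `|df x| <= dg x) ->
  `|f b - f a| <= g b - g a.
Proof.
move=> ab Hf Hg H; rewrite ler_norml; apply/andP; split.
  have := @deriv_le (\- f) g (fun x => - df x) dg a b ab _ Hg _.
  rewrite /= => h; rewrite lerNl; apply: le_trans (h _ _); last 2 first.
  - by move=> x xab; apply: has_derivN; exact: Hf.
  - by move=> x xab; have := H x xab; rewrite ler_norml => /andP[]; lra.
  lra.
apply: deriv_le Hf Hg _ => // x xab.
exact: le_trans (ler_norm _) (H x xab).
Qed.

Lemma const_of_deriv0 f a b :
  (forall x, has_deriv f x 0) -> f a = f b.
Proof.
move=> H; apply/eqP; rewrite -subr_eq0 -normr_le0.
have := @deriv_bound f (cst 0) (Num.min a b) (Num.max a b) 0 a b.
rewrite mul0r; apply.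
- by move=> z _; exact: H.
- by move=> z _; rewrite normr0.
- by rewrite ge_min le_max !lexx.
- by rewrite ge_min le_max !lexx !orbT.
Qed.

(** The derivatives are carried as data instead of being computed by [derive1n], so that
    differences, polynomials and glued functions are families without rewriting iterated
    derivatives. *)
Definition deriv_family (m : nat) (u : nat -> R -> R) :=
  forall k, (k < m)%N -> forall x, has_deriv (u k) x (u k.+1 x).

Lemma deriv_familyB m u v : deriv_family m u -> deriv_family m v ->
  deriv_family m (fun k x => u k x - v k x).
Proof. by move=> Hu Hv k km x; apply: has_derivB; [exact: Hu|exact: Hv]. Qed.

Lemma deriv_family_poly m (p : {poly R}) :
  deriv_family m (fun k x => (p^`(k)).[x]).
Proof. by move=> k _ x; rewrite derivnS; exact: has_deriv_poly. Qed.

(* Descending induction on the order of the derivative, with one mean value estimate per step. *)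
Lemma family_bound m u c d A L : deriv_family m u -> 0 <= A -> c <= d ->
  (forall x y, c <= x <= d -> c <= y <= d -> `|u m x - u m y| <= L) ->
  (forall k, (k <= m)%N ->
     exists2 xi, c <= xi <= d & `|u k xi| <= A * (d - c) ^+ (m - k)) ->
  forall k, (k <= m)%N -> forall x, c <= x <= d ->
    `|u k x| <= (L + m.+1%:R * A) * (d - c) ^+ (m - k).
Proof.
move=> Hu A0 cd Hm Hxi.
have L0 : 0 <= L.
  by apply: le_trans (Hm c c _ _); rewrite ?normr_ge0 ?lexx ?cd.
have key j : (j <= m)%N -> forall x, c <= x <= d ->
    `|u (m - j)%N x| <= (L + j.+1%:R * A) * (d - c) ^+ j.
  elim: j => [|j IH] jm x xcd.
    have [xi xicd Hb] := Hxi m (leqnn m); rewrite subnn expr0 mulr1 in Hb.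
    rewrite subn0 expr0 mulr1 mul1r -(subrK (u m xi) (u m x)).
    by apply: le_trans (ler_normD _ _) _; rewrite lerD// Hm.
  have mj : (m - j)%N = (m - j.+1).+1 by rewrite subnSK.
  have [xi xicd] := Hxi (m - j.+1)%N (leq_subr _ _).
  rewrite subKn// => Hb.
  rewrite -(subrK (u (m - j.+1)%N xi) (u (m - j.+1)%N x)).
  apply: le_trans (ler_normD _ _) _.
  have h1 : `|u (m - j.+1)%N x - u (m - j.+1)%N xi| <=
      ((L + j.+1%:R * A) * (d - c) ^+ j) * `|x - xi|.
    apply: (@deriv_bound _ (u (m - j)%N) c d) => // z zcd; last exact: IH (ltnW jm) _ zcd.
    by rewrite mj; apply: Hu; rewrite ltn_subrL /=; case: (m) jm.
  have h2 : `|x - xi| <= d - c by rewrite ler_norml; lra.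
  apply: (@le_trans _ _ (((L + j.+1%:R * A) * (d - c) ^+ j) * (d - c) + A * (d - c) ^+ j.+1)).
    apply: lerD => //; apply: le_trans h1 _; apply: ler_wpM2l => //.
    by rewrite mulr_ge0 ?exprn_ge0 ?subr_ge0// addr_ge0// mulr_ge0.
  by rewrite exprSr -[j.+2%:R]natr1; apply: le_of_eq; ring.
move=> k km x xcd.
have := key (m - k)%N (leq_subr _ _) x xcd; rewrite subKn// => h.
apply: le_trans h _; apply: ler_wpM2r; first by rewrite exprn_ge0// subr_ge0.
by rewrite lerD2l ler_wpM2r// ler_nat ltnS leq_subr.
Qed.

(** The induction generalises [c]: the tail is treated with [y] as lower bound, so its zeros lie at
    or beyond [y], while the new zero between [x] and [y] lies before them. *)
Lemma rolle_sorted f df (s : seq R) c d :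
  (forall x, has_deriv f x (df x)) ->
  sorted <%R s -> all (fun x => (c <= x <= d) && (f x == 0)) s ->
  exists t : seq R, [/\ size t = (size s).-1, sorted <%R t &
    all (fun x => (c <= x <= d) && (df x == 0)) t].
Proof.
move=> Hd.
case: s => [|x s]; first by exists [::].
elim: s x c => [|y s IH] x c; first by exists [::].
move=> /= /andP[xy srt] /andP[/andP[xcd fx] /= /andP[/andP[ycd fy] al]].
have [|t [st srt' alt]] := IH y y srt.
  rewrite /= lexx fy /=; case/andP: ycd => _ -> /=.
  move: (srt) => /(order_path_min lt_trans) /allP gt.
  apply/allP => z zs; move/allP: al => /(_ z zs) /andP[/andP[_ ->] ->].
  by rewrite (ltW (gt z zs)).
have [|||z] := @Rolle R f x y xy.
- by move=> z _; case: (Hd z).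
- by apply: (@has_deriv_within _ df) => z _; exact: Hd.
- by rewrite (eqP fx) (eqP fy).
rewrite in_itv /= => /andP[xz zy] Hz.
have dz : df z = 0.
  by have [_ <-] := Hd z; case: Hz.
exists (z :: t); split => /=; first by rewrite st.
- rewrite path_min_sorted //; apply/allP => v vt.
  by move/allP: alt => /(_ v vt) /andP[/andP[yv _] _]; exact: lt_le_trans yv.
- rewrite dz eqxx andbT; apply/andP; split; first lra.
  apply/allP => v vt; move/allP: alt => /(_ v vt) /andP[/andP[yv ->] ->].
  by rewrite !andbT; lra.
Qed.

(** Each derivative costs one zero, so m+1 zeros leave at least one at order m. *)
Lemma rolle_family m u (s : seq R) c d : deriv_family m u ->
  (m < size s)%N -> uniq s -> {in s, forall x, c <= x <= d /\ u 0%N x = 0} ->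
  forall k, (k <= m)%N -> exists2 xi, c <= xi <= d & u k xi = 0.
Proof.
move=> Hu ms us Hs.
have key k : (k <= m)%N -> exists t : seq R, [/\ size t = (size s - k)%N,
   sorted <%R t & all (fun x => (c <= x <= d) && (u k x == 0)) t].
  elim: k => [_|k IH km].
    exists (sort <=%R s); rewrite size_sort subn0; split => //.
      by rewrite sort_lt_sorted.
    apply/allP => x; rewrite mem_sort => /Hs[-> ->]; exact: eqxx.
  have [t [st srt al]] := IH (ltnW km).
  have [t' [st' srt' al']] := rolle_sorted (Hu k km) srt al.
  by exists t'; rewrite st' st subnS.
move=> k km; have [[|x t] [st _ al]] := key k km.
  by move/eqP: st; rewrite eq_sym subn_eq0 leqNgt (leq_ltn_trans km ms).
by move: al => /= /andP[/andP[xcd /eqP ux] _]; exists x.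
Qed.

End MeanValue.

(** * Real-valued moduli of continuity *)

Section Modulus.
Variable R : realType.

(** Concavity is expressed for chords from the origin: w t / t is nonincreasing. Continuity is
    expressed at 0. *)
Definition modulus (w : R -> R) : Prop :=
  [/\ w 0 = 0, (forall t, 0 < t -> 0 < w t),
      (forall s t, 0 <= s -> s <= t -> w s <= w t),
      (forall l t, 0 <= l <= 1 -> 0 <= t -> l * w t <= w (l * t)) &
      (forall e, 0 < e -> exists2 d, 0 < d & forall t, 0 <= t <= d -> w t <= e)].

(** For finiteness: by concavity between 0 and t, an infinite value at t would propagate to every
    point of ]0, t], against continuity at 0. *)
Lemma modval_modulus (omega : \bar R -> \bar R) :
  modulus_of_continuity omega -> modulus (modval omega).
Proof.
move=> [[w0 wpos] wc wmon wconc].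
have w0' : modval omega 0 = 0 by rewrite /modval w0.
have wge0 (t : R) : 0 <= t -> (0 <= omega t%:E)%E.
  by move=> t0; rewrite -w0; apply: wmon; rewrite ?lee_fin.
have conc (l t : R) : 0 <= l <= 1 -> 0 <= t ->
    (l%:E * omega t%:E <= omega (l * t)%:E)%E.
  move=> l01 t0; have := wconc t%:E 0%E l; rewrite !lee_fin => /(_ t0 (lexx _) l01).
  by rewrite w0 !mule0 !adde0 -EFinM.
have cont0 (e : R) : 0 < e -> exists2 d : R, 0 < d & forall t : R, 0 <= t <= d -> (omega t%:E < e%:E)%E.
  move=> e0.
  have /subspace_continuousP/(_ 0%E (lexx _)) := wc.
  move=> /(_ [set y | (y < e%:E)%E]) []; last first.
    move=> d /= d0 Hd; exists (d / 2); first by rewrite divr_gt0.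
    move=> t /andP[t0 td]; apply: (Hd t); last by rewrite lee_fin.
    by rewrite /= sub0r normrN ger0_norm//; lra.
  by rewrite /= /from_subspace w0; apply: open_ereal_lt'; rewrite lte_fin.
have fin (t : R) : 0 <= t -> omega t%:E \is a fin_num.
  move=> t0; rewrite fin_real// (lt_le_trans _ (wge0 t t0)) ?ltNy0//=.
  have [d d0 Hd] := cont0 1 ltr01.
  rewrite ltey; apply/eqP => tE.
  have [td|dt] := leP t d; first by have := Hd t; rewrite t0 td tE => /(_ isT).
  have tp : 0 < t by lra.
  have l0 : 0 < d / t by rewrite divr_gt0.
  have := conc (d / t) t; rewrite (ltW l0) tE ler_pdivrMr// mul1r (ltW dt) => /(_ isT t0).
  rewrite gt0_muley ?lte_fin// divfK ?gt_eqF// leye_eq => /eqP dE.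
  by have := Hd d; rewrite (ltW d0) lexx dE => /(_ isT).
have EF (t : R) : 0 <= t -> omega t%:E = (modval omega t)%:E by move=> t0; rewrite /modval fineK// fin.
split => //.
- by move=> t t0; rewrite -lte_fin -EF ?ltW// wpos.
- by move=> s t s0 st; rewrite -lee_fin -!EF ?(le_trans s0)// wmon ?lee_fin.
- move=> l t l01 t0; rewrite -lee_fin EFinM -!EF//; first exact: conc.
  by rewrite mulr_ge0//; case/andP: l01.
- move=> e e0; have [d d0 Hd] := cont0 e e0; exists d => // t td.
  by rewrite -lee_fin -EF; [exact/ltW/Hd|case/andP: td].
Qed.

Variable w : R -> R.
Hypothesis w_mod : modulus w.

Lemma modulus_gt0 t : 0 < t -> 0 < w t.
Proof. by case: w_mod => _ + _ _ _; apply. Qed.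

Lemma modulus_ge0 t : 0 <= t -> 0 <= w t.
Proof.
rewrite le_eqVlt => /predU1P[<-|/modulus_gt0/ltW//].
by case: w_mod => ->.
Qed.

Lemma modulus_le s t : 0 <= s -> s <= t -> w s <= w t.
Proof. by case: w_mod => _ _ + _ _; apply. Qed.

Lemma modulus_double t : 0 <= t -> w (2 * t) <= 2 * w t.
Proof.
move=> t0; case: w_mod => _ _ _ H _.
have := H 2^-1 (2 * t); rewrite mulKf// => h.
by rewrite -ler_pdivrMl// h//; lra.
Qed.

(** Turns a Lipschitz constant w t / t on an interval of length t into a bound by w. *)
Lemma modulus_chord s t : 0 <= s -> s <= t -> 0 < t -> w t / t * s <= w s.
Proof.
move=> s0 st t0; case: w_mod => _ _ _ H _.
have := H (s / t) t; rewrite divfK ?gt_eqF// => h.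
rewrite mulrAC -mulrA mulrC; apply: h; last exact: ltW.
by apply/andP; split; [rewrite divr_ge0// ltW | rewrite ler_pdivrMr// mul1r].
Qed.

Lemma modulus_small e : 0 < e -> exists2 d, 0 < d & forall t, 0 <= t <= d -> w t <= e.
Proof. by case: w_mod => _ _ _ _; apply. Qed.

End Modulus.

(** * Stability of the area *)

Section Area.
Variable R : realType.

Lemma primitive_exists (u : R -> R) (a b : R) : continuous u -> a < b ->
  exists U : R -> R, (forall x, a <= x <= b -> has_deriv U x (u x)) /\
    \int[lebesgue_measure]_(x in `[a, b]) u x = U b - U a.
Proof.
move=> cu ab.
(* Integrating from a - 1 makes a and b interior points, so that U is differentiable on both sides
   there. *)
pose U x := \int[lebesgue_measure]_(t in `[a - 1, x]) u t.
have dU x : a - 1 < x -> x < b + 1 -> has_deriv U x (u x).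
  move=> ax xb.
  have [|dU eU] := @continuous_FTC1_closed R u (a - 1) x (b + 1) xb _ ax (cu x).
    apply: continuous_compact_integrable; first exact: segment_compact.
    exact: continuous_subspaceT.
  by rewrite -eU derive1E; exact: derivableP.
have dU' x : a <= x <= b -> has_deriv U x (u x).
  by move=> xab; apply: dU; lra.
exists U; split => //.
rewrite /Rintegral (@continuous_FTC2 R u U a b ab) //=.
- exact: continuous_subspaceT.
- split.
  + by move=> x; rewrite in_itv /= => xab; case: (dU' x _) => //; lra.
  + by apply: cvg_at_right_filter; apply: has_deriv_cont (dU' a _); lra.
  + by apply: cvg_at_left_filter; apply: has_deriv_cont (dU' b _); lra.
- move=> x; rewrite in_itv /= => xab; rewrite derive1E.
  have xab' : a <= x <= b by lra.
  by case: (dU' x xab').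
Qed.

(* With phi = f - p and psi = g - q, the left-hand side is the integral of
   2 (p' psi - q' phi + phi' (q - q(a)) - psi' (p - p(a)) + phi' psi - psi' phi),
   so no integration by parts is needed. *)
Lemma area_stability (f g f1 g1 U J S s : R -> R) (p q : {poly R}) (a b th : R) :
  a < b ->
  (forall x, a <= x <= b -> has_deriv f x (f1 x)) ->
  (forall x, a <= x <= b -> has_deriv g x (g1 x)) ->
  (forall x, a <= x <= b ->
     has_deriv U x (2 * (f1 x * g x - g1 x * f x))) ->
  (forall x, a <= x <= b ->
     has_deriv J x (2 * (p^`().[x] * q.[x] - q^`().[x] * p.[x]))) ->
  (forall x, a <= x <= b -> has_deriv S x (s x)) ->
  (forall x, a <= x <= b -> `|p^`().[x]| + `|q^`().[x]| <= s x) ->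
  (forall x, a <= x <= b -> `|f x - p.[x]| <= th /\ `|g x - q.[x]| <= th) ->
  (forall x, a <= x <= b -> `|f1 x - p^`().[x]| <= th / (b - a) /\
                            `|g1 x - q^`().[x]| <= th / (b - a)) ->
  f a = p.[a] -> g a = q.[a] ->
  `|U b - U a - (J b - J a) + 2 * p.[a] * (g b - q.[b])
     - 2 * q.[a] * (f b - p.[b])| <= 6 * th * (S b - S a) + 4 * th ^+ 2.
Proof.
move=> ab df dg dU dJ dS ps c0 c1 fa ga.
have l0 : 0 < b - a by lra.
have th0 : 0 <= th by have [|h _] := c0 a; [lra|exact: le_trans h].
have Sx r x : a <= x <= b -> (forall z, a <= z <= b -> `|r^`().[z]| <= s z) ->
    `|r.[x] - r.[a]| <= S b - S a.
  move=> xab hr.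
  have s0 z : a <= z <= b -> 0 <= s z by move=> /hr; exact: le_trans.
  have h1 : S x - S a <= S b - S a.
    rewrite lerD2r -subr_ge0 -(subrr (0 : R)).
    apply: (@deriv_le _ (cst 0) S (cst 0) s) => //; try lra.
    - by move=> z _; exact: has_deriv_cst.
    - by move=> z zxb; apply: dS; lra.
    - by move=> z zxb; apply: s0; lra.
  apply: le_trans h1; apply: (@deriv_norm_le _ _ _ (fun z => r^`().[z]) s); first lra.
  - by move=> z _; exact: has_deriv_poly.
  - by move=> z zx; apply: dS; lra.
  - by move=> z zx; apply: hr; lra.
have Sp x : a <= x <= b -> `|p.[x] - p.[a]| <= S b - S a.
  by move=> xab; apply: Sx => // z /ps; apply: le_trans; rewrite lerDl.
have Sq x : a <= x <= b -> `|q.[x] - q.[a]| <= S b - S a.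
  by move=> xab; apply: Sx => // z /ps; apply: le_trans; rewrite lerDr.
set T := S b - S a.
have T0 : 0 <= T by apply: le_trans (Sp a _); rewrite ?normr_ge0// lexx ltW.
pose F x := U x - J x + 2 * p.[a] * (g x - q.[x]) - 2 * q.[a] * (f x - p.[x]).
(* The integral of the pointwise bound: the terms p' psi and q' phi give 2 th s, hence 2 th T; those
   with p - p(a) and q - q(a) give 4 th T; the products of errors give 4 th^2. *)
pose G x := 2 * th * S x + (4 * th * T + 4 * th ^+ 2) / (b - a) * x.
have -> : U b - U a - (J b - J a) + 2 * p.[a] * (g b - q.[b])
     - 2 * q.[a] * (f b - p.[b]) = F b - F a.
  by rewrite /F fa ga; ring.
have -> : 6 * th * T + 4 * th ^+ 2 = G b - G a.
  by rewrite /G /T; field; rewrite gt_eqF.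
apply: (@deriv_norm_le _ F G (fun x =>
   2 * (f1 x * g x - g1 x * f x) - 2 * (p^`().[x] * q.[x] - q^`().[x] * p.[x])
   + 2 * p.[a] * (g1 x - q^`().[x]) - 2 * q.[a] * (f1 x - p^`().[x]))
  (fun x => 2 * th * s x + (4 * th * T + 4 * th ^+ 2) / (b - a))); first exact: ltW.
- move=> x xab; apply: has_derivB; first apply: has_derivD.
  + by apply: has_derivB; [exact: dU|exact: dJ].
  + by apply: has_derivZ; apply: has_derivB; [exact: dg|exact: has_deriv_poly].
  + by apply: has_derivZ; apply: has_derivB; [exact: df|exact: has_deriv_poly].
- move=> x xab; apply: has_derivD; first by apply: has_derivZ; exact: dS.
  have := has_derivZ ((4 * th * T + 4 * th ^+ 2) / (b - a)) (has_deriv_id x).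
  by rewrite mulr1.
- move=> x xab.
  have [f0 g0] := c0 x xab; have [f1' g1'] := c1 x xab.
  have hp := Sp x xab; have hq := Sq x xab; have hs := ps x xab.
  set ph := f x - p.[x] in f0; set ps' := g x - q.[x] in g0.
  set dp := f1 x - p^`().[x] in f1'; set dq := g1 x - q^`().[x] in g1'.
  set e := th / (b - a) in f1' g1'.
  have e0 : 0 <= e by rewrite divr_ge0// ltW.
  have -> : (4 * th * T + 4 * th ^+ 2) / (b - a) = 4 * e * T + 4 * e * th.
    by rewrite /e; field; rewrite gt_eqF.
  have -> : 2 * (f1 x * g x - g1 x * f x) - 2 * (p^`().[x] * q.[x] - q^`().[x] * p.[x])
   + 2 * p.[a] * dq - 2 * q.[a] * dp =
   2 * (p^`().[x] * ps' - q^`().[x] * ph + dp * (q.[x] - q.[a]) - dq * (p.[x] - p.[a])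
     + dp * ps' - dq * ph) by rewrite /ph /ps' /dp /dq; ring.
  rewrite normrM ger0_norm//.
  have b1 : `|p^`().[x] * ps'| <= `|p^`().[x]| * th by rewrite normrM ler_wpM2l.
  have b2 : `|q^`().[x] * ph| <= `|q^`().[x]| * th by rewrite normrM ler_wpM2l.
  have b3 : `|dp * (q.[x] - q.[a])| <= e * T by rewrite normrM ler_pM.
  have b4 : `|dq * (p.[x] - p.[a])| <= e * T by rewrite normrM ler_pM.
  have b5 : `|dp * ps'| <= e * th by rewrite normrM ler_pM.
  have b6 : `|dq * ph| <= e * th by rewrite normrM ler_pM.
  have b7 : (`|p^`().[x]| + `|q^`().[x]|) * th <= s x * th by rewrite ler_wpM2r.
  have tr (y1 y2 y3 y4 y5 y6 : R) : `|y1 - y2 + y3 - y4 + y5 - y6| <=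
     `|y1| + `|y2| + `|y3| + `|y4| + `|y5| + `|y6|.
    do 5! [apply: le_trans (ler_normD _ _) _; rewrite ?normrN lerD2r].
    exact: lexx.
  have := tr (p^`().[x] * ps') (q^`().[x] * ph) (dp * (q.[x] - q.[a]))
    (dq * (p.[x] - p.[a])) (dp * ps') (dq * ph).
  lra.
Qed.

End Area.

(** * Prescribing the area across a single gap *)

Section Polynomials.
Variable R : realType.
Implicit Types (p q : {poly R}) (x c A B : R) (k m n : nat).

Lemma poly_primitive p : exists P : {poly R}, P^`() = p.
Proof.
exists (\poly_(i < (size p).+1) (p`_i.-1 / i%:R)).
apply/polyP => i; rewrite coef_deriv coef_poly ltnS.
case: ltnP => [_|h] /=; first by rewrite -[LHS]mulr_natr divfK// pnatr_eq0.
by rewrite mul0rn nth_default.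
Qed.

Definition flat (m : nat) p (c : R) := forall k, (k <= m)%N -> p^`(k).[c] = 0.

Lemma flat_factor m q c : flat m (q * ('X - c%:P) ^+ m.+1) c.
Proof.
move=> k; elim: k m q => [|k IH] m q km.
  by rewrite derivn0 !hornerE subrr expr0n /= mulr0.
case: m km => // m km; rewrite derivSn derivM deriv_exp /= derivXsubC mul1r.
have -> : q^`() * ('X - c%:P) ^+ m.+2 + q * (('X - c%:P) ^+ m.+1 *+ m.+2) =
   (q^`() * ('X - c%:P) + q *+ m.+2) * ('X - c%:P) ^+ m.+1.
  by rewrite [in LHS]exprS -[_ *+ _]mulr_natr -[q *+ _]mulr_natr; ring.
exact: IH.
Qed.

Lemma flatD m p q c : flat m p c -> flat m q c -> flat m (p + q) c.
Proof. by move=> hp hq k km; rewrite derivnD hornerD hp// hq// addr0. Qed.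

Lemma flatM m p q c : flat m p c -> flat m (q * p) c.
Proof.
move=> hp k km; have : forall j, (j <= k)%N -> p^`(j).[c] = 0.
  by move=> j jk; apply: hp; exact: leq_trans km.
elim: k q p {hp km} => [|k IH] q p H; first by rewrite derivn0 hornerM -[p]derivn0 H// mulr0.
rewrite derivSn derivM derivnD hornerD !IH ?addr0//.
- by move=> j jk; rewrite -derivSn H.
- by move=> j jk; rewrite H// ltnW.
Qed.

Definition bounded01 (n : nat) p (A : R) :=
  forall k, (k <= n)%N -> forall x, 0 <= x <= 1 -> `|p^`(k).[x]| <= A.

Lemma bounded01_ge0 n p A : bounded01 n p A -> 0 <= A.
Proof. by move=> H; apply: le_trans (H 0%N _ 0 _); rewrite // lexx ler01. Qed.

Lemma bounded01D n p q A B : bounded01 n p A -> bounded01 n q B ->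
  bounded01 n (p + q) (A + B).
Proof.
move=> hp hq k km x x01; rewrite derivnD hornerD.
by apply: le_trans (ler_normD _ _) _; rewrite lerD ?hp ?hq.
Qed.

Lemma bounded01Z n p A c : bounded01 n p A -> bounded01 n (c *: p) (`|c| * A).
Proof.
by move=> hp k km x x01; rewrite derivnZ hornerZ normrM ler_wpM2l ?hp.
Qed.

(** The factor 2^n is the sum of the binomial coefficients in Leibniz' rule. *)
Lemma bounded01M n p q A B : bounded01 n p A -> bounded01 n q B ->
  bounded01 n (p * q) (2 ^+ n * (A * B)).
Proof.
elim: n p q => [|n IH] p q hp hq k.
  rewrite leqn0 => /eqP -> x x01; rewrite derivn0 hornerM normrM expr0 mul1r.
  by rewrite ler_pM//; [rewrite -[p]derivn0 hp|rewrite -[q]derivn0 hq].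
have A0 := bounded01_ge0 hp; have B0 := bounded01_ge0 hq.
have hp' : bounded01 n p A by move=> j jn; apply: hp; exact: leqW.
have hq' : bounded01 n q B by move=> j jn; apply: hq; exact: leqW.
case: k => [|k] kn x x01.
  apply: le_trans (IH p q hp' hq' 0%N _ x x01) _ => //.
  by rewrite ler_wpM2r ?mulr_ge0// ler_eXn2l// ltr1n.
rewrite derivSn derivM.
have -> : 2 ^+ n.+1 * (A * B) = 2 ^+ n * (A * B) + 2 ^+ n * (A * B) by rewrite exprS; ring.
suff H : bounded01 n (p^`() * q + p * q^`()) (2 ^+ n * (A * B) + 2 ^+ n * (A * B)).
  exact: H.
by apply: bounded01D; apply: IH => // j jn; rewrite -derivSn; [exact: hp|exact: hq].
Qed.

Lemma bounded01_exists n p : exists A, bounded01 n p A.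
Proof.
have H k : exists A, forall x : R, 0 <= x <= 1 -> `|p^`(k).[x]| <= A.
  exists (\sum_(i < size p^`(k)) `|p^`(k)`_i|) => x /andP[x0 x1].
  rewrite horner_coef; apply: le_trans (ler_norm_sum _ _ _) _.
  apply: ler_sum => i _; rewrite normrM ler_piMr// normrX (ger0_norm x0).
  exact: exprn_ile1.
elim: n => [|n [A hA]].
  by have [A hA] := H 0%N; exists A => k; rewrite leqn0 => /eqP ->.
have [B hB] := H n.+1; exists (Num.max A B) => k.
rewrite leq_eqVlt => /predU1P[->|kn] x x01; rewrite le_max.
  by rewrite hB ?orbT.
by rewrite hA.
Qed.

Lemma derivn_mulXsubC k q c :
  (q * ('X - c%:P))^`(k.+1) = q^`(k) *+ k.+1 + q^`(k.+1) * ('X - c%:P).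
Proof.
rewrite mulrBr -[q * 'X]addr0 -(polyC0 R) derivnB derivnMXaddC.
by rewrite [q * c%:P]mulrC mul_polyC derivnZ mulrBr addrA -mul_polyC [_ * c%:P]mulrC.
Qed.

(** A quantitative form of Lagrange interpolation, with C depending only on n and d. After
    subtracting p(s n) and dividing by X - s n, the quotient q is at most 2 B / d at the other
    nodes, and the induction applies to it. The three terms of the constant bound p(s n), q^(k) (x -
    s n) and k q^(k-1). *)
Lemma poly_bound_nodes n (d : R) : 0 < d -> exists2 C : R, 0 <= C &
  forall p (s : nat -> R) B, (size p <= n)%N ->
    (forall i, (i < n)%N -> 0 <= s i <= 1 /\ `|p.[s i]| <= B) ->
    (forall i j, (i < j < n)%N -> d <= `|s i - s j|) ->
    forall k x, 0 <= x <= 1 -> `|p^`(k).[x]| <= C * B.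
Proof.
move=> d0; elim: n => [|n [C C0 IH]].
  exists 0 => // p s B; rewrite leqn0 size_poly_eq0 => /eqP -> _ _ k x _.
  by rewrite linear0 horner0 normr0 mul0r.
exists (1 + C * (2 / d) + n.+1%:R * (C * (2 / d))).
  have h : 0 <= C * (2 / d) by rewrite mulr_ge0// divr_ge0// ltW.
  by rewrite !addr_ge0// mulr_ge0.
move=> p s B sp Hs Hd k x x01.
have [sn01 psn] := Hs n (leqnn _).
have B0 : 0 <= B := le_trans (normr_ge0 _) psn.
have [q Hq] : exists q, p - p.[s n]%:P = q * ('X - (s n)%:P).
  by apply/factor_theorem; rewrite rootE !hornerE subrr.
have pE : p = p.[s n]%:P + q * ('X - (s n)%:P) by rewrite -Hq subrKC.
have sq : (size q <= n)%N.
  have [->|q0] := eqVneq q 0; first by rewrite size_poly0.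
  have : (size (q * ('X - (s n)%:P))%R <= n.+1)%N.
    rewrite -Hq (leq_trans (size_polyD _ _))// geq_max sp /= size_polyN.
    exact: leq_trans (size_polyC_leq1 _) _.
  by rewrite size_Mmonic ?monicXsubC// size_XsubC addn2.
have Hq' := IH q s (2 / d * B) sq.
have {}Hq' j : `|q^`(j).[x]| <= C * (2 / d * B).
  apply: Hq' => // [i im|i j' /andP[ij jn]]; last by apply: Hd; rewrite ij ltnS ltnW.
  have [si psi] := Hs i (leqW im); split => //.
  have di : d <= `|s i - s n| by apply: Hd; rewrite im /=.
  have : `|q.[s i]| * `|s i - s n| <= 2 * B.
    rewrite -normrM (_ : q.[s i] * (s i - s n) = p.[s i] - p.[s n]).
      by apply: le_trans (ler_normB _ _) _; lra.
    by rewrite [in p.[s i]]pE !hornerE; ring.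
  move=> h; rewrite mulrAC ler_pdivlMr//.
  by apply: le_trans h; rewrite ler_wpM2l.
have dE : p^`(k).[x] = (if k == 0%N then p.[s n] else 0) + q^`(k).[x] * (x - s n)
    + (q^`(k.-1).[x]) *+ k.
  case: k => [|k]; rewrite ?[_ == 0%N]/= ?[_.-1]/=.
    by rewrite !derivn0 mulr0n addr0 [in LHS]pE !hornerE.
  by rewrite [in LHS]pE derivnD derivnC derivn_mulXsubC !hornerE hornerMn addrC.
have hk : `|q^`(k.-1).[x] *+ k| <= n.+1%:R * (C * (2 / d * B)).
  have [kn|nk] := leqP k n.+1.
    rewrite -mulr_natl normrM ger0_norm// ler_pM// ler_nat//.
  rewrite derivn_poly0 ?horner0 ?mul0rn ?normr0.
    by rewrite !mulr_ge0// invr_ge0 ltW.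
  by rewrite (leq_trans sq)// -ltnS (ltn_predK nk) ltnW.
have hx : `|x - s n| <= 1 by rewrite ler_norml; lra.
rewrite dE; apply: le_trans (ler_normD _ _) _; rewrite mulrDl.
apply: lerD; last by rewrite -!mulrA in hk *.
apply: le_trans (ler_normD _ _) _; rewrite mulrDl mul1r; apply: lerD.
  by case: ifP => _; rewrite ?normr0.
rewrite normrM -!mulrA -[leRHS]mulr1; apply: ler_pM => //.
by rewrite [2 * _]mulrA.
Qed.

End Polynomials.

Section UnitGap.
Variable R : realType.
Implicit Types (p q : {poly R}) (x c A B : R) (k m n : nat).

(** The integral over [0, 1] through some primitive; [int01E] shows that any primitive gives the
    same value. *)
Definition int01 p : R :=
  (sval (cid (poly_primitive p))).[1] - (sval (cid (poly_primitive p))).[0].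

Lemma int01E p E : E^`() = p -> int01 p = E.[1] - E.[0].
Proof.
move=> dE; rewrite /int01; case: cid => F /= dF.
apply/eqP; rewrite -subr_eq0.
have := @const_of_deriv0 R (fun x => (F - E).[x]) 1 0 _.
rewrite !hornerD !hornerN => h; apply/eqP.
suff -> : F.[1] - F.[0] - (E.[1] - E.[0]) = (F.[1] - E.[1]) - (F.[0] - E.[0]).
  rewrite h ?subrr// => x; have := has_deriv_poly (F - E) x.
  by rewrite derivB dE dF subrr horner0.
by ring.
Qed.

Lemma int01D p q : int01 (p + q) = int01 p + int01 q.
Proof.
have [P dP] := poly_primitive p; have [Q dQ] := poly_primitive q.
rewrite (int01E dP) (int01E dQ) (@int01E _ (P + Q)) ?derivD ?dP ?dQ//.
by rewrite !hornerD; ring.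
Qed.

Lemma int01Z c p : int01 (c *: p) = c * int01 p.
Proof.
have [P dP] := poly_primitive p.
by rewrite (int01E dP) (@int01E _ (c *: P)) ?derivZ ?dP// !hornerZ; ring.
Qed.

Lemma int01_bound p B : (forall x, 0 <= x <= 1 -> `|p.[x]| <= B) -> `|int01 p| <= B.
Proof.
move=> H; have [P dP] := poly_primitive p; rewrite (int01E dP).
have := @deriv_bound R (horner P) (horner p) 0 1 B 1 0.
rewrite subr0 normr1 mulr1; apply; rewrite ?lexx ?ler01// => z _.
by rewrite -dP; exact: has_deriv_poly.
Qed.

Lemma int01_ge0 p : (forall x, 0 <= x <= 1 -> 0 <= p.[x]) -> 0 <= int01 p.
Proof.
move=> H; have [P dP] := poly_primitive p; rewrite (int01E dP).
rewrite -[X in X <= _](subrr (0 : R)).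
apply: (@deriv_le _ (fun=> 0) (horner P) (fun=> 0) (horner p)) => //.
- by move=> x _; exact: has_deriv_cst.
- by move=> x _; rewrite -dP; exact: has_deriv_poly.
Qed.

Definition bump m : {poly R} := ('X * (1 - 'X)) ^+ m.+1.

Lemma flat_bump0 m q : flat m (q * bump m) 0.
Proof.
rewrite /bump exprMn mulrC mulrAC -mulrA -[X in X ^+ m.+1 * _]subr0 mulrC.
exact: flat_factor.
Qed.

Lemma flat_bump1 m q : flat m (q * bump m) 1.
Proof.
rewrite /bump (_ : 'X * (1 - 'X) = (- 'X) * ('X - 1%:P)); last by rewrite polyC1; ring.
by rewrite exprMn mulrA; exact: flat_factor.
Qed.

Lemma bump_ge0 m x : 0 <= x <= 1 -> 0 <= (bump m).[x].
Proof.
by move=> x01; rewrite /bump !hornerE exprn_ge0// mulr_ge0//; lra.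
Qed.

Lemma bump_mid m x : 4^-1 <= x <= 3 / 4 -> (3 / 16) ^+ m.+1 <= (bump m).[x].
Proof.
move=> xm; rewrite /bump horner_exp hornerM hornerX hornerD hornerN hornerX hornerC.
have h : 3 / 16 <= x * (1 - x) by nra.
apply: lerXn2r; rewrite ?nnegrE//; lra.
Qed.

(* On each of [n] disjoint subintervals of [1/4, 3/4] some value of p^2 is at most a multiple of the
   integral, and n separated values control a polynomial of size n. *)
Lemma bump_coercive m n : exists2 C : R, 0 < C & forall p, (size p <= n)%N ->
  forall k x, 0 <= x <= 1 -> p^`(k).[x] ^+ 2 <= C * int01 (bump m * p ^+ 2).
Proof.
(* Length of the node intervals [1/4 + 2ih, 1/4 + (2i+1)h], i < n: they lie in [1/4, 3/4] and are h
   apart. *)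
pose h : R := (4 * n.+1%:R)^-1.
have h0 : 0 < h by rewrite invr_gt0 mulr_gt0.
have hn : 4 * (n.+1%:R * h) = 1 by rewrite /h mulrA divff// mulf_neq0// pnatr_eq0.
pose e0 : R := (3 / 16) ^+ m.+1.
have e00 : 0 < e0 by rewrite exprn_gt0//; lra.
have [C C0 HC] := poly_bound_nodes n h0.
exists ((C + 1) ^+ 2 / (e0 * h)); first by apply: divr_gt0; [apply: exprn_gt0; lra|exact: mulr_gt0].
move=> p sp k x x01.
set L := int01 _.
have [E dE] := poly_primitive (bump m * p ^+ 2).
have LE : L = E.[1] - E.[0] by exact: int01E.
have hE y : (bump m * p ^+ 2).[y] = (bump m).[y] * p.[y] ^+ 2.
  by rewrite hornerM [(p ^+ 2).[y]]horner_exp.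
have ge0 y : 0 <= y <= 1 -> 0 <= (bump m * p ^+ 2).[y].
  by move=> y01; rewrite hE mulr_ge0 ?bump_ge0// sqr_ge0.
have L0 : 0 <= L by apply: int01_ge0.
have Emon y z : 0 <= y -> y <= z -> z <= 1 -> E.[y] <= E.[z].
  move=> y0 yz z1; rewrite -subr_ge0 -[X in X <= _](subrr (0 : R)).
  apply: (@deriv_le _ (fun=> 0) (horner E) (fun=> 0) (horner E^`())) => // t tyz.
  - exact: has_deriv_cst.
  - exact: has_deriv_poly.
  - by rewrite dE; apply: ge0; lra.
have node (i : nat) : exists c, (i < n)%N ->
    4^-1 + 2 * i%:R * h <= c <= 4^-1 + (2 * i%:R + 1) * h /\ p.[c] ^+ 2 <= L / (e0 * h).
  case: (ltnP i n) => [ilt|_]; last by exists 0.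
  have ih : (2 * i%:R + 1) * h <= 2^-1.
    have : i.+1%:R * h <= n.+1%:R * h by rewrite (ler_wpM2r (ltW h0))// ler_nat ltnW.
    by rewrite -(natr1 i) => ?; nra.
  have ih0 : 0 <= i%:R * h by rewrite mulr_ge0// (ltW h0).
  have [||c hc Ec] := @mvt _ (horner E) (horner E^`()) (4^-1 + 2 * i%:R * h) (4^-1 + (2 * i%:R + 1) * h).
  - nra.
  - by move=> t _; exact: has_deriv_poly.
  exists c => _; split => //.
  have el : E.[4^-1 + (2 * i%:R + 1) * h] - E.[4^-1 + 2 * i%:R * h] <= L.
    rewrite LE; apply: lerB; apply: Emon; nra.
  rewrite Ec dE hE in el.
  rewrite ler_pdivlMr ?mulr_gt0//; apply: le_trans el.
  have -> : 4^-1 + (2 * i%:R + 1) * h - (4^-1 + 2 * i%:R * h) = h by ring.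
  rewrite mulrA; apply: (ler_wpM2r (ltW h0)).
  by rewrite mulrC ler_wpM2r ?sqr_ge0// bump_mid//; nra.
have [s Hs] := choice node.
pose B := Num.sqrt (L / (e0 * h)).
have B2 : B ^+ 2 = L / (e0 * h) by rewrite sqr_sqrtr// divr_ge0// ltW// mulr_gt0.
have pk : `|p^`(k).[x]| <= C * B.
  apply: (HC p s B sp) => // [i ilt|i j /andP[ij jn]].
    have [si psi] := Hs i ilt.
    have ih : (2 * i%:R + 1) * h <= 2^-1.
      have : i.+1%:R * h <= n.+1%:R * h by rewrite (ler_wpM2r (ltW h0))// ler_nat ltnW.
      by rewrite -(natr1 i) => ?; nra.
    have ih0 : 0 <= i%:R * h by rewrite mulr_ge0// (ltW h0).
    split; first nra.
    by rewrite -sqrtr_sqr /B ler_wsqrtr.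
  have [si _] := Hs i (ltn_trans ij jn); have [sj _] := Hs j jn.
  have : i.+1%:R * h <= j%:R * h by rewrite (ler_wpM2r (ltW h0))// ler_nat.
  rewrite -(natr1 i) distrC => ?; apply: le_trans (ler_norm _); nra.
rewrite -real_normK ?num_real//.
apply: (@le_trans _ _ ((C * B) ^+ 2)); first by rewrite lerXn2r// nnegrE mulr_ge0// sqrtr_ge0.
rewrite exprMn B2 mulrA mulrAC ler_wpM2r//.
rewrite ler_wpM2r// ?invr_ge0 ?mulr_ge0 ?(ltW h0) ?(ltW e00)//.
by apply: lerXn2r; rewrite ?nnegrE; lra.
Qed.

(** The sign condition makes the discriminant nonnegative. For al > 0 the root with be t >= 0 is
    taken: then al t^2 <= D, a bound on t that does not involve [be]. *)
Lemma quadratic_root (al be D : R) : al != 0 -> 0 <= al * D ->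
  exists t, al * t ^+ 2 + be * t = D /\ t ^+ 2 <= D / al.
Proof.
wlog al0 : al be D / 0 < al.
  move=> W an0 aD; have [|al0] := ltP 0 al; first by move=> h; exact: W.
  have [||| t [e1 e2]] := W (- al) (- be) (- D).
  - by rewrite oppr_gt0 lt_neqAle an0.
  - by rewrite oppr_eq0.
  - by rewrite mulrNN.
  exists t; split; last by move: e2; rewrite invrN mulrNN.
  by apply: oppr_inj; rewrite -e1; ring.
move=> an0 aD.
have D0 : 0 <= D by rewrite pmulr_rge0 in aD.
pose s := Num.sqrt (be ^+ 2 + 4 * al * D).
have disc : 0 <= be ^+ 2 + 4 * al * D by rewrite addr_ge0 ?sqr_ge0// -mulrA mulr_ge0.
have s2 : s ^+ 2 = be ^+ 2 + 4 * al * D by rewrite sqr_sqrtr.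
have sb : `|be| <= s by rewrite -sqrtr_sqr ler_wsqrtr// lerDl -mulrA mulr_ge0.
have root (e : R) : e ^+ 2 = 1 -> al * ((e * s - be) / (2 * al)) ^+ 2 + be * ((e * s - be) / (2 * al)) = D.
  move=> e2; rewrite (_ : _ + _ = (e ^+ 2 * s ^+ 2 - be ^+ 2) / (4 * al)); last by field.
  by rewrite e2 s2; field.
have bound t : al * t ^+ 2 + be * t = D -> 0 <= be * t -> t ^+ 2 <= D / al.
  by move=> <- bt; rewrite ler_pdivlMr// mulrC lerDl.
have [b0|b0] := leP 0 be.
  exists ((1 * s - be) / (2 * al)); have r := root 1 (expr1n _ _); split => //.
  apply: bound r _; rewrite mulr_ge0// divr_ge0//; last by lra.
  by rewrite mul1r subr_ge0 (le_trans (ler_norm _)).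
exists ((-1 * s - be) / (2 * al)).
have r : al * ((-1 * s - be) / (2 * al)) ^+ 2 + be * ((-1 * s - be) / (2 * al)) = D.
  by apply: root; rewrite sqrrN expr1n.
split => //; apply: bound r _.
rewrite nmulr_rge0// pmulr_lle0 ?invr_gt0; last by lra.
rewrite ltr0_norm// in sb; lra.
Qed.

Lemma bounded01_le n p A B : bounded01 n p A -> A <= B -> bounded01 n p B.
Proof. by move=> H AB k kn x x01; apply: le_trans AB; exact: H. Qed.

Lemma int01_bump_gt0 m : 0 < int01 (bump m).
Proof.
have [C C0 H] := bump_coercive m 1.
have := H 1 _ 0%N 0; rewrite size_poly1 derivn0 expr1n mulr1 hornerC expr1n lexx ler01.
move=> /(_ isT isT) h; rewrite -(pmulr_rgt0 _ C0).
exact: lt_le_trans h.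
Qed.

Lemma bump_sqr m : bump m ^+ 2 = bump (2 * m).+1.
Proof. by rewrite /bump -exprM; congr (_ ^+ _); lia. Qed.

Lemma int01_derivM p q : p.[0] = 0 -> p.[1] = 0 ->
  int01 (p^`() * q + p * q^`()) = 0.
Proof.
by move=> p0 p1; rewrite (@int01E _ (p * q)) ?derivM// !hornerM p0 p1 !mul0r subrr.
Qed.

(** Adding such a polynomial leaves the m-jets at 0 and 1 unchanged; the bound at order m+1 is what
    controls the modulus of the m-th derivative inside a gap. *)
Definition flat_pair m A p := [/\ flat m p 0, flat m p 1 & bounded01 m.+1 p A].

Lemma flat_pairZ m A p c : flat_pair m A p -> flat_pair m (`|c| * A) (c *: p).
Proof.
by case=> f0 f1 b; split; rewrite -?mul_polyC; [exact: flatM|exact: flatM|rewrite mul_polyC; exact: bounded01Z].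
Qed.

Lemma flat_pair_le m A B p : flat_pair m A p -> A <= B -> flat_pair m B p.
Proof. by case=> f0 f1 b AB; split => //; exact: bounded01_le AB. Qed.

Lemma flat_pair0 m A : 0 <= A -> flat_pair m A 0.
Proof.
by move=> A0; split => [k _|k _|k _ x _]; rewrite linear0 horner0 ?normr0.
Qed.

Lemma flat_pair_bump m q A B : bounded01 m.+1 (bump m) A -> bounded01 m.+1 q B ->
  flat_pair m (2 ^+ m.+1 * (B * A)) (q * bump m).
Proof.
move=> hA hB; split; [exact: flat_bump0|exact: flat_bump1|exact: bounded01M].
Qed.

(** P and Q stand for the derivatives of the planar components, p1 and p2 for those of the Taylor
    polynomials; the integral is the change of area caused by (phi, psi). Let La be the L2 norm of
    p1 with weight [bump m]. If La is large, phi = 0 and psi proportional to p1 [bump] / La change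
    the area by about La per unit, while D is at most C (1 + c La). If La is small, D is bounded and
    the loop (t b, s t X b), with b the bump and s a sign, gives a quadratic equation for t. *)
Lemma perturb_half m n C : 0 <= C -> exists2 C' : R, 0 <= C' &
  forall (P Q p1 p2 : {poly R}) (D : R), (size p1 <= n)%N -> (size p2 <= n)%N ->
    (forall x, 0 <= x <= 1 -> `|P.[x] - p1.[x]| <= C) ->
    int01 (bump m * p2 ^+ 2) <= int01 (bump m * p1 ^+ 2) ->
    (forall B, (forall x, 0 <= x <= 1 -> `|p1.[x]| <= B /\ `|p2.[x]| <= B) ->
       `|D| <= C * (1 + B)) ->
    exists phi psi, [/\ flat_pair m C' phi, flat_pair m C' psi &
      4 * int01 (P * psi - Q * phi + phi^`() * psi) = D].
Proof.
move=> C0; have [c2 c20 Hc] := bump_coercive m n.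
pose c := Num.sqrt c2.
have c0 : 0 <= c by exact: sqrtr_ge0.
have [A bA] := bounded01_exists m.+1 (bump m).
have A0 := bounded01_ge0 bA.
have [A3 bA3] := bounded01_exists m.+1 ('X : {poly R}).
pose A2 := 2 ^+ m.+1 * (c * A).
have A20 : 0 <= A2 by rewrite mulr_ge0 ?exprn_ge0// mulr_ge0.
pose A4 := 2 ^+ m.+1 * (A3 * A).
have fX : flat_pair m A4 ('X * bump m) by exact: flat_pair_bump.
have A40 : 0 <= A4 by case: fX => _ _ /bounded01_ge0.
have fb : flat_pair m A (bump m).
  by have h0 := @flat_bump0 m 1; have h1 := @flat_bump1 m 1; rewrite mul1r in h0 h1; split.
pose r := int01 (bump m ^+ 2) / 2.
have r0 : 0 < r by rewrite divr_gt0// bump_sqr int01_bump_gt0.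
(* Above this threshold half of La absorbs the error C A2 made in replacing P by p1; the added 1
   keeps La at least 1. *)
pose L0 := 2 * C * A2 + 1.
have L01 : 1 <= L0 by rewrite lerDr !mulr_ge0.
pose D0 := C * (1 + c * L0).
have D00 : 0 <= D0 by rewrite mulr_ge0// addr_ge0// mulr_ge0//; lra.
(* Bounds |t| in the quadratic case, where t^2 <= D0 / (4 r). *)
pose tau := 1 + D0 / (4 * r).
have tau0 : 0 <= tau by rewrite addr_ge0// divr_ge0//; lra.
have K0 : 0 <= C * (1 + c) * A2 by rewrite mulr_ge0// mulr_ge0//; lra.
have K1 : 0 <= C * (1 + c) * A2 + tau * A + tau * A4.
  have h1 : 0 <= tau * A by rewrite mulr_ge0.
  have h2 : 0 <= tau * A4 by rewrite mulr_ge0.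
  lra.
exists (C * (1 + c) * A2 + tau * A + tau * A4) => //.
move=> P Q p1 p2 D s1 s2 hP h21 hD.
have ge0 p : 0 <= int01 (bump m * p ^+ 2).
  by apply: int01_ge0 => x x01; rewrite hornerM mulr_ge0 ?bump_ge0// horner_exp sqr_ge0.
pose La := Num.sqrt (int01 (bump m * p1 ^+ 2)).
have La0 : 0 <= La by exact: sqrtr_ge0.
have La2 : int01 (bump m * p1 ^+ 2) = La * La by rewrite -expr2 sqr_sqrtr.
have b1 k x : 0 <= x <= 1 -> `|p1^`(k).[x]| <= c * La.
  by move=> x01; rewrite -sqrtr_sqr -(sqrtrM _ (ltW c20)) ler_wsqrtr// Hc.
have b2 k x : 0 <= x <= 1 -> `|p2^`(k).[x]| <= c * La.
  move=> x01; rewrite -sqrtr_sqr -(sqrtrM _ (ltW c20)) ler_wsqrtr//.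
  apply: le_trans (Hc _ s2 k x x01) _; exact: ler_wpM2l (ltW c20) _ _ h21.
have {}hD : `|D| <= C * (1 + c * La).
  by apply: hD => x x01; split; [have := b1 0%N x x01|have := b2 0%N x x01]; rewrite derivn0.
have [LaL|LaL] := leP L0 La.
  have Lp : 0 < La by lra.
  pose psi0 := La^-1 *: (p1 * bump m).
  have f0 : flat_pair m A2 psi0.
    have h : flat_pair m (2 ^+ m.+1 * (c * La * A)) (p1 * bump m).
      by apply: flat_pair_bump => // k _ x; exact: b1.
    apply: flat_pair_le (flat_pairZ La^-1 h) _.
    rewrite ger0_norm ?invr_ge0//; apply: le_of_eq; rewrite /A2.
    by field; rewrite gt_eqF.
  pose ka := int01 (P * psi0).
  have kaE : ka = La + int01 ((P - p1) * psi0).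
    have -> : La = int01 (p1 * psi0).
      rewrite /psi0 -scalerAr (_ : p1 * (p1 * bump m) = bump m * p1 ^+ 2); last by ring.
      by rewrite int01Z La2 mulKf// gt_eqF.
    by rewrite -int01D -mulrDl addrC subrK.
  have e1 : `|int01 ((P - p1) * psi0)| <= C * A2.
    apply: int01_bound => x x01; rewrite hornerM normrM ler_pM//.
      by rewrite hornerD hornerN hP.
    by case: f0 => _ _ /(_ 0%N isT x x01).
  have ka2 : La / 2 <= ka.
    move: e1; rewrite ler_norml kaE => /andP[e1 _]; rewrite /L0 in LaL; lra.
  have kap : 0 < ka by lra.
  exists 0, ((D / (4 * ka)) *: psi0); split.
  - exact: flat_pair0.
  - apply: flat_pair_le (flat_pairZ _ f0) _.
    rewrite -addrA; apply: ler_wpDr; first by rewrite addr_ge0// mulr_ge0.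
    apply: ler_wpM2r => //.
    rewrite normrM normfV (ger0_norm (_ : 0 <= 4 * ka)); last by lra.
    rewrite ler_pdivrMr; last by lra.
    apply: le_trans hD _; rewrite -mulrA ler_wpM2l//; nra.
  - rewrite mulr0 subr0 deriv0 mul0r addr0 -scalerAr int01Z -/ka.
    by field; rewrite gt_eqF.
have {}hD : `|D| <= D0.
  by apply: le_trans hD _; rewrite ler_wpM2l// lerD2l ler_wpM2l// ltW.
(* The orientation of the loop is chosen so that its quadratic coefficient [al] has the sign of
   D. *)
pose s : R := if 0 <= D then -1 else 1.
have sn : `|s| = 1 by rewrite /s; case: ifP => _; rewrite ?normrN normr1.
(* The loop encloses a nonzero area: integrating (X b^2)' = b^2 + 2 X b b' expresses it through the
   integral of b^2, which is positive. *)
have kaE : int01 ((bump m)^`() * ('X * bump m)) = - r.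
  have : int01 (('X * bump m ^+ 2)^`()) = 0.
    have [_ f1 _] := fb; have := f1 0%N isT; rewrite derivn0 => h.
    rewrite (@int01E _ ('X * bump m ^+ 2))// !hornerM !hornerX.
    by rewrite h !mulr0 mul0r subrr.
  rewrite derivM derivX mul1r expr2 derivM.
  rewrite (_ : _ + _ = bump m ^+ 2 + 2 *: ((bump m)^`() * ('X * bump m))); last first.
    by rewrite -mul_polyC polyCD polyC1; ring.
  rewrite int01D int01Z /r => h; lra.
pose al := 4 * s * - r.
pose be := 4 * (s * int01 (P * ('X * bump m)) - int01 (Q * bump m)).
have alN : `|al| = 4 * r.
  by rewrite /al !normrM sn normrN (gtr0_norm r0) mulr1 normr_nat.
have al0 : al != 0 by rewrite -normr_eq0 alN gt_eqF// mulr_gt0.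
have aD : 0 <= al * D by rewrite /al /s; case: ifP => D1; nra.
have [t [tE t2]] := quadratic_root be al0 aD.
have tt : `|t| <= tau.
  have : `|D / al| <= D0 / (4 * r).
    rewrite normrM normfV alN ler_wpM2r//.
    by rewrite invr_ge0; lra.
  move=> /(le_trans (ler_norm _)) /(le_trans t2); rewrite -real_normK ?num_real// /tau => h.
  nra.
exists (t *: bump m), ((s * t) *: ('X * bump m)); split.
- apply: flat_pair_le (flat_pairZ _ fb) _.
  have : `|t| * A <= tau * A by rewrite ler_wpM2r.
  have : 0 <= tau * A4 by rewrite mulr_ge0.
  lra.
- apply: flat_pair_le (flat_pairZ _ fX) _; rewrite normrM sn mul1r.
  have : `|t| * A4 <= tau * A4 by rewrite ler_wpM2r.
  have : 0 <= tau * A by rewrite mulr_ge0.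
  lra.
- rewrite -tE derivZ (_ : _ + _ = (s * t) *: (P * ('X * bump m)) + (- t) *: (Q * bump m)
      + (s * t ^+ 2) *: ((bump m)^`() * ('X * bump m))); last first.
    by rewrite -!mul_polyC polyCN !polyCM; ring.
  by rewrite !int01D !int01Z kaE /al /be; ring.
Qed.

(** Exchanging the two coordinates reverses the sign of the area, up to the derivative of phi psi,
    which integrates to 0; hence p1 may be taken to have the larger norm. *)
Lemma perturb m n C : 0 <= C -> exists2 C' : R, 0 <= C' &
  forall (P Q p1 p2 : {poly R}) (D : R), (size p1 <= n)%N -> (size p2 <= n)%N ->
    (forall x, 0 <= x <= 1 -> `|P.[x] - p1.[x]| <= C /\ `|Q.[x] - p2.[x]| <= C) ->
    (forall B, (forall x, 0 <= x <= 1 -> `|p1.[x]| <= B /\ `|p2.[x]| <= B) ->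
       `|D| <= C * (1 + B)) ->
    exists phi psi, [/\ flat_pair m C' phi, flat_pair m C' psi &
      4 * int01 (P * psi - Q * phi + phi^`() * psi) = D].
Proof.
move=> C0; have [C' C'0 H] := perturb_half m n C0; exists C' => //.
move=> P Q p1 p2 D s1 s2 hPQ hD.
have [h|/ltW h] := leP (int01 (bump m * p2 ^+ 2)) (int01 (bump m * p1 ^+ 2)).
  by apply: (H P Q p1 p2) => // x /hPQ[].
have [||psi [phi [fpsi fphi E]]] := H Q P p2 p1 (- D) s2 s1 _ h.
- by move=> x /hPQ[].
- by move=> B hB; rewrite normrN; apply: hD => x /hB[].
exists phi, psi; split => //.
have z : int01 (phi^`() * psi + phi * psi^`()) = 0.
  case: fphi => f0 f1 _; apply: int01_derivM; rewrite -[phi]derivn0; [exact: f0|exact: f1].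
rewrite (_ : _ + _ = (-1) *: (Q * phi - P * psi + psi^`() * phi) + (phi^`() * psi + phi * psi^`())).
  by rewrite int01D z int01Z; lra.
by rewrite scaleN1r; ring.
Qed.

(** A normalised primitive of the bump. With it, F0 + s (F1 - F0) has the m-jet of F0 at 0 and that
    of F1 at 1. *)
Lemma step_poly m : exists s : {poly R}, flat m s 0 /\ flat m (s - 1) 1.
Proof.
have [P dP] := poly_primitive (bump m).
have i0 := int01_bump_gt0 m; set c := int01 _ in i0.
have cE : c = P.[1] - P.[0] by exact: int01E.
have f0 := @flat_bump0 m 1; have f1 := @flat_bump1 m 1; rewrite mul1r in f0 f1.
exists (c^-1 *: (P - P.[0]%:P)); split => -[|k] km.
- by rewrite derivn0 !hornerE subrr mulr0.
- by rewrite derivnZ derivSn derivB dP derivC subr0 hornerZ f0 ?mulr0// ltnW.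
- by rewrite derivn0 hornerD hornerN hornerZ hornerD hornerN !hornerC -cE mulVf ?subrr// gt_eqF.
- rewrite derivnB derivnZ derivSn derivB dP derivC subr0.
  by rewrite derivSn -polyC1 derivC linear0 subr0 hornerZ f1 ?mulr0// ltnW.
Qed.

(** The density of the swept area, that is, the derivative of the height over (P, Q). *)
Definition area (P Q : {poly R}) : {poly R} := 2 *: (P^`() * Q - Q^`() * P).

Lemma has_deriv_area_primitive (P Q E : {poly R}) x : E^`() = area P Q ->
  has_deriv (horner E) x (2 * (P^`().[x] * Q.[x] - Q^`().[x] * P.[x])).
Proof.
move=> dE; have := has_deriv_poly E x.
by rewrite dE hornerZ hornerD hornerN !hornerM.
Qed.

(** The interpolation (P0, Q0) between the end jets stays close to (T1, T2), so by [area_stability]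
    its area misses D by O(1 + B); [perturb] supplies exactly the missing amount without touching
    the end jets. *)
Lemma gap_unit m C : 0 <= C -> exists2 C' : R, 0 <= C' &
  forall (F0 F1 G0 G1 T1 T2 : {poly R}) (D : R),
    (size T1 <= m.+1)%N -> (size T2 <= m.+1)%N ->
    bounded01 m.+1 (F1 - F0) C -> bounded01 m.+1 (G1 - G0) C ->
    bounded01 m.+1 (F0 - T1) C -> bounded01 m.+1 (G0 - T2) C ->
    F0.[0] = T1.[0] -> G0.[0] = T2.[0] ->
    (forall B, (forall x, 0 <= x <= 1 -> `|T1^`().[x]| <= B /\ `|T2^`().[x]| <= B) ->
      `|D - int01 (area T1 T2) + 2 * T1.[0] * (G1.[1] - T2.[1])
        - 2 * T2.[0] * (F1.[1] - T1.[1])| <= C * (1 + B)) ->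
    exists P Q : {poly R},
      [/\ flat m (P - F0) 0 /\ flat m (Q - G0) 0,
          flat m (P - F1) 1 /\ flat m (Q - G1) 1,
          bounded01 m.+1 (P - F0) C' /\ bounded01 m.+1 (Q - G0) C' &
          int01 (area P Q) = D].
Proof.
move=> C0; have [s [s0 s1]] := step_poly m.
have [S bS] := bounded01_exists m.+1 s.
have S0 := bounded01_ge0 bS.
pose C1 := 2 ^+ m.+1 * (S * C).
have C10 : 0 <= C1 by rewrite mulr_ge0 ?exprn_ge0// mulr_ge0.
pose th := C1 + C.
have th0 : 0 <= th by rewrite addr_ge0.
(* C comes from the hypothesis on D, 12 th and 4 th^2 from [area_stability] with S x = 2 B x. *)
pose C2 := C + 12 * th + 4 * th ^+ 2.
have C20 : 0 <= C2 by rewrite !addr_ge0 ?mulr_ge0// sqr_ge0.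
have thC2 : th <= C2.
  have : 0 <= th ^+ 2 by exact: sqr_ge0.
  by rewrite /C2; lra.
have [C3 C30 HP] := perturb m m.+1 C20.
exists (C1 + C3); first by rewrite addr_ge0.
move=> F0 F1 G0 G1 T1 T2 D sT1 sT2 bF bG bFT bGT F00 G00 hD.
pose P0 := F0 + s * (F1 - F0); pose Q0 := G0 + s * (G1 - G0).
have bP0 : bounded01 m.+1 (P0 - F0) C1 by rewrite /P0 addrC addKr; exact: bounded01M.
have bQ0 : bounded01 m.+1 (Q0 - G0) C1 by rewrite /Q0 addrC addKr; exact: bounded01M.
have bPT : bounded01 m.+1 (P0 - T1) th.
  by rewrite (_ : P0 - T1 = (P0 - F0) + (F0 - T1)); [exact: bounded01D|ring].
have bQT : bounded01 m.+1 (Q0 - T2) th.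
  by rewrite (_ : Q0 - T2 = (Q0 - G0) + (G0 - T2)); [exact: bounded01D|ring].
have f0P : flat m (P0 - F0) 0 by rewrite /P0 addrC addKr mulrC; exact: flatM.
have f0Q : flat m (Q0 - G0) 0 by rewrite /Q0 addrC addKr mulrC; exact: flatM.
have f1P : flat m (P0 - F1) 1.
  by rewrite (_ : P0 - F1 = (F1 - F0) * (s - 1)); [exact: flatM|rewrite /P0; ring].
have f1Q : flat m (Q0 - G1) 1.
  by rewrite (_ : Q0 - G1 = (G1 - G0) * (s - 1)); [exact: flatM|rewrite /Q0; ring].
have [E dE] := poly_primitive (area P0 Q0).
have [J dJ] := poly_primitive (area T1 T2).
have P00 : P0.[0] = T1.[0].
  by have := f0P 0%N isT; rewrite derivn0 hornerD hornerN F00 => /eqP; rewrite subr_eq0 => /eqP.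
have Q00 : Q0.[0] = T2.[0].
  by have := f0Q 0%N isT; rewrite derivn0 hornerD hornerN G00 => /eqP; rewrite subr_eq0 => /eqP.
have P01 : P0.[1] = F1.[1].
  by have := f1P 0%N isT; rewrite derivn0 hornerD hornerN => /eqP; rewrite subr_eq0 => /eqP.
have Q01 : Q0.[1] = G1.[1].
  by have := f1Q 0%N isT; rewrite derivn0 hornerD hornerN => /eqP; rewrite subr_eq0 => /eqP.
have c1 x : 0 <= x <= 1 -> `|P0^`().[x] - T1^`().[x]| <= th /\ `|Q0^`().[x] - T2^`().[x]| <= th.
  move=> x01; have := bPT 1%N isT x x01; have := bQT 1%N isT x x01.
  by rewrite !derivn1 !derivB !hornerD !hornerN.
have hD0 B : (forall x, 0 <= x <= 1 -> `|T1^`().[x]| <= B /\ `|T2^`().[x]| <= B) ->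
    `|D - int01 (area P0 Q0)| <= C2 * (1 + B).
  move=> hB; have B0 : 0 <= B.
    by apply: le_trans (proj1 (hB 0 _)); rewrite ?normr_ge0 ?lexx ?ler01.
  have := @area_stability R (horner P0) (horner Q0) (horner P0^`()) (horner Q0^`())
    (horner E) (horner J) (fun x => (2 * B) * x) (fun=> 2 * B) T1 T2 0 1 th ltr01.
  rewrite subr0 divr1 mulr1 mulr0 subr0 => H.
  have {}H := H (fun x _ => has_deriv_poly _ x) (fun x _ => has_deriv_poly _ x)
    (fun x _ => has_deriv_area_primitive x dE) (fun x _ => has_deriv_area_primitive x dJ).
  have {}H : `|E.[1] - E.[0] - (J.[1] - J.[0]) + 2 * T1.[0] * (Q0.[1] - T2.[1])
     - 2 * T2.[0] * (P0.[1] - T1.[1])| <= 6 * th * (2 * B) + 4 * th ^+ 2.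
    apply: H => //.
    - by move=> x _; have := has_derivZ (2 * B) (has_deriv_id x); rewrite mulr1.
    - by move=> x /hB[]; lra.
    - move=> x x01; have := bPT 0%N isT x x01; have := bQT 0%N isT x x01.
      by rewrite !derivn0 !hornerD !hornerN.
  have := hD B hB; rewrite (int01E dE) (int01E dJ) -P01 -Q01 => h.
  have e : D - (E.[1] - E.[0]) = (D - (J.[1] - J.[0]) + 2 * T1.[0] * (Q0.[1] - T2.[1]) -
     2 * T2.[0] * (P0.[1] - T1.[1])) - (E.[1] - E.[0] - (J.[1] - J.[0]) +
       2 * T1.[0] * (Q0.[1] - T2.[1]) - 2 * T2.[0] * (P0.[1] - T1.[1])) by ring.
  rewrite e; apply: le_trans (ler_normB _ _) _; apply: le_trans (lerD h H) _.
  have : 0 <= th * B by rewrite mulr_ge0.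
  have : 0 <= th ^+ 2 * B by rewrite mulr_ge0// sqr_ge0.
  have : 0 <= th ^+ 2 by rewrite sqr_ge0.
  by rewrite /C2; nra.
have [||||phi [psi [fphi fpsi hE]]] := HP P0^`() Q0^`() T1^`() T2^`() (D - int01 (area P0 Q0)).
- by apply: leq_trans (leq_trans (size_poly _ _) (leq_pred _)) sT1.
- by apply: leq_trans (leq_trans (size_poly _ _) (leq_pred _)) sT2.
- by move=> x /c1[h1 h2]; split; [exact: le_trans thC2|exact: le_trans thC2].
- exact: hD0.
case: fphi => fphi0 fphi1 bphi; case: fpsi => fpsi0 fpsi1 bpsi.
have e1 (F : {poly R}) : P0 + phi - F = (P0 - F) + phi by rewrite addrAC.
have e2 (F : {poly R}) : Q0 + psi - F = (Q0 - F) + psi by rewrite addrAC.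
exists (P0 + phi), (Q0 + psi); rewrite !e1 !e2; split.
- by split; exact: flatD.
- by split; exact: flatD.
- by split; exact: bounded01D.
have pz : phi.[0] = 0 by rewrite -[phi]derivn0 fphi0.
have po : phi.[1] = 0 by rewrite -[phi]derivn0 fphi1.
have sz : psi.[0] = 0 by rewrite -[psi]derivn0 fpsi0.
have so : psi.[1] = 0 by rewrite -[psi]derivn0 fpsi1.
have i1 := int01_derivM Q0 pz po.
have i2 := int01_derivM P0 sz so.
have i3 := int01_derivM psi pz po.
(* Integration by parts in algebraic form: the last three summands are multiples of the derivatives
   of phi Q0, psi P0 and phi psi, which integrate to 0. *)
have -> : area (P0 + phi) (Q0 + psi) = area P0 Q0 + 4 *: (P0^`() * psi - Q0^`() * phi + phi^`() * psi)
   + 2 *: (phi^`() * Q0 + phi * Q0^`()) + (-2) *: (psi^`() * P0 + psi * P0^`())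
   + (-2) *: (phi^`() * psi + phi * psi^`()).
  rewrite /area -!mul_polyC !derivD.
  have -> : (4 : R)%:P = 2%:P * 2%:P by rewrite -polyCM; congr _%:P; ring.
  have e3 : (2 : R)%:P = 2 :> {poly R} by rewrite polyC_natr.
  by rewrite polyCN e3; ring.
move: (area P0 Q0) hE => Ar hE.
by rewrite !int01D !int01Z i1 i2 i3 hE; ring.
Qed.

End UnitGap.

(** * Rescaling from the unit interval *)

Section ScaledGap.
Variable R : realType.
Implicit Types (p q : {poly R}) (x c A B : R) (k m n : nat).

(** The C^n norm that is invariant under affine changes of the interval. For l = b - a and A = C
    w(l) l^m it says that the k-th derivative is O(w(l) l^(m-k)). *)
Definition scaled n (a b A : R) p := forall k, (k <= n)%N ->
  forall x, a <= x <= b -> `|p^`(k).[x]| * (b - a) ^+ k <= A.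

Lemma derivn_comp_affine p (c d : R) k :
  (p \Po (c *: 'X + d%:P))^`(k) = c ^+ k *: (p^`(k) \Po (c *: 'X + d%:P)).
Proof.
elim: k => [|k IH]; first by rewrite !derivn0 expr0 scale1r.
rewrite derivnS IH derivZ deriv_comp derivD derivZ derivX derivC addr0 -derivnS.
by rewrite -scalerAr mulr1 scalerA exprSr.
Qed.

Lemma scaled_bounded01 n (a b th C : R) p : a < b -> 0 < th ->
  scaled n a b (C * th) p ->
  bounded01 n (th^-1 *: (p \Po ((b - a) *: 'X + a%:P))) C.
Proof.
move=> ab th0 H k kn x x01; have l0 : 0 < b - a by lra.
rewrite derivnZ derivn_comp_affine !hornerZ horner_comp hornerD hornerZ hornerX hornerC.
rewrite !normrM normfV (gtr0_norm th0) normrX (gtr0_norm l0) ler_pdivrMl//.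
rewrite mulrC [th * C]mulrC; apply: H => //; nra.
Qed.

Lemma bounded01_scaled n (a b th C : R) p : a < b -> 0 < th -> bounded01 n p C ->
  scaled n a b (C * th) (th *: (p \Po ((b - a)^-1 *: 'X + (- a / (b - a))%:P))).
Proof.
move=> ab th0 H k kn x xab; have l0 : 0 < b - a by lra.
rewrite derivnZ derivn_comp_affine !hornerZ horner_comp hornerD hornerZ hornerX hornerC.
rewrite !normrM (gtr0_norm th0) normrX normfV (gtr0_norm l0) [C * th]mulrC -mulrA ler_pM2l//.
rewrite exprVn mulrAC mulVf ?mul1r ?expf_neq0 ?gt_eqF//; apply: H => //.
have -> : (b - a)^-1 * x + - a / (b - a) = (x - a) / (b - a) by ring.
by rewrite divr_ge0 ?ler_pdivrMr//=; lra.
Qed.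

Lemma affine_cancel (a b : R) p : a < b ->
  (p \Po ((b - a) *: 'X + a%:P)) \Po ((b - a)^-1 *: 'X + (- a / (b - a))%:P) = p.
Proof.
move=> ab; rewrite -comp_polyA comp_polyD comp_polyZ comp_polyX comp_polyC scalerDr scalerA.
rewrite divff ?scale1r; last by rewrite subr_eq0 gt_eqF.
rewrite -mul_polyC -polyCM -addrA -polyCD.
rewrite (_ : (b - a) * (- a / (b - a)) + a = 0) ?polyC0 ?addr0 ?comp_polyXr//.
by field; rewrite subr_eq0 gt_eqF.
Qed.

Lemma flat_affine m p (c d s : R) : flat m p (c * s + d) ->
  flat m (p \Po (c *: 'X + d%:P)) s.
Proof.
move=> H k km; rewrite derivn_comp_affine hornerZ horner_comp hornerD hornerZ hornerX hornerC.
by rewrite H// mulr0.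
Qed.

Lemma flatZ m p c x : flat m p x -> flat m (c *: p) x.
Proof. by move=> H k km; rewrite derivnZ hornerZ H// mulr0. Qed.

(** Reduces to [0, 1] by an affine substitution and division of the planar data by th. Areas are
    then divided by th^2, and a bound B of the rescaled derivatives is a bound B th / (b - a) of the
    original ones, so th^2 + th B (b - a) becomes 1 + B. *)
Lemma gap_poly m C : 0 <= C -> exists2 C' : R, 0 <= C' &
  forall (a b th : R) (F0 F1 G0 G1 T1 T2 : {poly R}) (D : R), a < b -> 0 < th ->
    (size T1 <= m.+1)%N -> (size T2 <= m.+1)%N ->
    scaled m.+1 a b (C * th) (F1 - F0) -> scaled m.+1 a b (C * th) (G1 - G0) ->
    scaled m.+1 a b (C * th) (F0 - T1) -> scaled m.+1 a b (C * th) (G0 - T2) ->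
    F0.[a] = T1.[a] -> G0.[a] = T2.[a] ->
    (forall J B, J^`() = area T1 T2 ->
      (forall x, a <= x <= b -> `|T1^`().[x]| <= B /\ `|T2^`().[x]| <= B) ->
      `|D - (J.[b] - J.[a]) + 2 * T1.[a] * (G1.[b] - T2.[b])
        - 2 * T2.[a] * (F1.[b] - T1.[b])| <= C * (th ^+ 2 + th * B * (b - a))) ->
    exists P Q E : {poly R},
      [/\ flat m (P - F0) a /\ flat m (Q - G0) a,
          flat m (P - F1) b /\ flat m (Q - G1) b,
          scaled m.+1 a b (C' * th) (P - F0) /\ scaled m.+1 a b (C' * th) (Q - G0),
          E^`() = area P Q & E.[b] - E.[a] = D].
Proof.
move=> C0; have [C' C'0 H] := gap_unit m C0; exists C' => //.
move=> a b th F0 F1 G0 G1 T1 T2 D ab th0 s1 s2 hF hG hFT hGT Fa Ga hD.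
have l0 : 0 < b - a by lra.
pose L : {poly R} := (b - a) *: 'X + a%:P.
pose M : {poly R} := (b - a)^-1 *: 'X + (- a / (b - a))%:P.
pose sc p := th^-1 *: (p \Po L).
have scB p q : sc p - sc q = sc (p - q) by rewrite /sc comp_polyB scalerBr.
have L0 : L.[0] = a by rewrite hornerD hornerZ hornerX hornerC mulr0 add0r.
have L1 : L.[1] = b by rewrite hornerD hornerZ hornerX hornerC mulr1 subrK.
have M0 : M.[a] = 0.
  by rewrite hornerD hornerZ hornerX hornerC mulrC -mulrDl subrr mul0r.
have M1 : M.[b] = 1.
  by rewrite hornerD hornerZ hornerX hornerC mulrC -mulrDl divff// gt_eqF.
have sc0 p : (sc p).[0] = th^-1 * p.[a] by rewrite hornerZ horner_comp L0.
have sc1 p : (sc p).[1] = th^-1 * p.[b] by rewrite hornerZ horner_comp L1.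
have dL : L^`() = (b - a)%:P by rewrite derivD derivZ derivX derivC addr0 alg_polyC.
have dM : M^`() = (b - a)^-1%:P by rewrite derivD derivZ derivX derivC addr0 alg_polyC.
have dsc p : (sc p)^`() = (th^-1 * (b - a)) *: (p^`() \Po L).
  by rewrite derivZ deriv_comp dL mulrC mul_polyC scalerA.
have ssc p : (size p <= m.+1)%N -> (size (sc p) <= m.+1)%N.
  move=> sp; rewrite (leq_trans (size_scale_leq _ _))// size_comp_poly2//.
  by rewrite /L -mul_polyC size_MXaddC polyC_eq0 (gt_eqF l0) /= size_polyC (gt_eqF l0).
have [J dJ] := poly_primitive (area T1 T2).
have [|||||||||P [Q [[fP0 fQ0] [fP1 fQ1] [bP bQ] iE]]] :=
  H (sc F0) (sc F1) (sc G0) (sc G1) (sc T1) (sc T2) (D / th ^+ 2).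
- exact: ssc.
- exact: ssc.
- by rewrite scB; exact: scaled_bounded01.
- by rewrite scB; exact: scaled_bounded01.
- by rewrite scB; exact: scaled_bounded01.
- by rewrite scB; exact: scaled_bounded01.
- by rewrite !sc0 Fa.
- by rewrite !sc0 Ga.
- move=> B hB.
  have dJ' : (th^-1 ^+ 2 *: (J \Po L))^`() = area (sc T1) (sc T2).
    rewrite derivZ deriv_comp dL dJ /area !dsc /sc comp_polyZ comp_polyB !comp_polyM.
    rewrite -!mul_polyC !polyCM; ring.
  have hB' : forall x, a <= x <= b -> `|T1^`().[x]| <= B * th / (b - a) /\ `|T2^`().[x]| <= B * th / (b - a).
    move=> x xab.
    have x01 : 0 <= M.[x] <= 1.
      have -> : M.[x] = (x - a) / (b - a) by rewrite hornerD hornerZ hornerX hornerC; ring.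
      by rewrite divr_ge0 ?ler_pdivrMr//=; lra.
    have LM : L.[M.[x]] = x.
      by rewrite !hornerD !hornerZ !hornerX !hornerC; field; rewrite gt_eqF.
    have [] := hB _ x01; rewrite !dsc !hornerZ !horner_comp LM !normrM.
    rewrite normfV (gtr0_norm th0) (gtr0_norm l0) => h1 h2.
    by split; rewrite ler_pdivlMr// mulrC [B * th]mulrC -ler_pdivrMl// mulrA.
  have := hD J _ dJ hB'.
  rewrite !sc0 !sc1 (int01E dJ') !hornerZ !horner_comp L0 L1 => h.
  rewrite (_ : _ - _ = (D - (J.[b] - J.[a]) + 2 * T1.[a] * (G1.[b] - T2.[b]) -
     2 * T2.[a] * (F1.[b] - T1.[b])) / th ^+ 2); last by field; rewrite gt_eqF.
  rewrite normrM normfV (ger0_norm (sqr_ge0 th)) ler_pdivrMr ?exprn_gt0//.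
  apply: le_trans h _; apply: le_of_eq; field; by rewrite gt_eqF.
have [E dE] := poly_primitive (area P Q).
have unsc p q : th *: (p \Po M) - q = th *: ((p - sc q) \Po M).
  by rewrite comp_polyB scalerBr /sc comp_polyZ scalerA divff ?gt_eqF// scale1r affine_cancel.
exists (th *: (P \Po M)), (th *: (Q \Po M)), (th ^+ 2 *: (E \Po M)); split.
- by rewrite !unsc; split; apply: flatZ; apply: flat_affine; rewrite mulrC -mulrDl subrr mul0r.
- by rewrite !unsc; split; apply: flatZ; apply: flat_affine; rewrite mulrC -mulrDl divff// gt_eqF.
- by rewrite !unsc; split; exact: bounded01_scaled.
- rewrite derivZ deriv_comp dM dE /area !derivZ !deriv_comp dM comp_polyZ comp_polyB !comp_polyM.
  by rewrite -!mul_polyC !polyCM; ring.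
- rewrite !hornerZ !horner_comp M0 M1 -mulrBr -(int01E dE) iE.
  by field; rewrite gt_eqF.
Qed.

End ScaledGap.

(** * Whitney extension by gap polynomials *)

Section Glue.
Variable R : realType.

Lemma has_derivP (f : R -> R) (x d : R) :
  has_deriv f x d <-> (forall e : R, 0 < e -> exists2 dl : R, 0 < dl &
    forall y, `|y - x| < dl -> `|f y - f x - d * (y - x)| <= e * `|y - x|).
Proof.
split.
  move=> [df dv] e e0.
  have H : (fun h => h^-1 *: ((f \o shift x) (h *: (1 : R)) - f x)) @ 0^' --> d.
    by rewrite -dv; exact: df.
  have /cvgrPdist_le/(_ _ e0) := H.
  rewrite near_withinE => -[dl /= dl0 Hd]; exists dl => // y yx.
  have [->|ynx] := eqVneq y x; first by rewrite !subrr mulr0 subrr normr0 mulr0.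
  have yx0 : y - x != 0 by rewrite subr_eq0.
  have := Hd (y - x); rewrite /= sub0r normrN => /(_ yx yx0).
  rewrite /GRing.scale /= mulr1 subrK => h.
  rewrite (_ : f y - f x - d * (y - x) = - (d - (y - x)^-1 * (f y - f x)) * (y - x)).
    by rewrite normrM normrN ler_wpM2r.
  by field.
move=> H.
have C : (fun h => h^-1 *: ((f \o shift x) (h *: (1 : R)) - f x)) @ 0^' --> d.
  apply/cvgrPdist_le => e e0; have [dl dl0 Hd] := H e e0.
  rewrite near_withinE; exists dl => // h; rewrite /= sub0r normrN => hd h0.
  have := Hd (h + x); rewrite addrK => /(_ hd).
  rewrite /GRing.scale /= mulr1 => h1.
  rewrite -(ler_pM2r (_ : 0 < `|h|)) ?normr_gt0// -normrM.
  rewrite (_ : (d - h^-1 * (f (h + x) - f x)) * h = - (f (h + x) - f x - d * h)) ?normrN//.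
  by field.
by split; [apply/cvg_ex; exists d|exact: cvg_lim C].
Qed.

Lemma continuousP_eps (u : R -> R) (x : R) :
  {for x, continuous u} <-> (forall e : R, 0 < e -> exists2 dl : R, 0 < dl &
    forall y, `|y - x| < dl -> `|u y - u x| <= e).
Proof.
split.
  move=> /cvgrPdist_le H e e0; have [dl /= dl0 Hd] := H e e0.
  by exists dl => // y yx; rewrite distrC; apply: Hd; rewrite /= distrC.
move=> H; apply/cvgrPdist_le => e e0; have [dl dl0 Hd] := H e e0.
by exists dl => //= y yx; rewrite distrC; apply: Hd; rewrite distrC.
Qed.

Variable K : set R.
Hypothesis K_closed : closed K.
Hypothesis K_below : forall x, exists2 l, K l & l <= x.
Hypothesis K_above : forall x, exists2 r, K r & x <= r.

Definition gap (l r : R) := [/\ K l, K r, l < r & forall y, l < y < r -> ~ K y].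

Lemma gap_exists x : ~ K x -> exists lr : R * R, gap lr.1 lr.2 /\ lr.1 < x < lr.2.
Proof.
move=> Kx; pose A := [set y | K y /\ y <= x]; pose B := [set y | K y /\ x <= y].
have A0 : A !=set0 by have [l Kl lx] := K_below x; exists l.
have B0 : B !=set0 by have [r Kr xr] := K_above x; exists r.
have Aub : has_ubound A by exists x => y [].
have Blb : has_lbound B by exists x => y [].
have KA : K (sup A).
  apply: K_closed; apply: closureS (closure_sup A0 Aub); by move=> y [].
have KB : K (inf B).
  apply: contrapT => nK; have := closed_openC K_closed; rewrite openE => /(_ _ nK).
  move=> /nbhs_ballP[e /= e0 He].
  have [y By ye] := inf_adherent e0 (conj B0 Blb); apply: (He y); last by case: By.
  have := ge_inf Blb By => yB.
  by rewrite /ball /= distrC ger0_norm ?subr_ge0//; lra.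
have Ax : sup A < x.
  rewrite lt_neqAle ge_sup// ?andbT; last by move=> y [].
  by apply/eqP => E; apply: Kx; rewrite -E.
have xB : x < inf B.
  rewrite lt_neqAle lb_le_inf// ?andbT; last by move=> y [].
  by apply/eqP => E; apply: Kx; rewrite E.
exists (sup A, inf B); split; last by rewrite /= Ax.
split => //=; first exact: lt_trans xB.
move=> y /andP[Ay yB] Ky; have [yx|xy] := leP y x.
  by have := ub_le_sup Aub (conj Ky yx); rewrite leNgt Ay.
by have := ge_inf Blb (conj Ky (ltW xy)); rewrite leNgt yB.
Qed.

Lemma gap_unique l r l' r' x : gap l r -> gap l' r' -> l < x < r -> l' < x < r' ->
  l = l' /\ r = r'.
Proof.
move=> [Kl Kr lr N] [Kl' Kr' lr' N'] xlr xlr'.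
have h1 : ~ (l' < l < r') by move=> h; exact: N' h Kl.
have h2 : ~ (l < l' < r) by move=> h; exact: N h Kl'.
have h3 : ~ (l' < r < r') by move=> h; exact: N' h Kr.
have h4 : ~ (l < r' < r) by move=> h; exact: N h Kr'.
split; apply/eqP; rewrite eq_le; apply/andP; split; rewrite leNgt; apply/negP => h.
- by apply: h1; lra.
- by apply: h2; lra.
- by apply: h4; lra.
- by apply: h3; lra.
Qed.

(** The default (x, x) is met only where no gap contains x, that is on K, where [glue_fun] does not
    look at it. *)
Definition gap_ends (x : R) : R * R := xget (x, x) [set lr | gap lr.1 lr.2 /\ lr.1 < x < lr.2].

Lemma gap_endsE l r x : gap l r -> l < x < r -> gap_ends x = (l, r).
Proof.
move=> g xlr; rewrite /gap_ends; case: xgetP => [[l' r'] _ /= [g' x']|/(_ (l, r))].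
  by have [-> ->] := gap_unique g g' xlr x'.
by move=> /(_ (conj g xlr)).
Qed.

Definition glue_fun (J : R -> R) (G : R -> R -> {poly R}) (x : R) : R :=
  if `[< K x >] then J x else (G (gap_ends x).1 (gap_ends x).2).[x].

Lemma glue_in J G x : K x -> glue_fun J G x = J x.
Proof. by move=> Kx; rewrite /glue_fun asboolT. Qed.

Lemma glue_gap J G l r x : gap l r -> (G l r).[l] = J l -> (G l r).[r] = J r ->
  l <= x <= r -> glue_fun J G x = (G l r).[x].
Proof.
move=> g el er /andP[]; rewrite le_eqVlt => /predU1P[<-|lx].
  by move=> _; rewrite glue_in ?el//; case: g.
rewrite le_eqVlt => /predU1P[->|xr]; first by rewrite glue_in ?er//; case: g.
rewrite /glue_fun asboolF; first by rewrite (gap_endsE g)//= lx.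
by case: g => _ _ _; apply; rewrite lx.
Qed.

Lemma K_or_gap x : K x \/ exists l r, gap l r /\ l < x < r.
Proof.
have [Kx|/gap_exists[[l r] /= H]] := pselect (K x); first by left.
by right; exists l, r.
Qed.

(** At a point of K gaps may accumulate, and differentiability along K says nothing about the
    interior of nearby gaps; continuity of the candidate derivative u controls the polynomials
    there. *)
Lemma glue_deriv (J u : R -> R) (G : R -> R -> {poly R}) :
  (forall l r, gap l r -> (G l r).[l] = J l /\ (G l r).[r] = J r) ->
  (forall l r x, gap l r -> l <= x <= r -> u x = (G l r)^`().[x]) ->
  continuous u ->
  (forall a, K a -> forall e : R, 0 < e -> exists2 dl : R, 0 < dl &
    forall y, K y -> `|y - a| < dl -> `|J y - J a - u a * (y - a)| <= e * `|y - a|) ->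
  forall x, has_deriv (glue_fun J G) x (u x).
Proof.
move=> GJ Gu cu HJ x.
have GE l r y : gap l r -> l <= y <= r -> glue_fun J G y = (G l r).[y].
  by move=> g; have [el er] := GJ l r g; exact: glue_gap.
have [Kx|[l [r [g xlr]]]] := K_or_gap x; last first.
  apply/has_derivP => e e0.
  have /has_derivP/(_ e e0)[dl dl0 Hd] := has_deriv_poly (G l r) x.
  exists (Num.min dl (Num.min (x - l) (r - x))).
    by rewrite !lt_min dl0 /=; lra.
  move=> y; rewrite !lt_min => /and3P[yd yl yr].
  move: yl yr; rewrite !ltr_norml => yl yr.
  rewrite !(GE l r)//; try lra.
  by rewrite (Gu l r)//; [exact: Hd|lra].
apply/has_derivP => e e0; have e20 : 0 < e / 2 by lra.
have [d1 d10 H1] := HJ x Kx _ e20.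
have /continuousP_eps/(_ _ e20)[d2 d20 H2] := cu x.
exists (Num.min d1 d2); first by rewrite lt_min d10.
move=> y; rewrite lt_min => /andP[y1 y2].
rewrite (glue_in J G Kx).
have [Ky|[l [r [g ylr]]]] := K_or_gap y.
  rewrite glue_in//; apply: le_trans (H1 y Ky y1) _.
  by rewrite ler_wpM2r//; lra.
(* From the endpoint z of the gap next to x: the function is within e/2 at z, and the mean
   value theorem covers [z, y]. *)
have key z : K z -> l <= z <= r -> `|y - x| = `|y - z| + `|z - x| ->
    `|glue_fun J G y - J x - u x * (y - x)| <= e * `|y - x|.
  move=> Kz zlr yzx.
  have hz : `|J z - J x - u x * (z - x)| <= e / 2 * `|z - x|.
    by apply: H1 => //; apply: le_lt_trans y1; rewrite yzx lerDr.
  have hy : `|((G l r).[y] - u x * y) - ((G l r).[z] - u x * z)| <= e / 2 * `|y - z|.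
    apply: (@deriv_bound R (fun t => (G l r).[t] - u x * t)
      (fun t => (G l r)^`().[t] - u x) (Num.min y z) (Num.max y z)).
    - move=> t _; apply: has_derivB; first exact: has_deriv_poly.
      by have := has_derivZ (u x) (has_deriv_id t); rewrite mulr1.
    - move=> t; rewrite ge_min le_max => tyz; rewrite -(Gu l r)//; last lra.
      apply: H2; apply: le_lt_trans y2; rewrite yzx.
      have : `|t - z| <= `|y - z|.
        have h1 := ler_norm (y - z); have h2 := ler_norm (z - y); rewrite (distrC z) in h2.
        by rewrite ler_norml; case/andP: tyz => /orP[] h3 /orP[] h4; lra.
      by move=> ?; apply: le_trans (ler_distD z _ _) _; rewrite lerD2r.
    - by rewrite ge_min le_max !lexx.
    - by rewrite ge_min le_max !lexx !orbT.
  rewrite (GE l r)//; last lra.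
  have Gz : (G l r).[z] = J z by rewrite -(GE l r)// glue_in.
  rewrite [X in `|X| <= _](_ : _ = (((G l r).[y] - u x * y) - ((G l r).[z] - u x * z)) + (J z - J x - u x * (z - x))).
    apply: le_trans (ler_normD _ _) _; rewrite yzx.
    have := normr_ge0 (y - z); have := normr_ge0 (z - x); nra.
  by rewrite Gz; ring.
have [xy|yx] := leP x y.
  have xl : x <= l.
    rewrite leNgt; apply/negP => lx; case: g => _ _ _ N; apply: N Kx; lra.
  apply: (key l); first by case: g.
    lra.
  by rewrite !ger0_norm; lra.
have rx : r <= x.
  rewrite leNgt; apply/negP => lx; case: g => _ _ _ N; apply: N Kx; lra.
apply: (key r); first by case: g.
  lra.
by rewrite !ler0_norm; lra.
Qed.

(** From x to y the path goes through the first and the last point of K between them; each of the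
    three pieces costs at most C w(y - x). *)
Lemma glue_modulus (w u : R -> R) C : modulus w -> 0 <= C ->
  (forall a b, K a -> K b -> a < b -> `|u a - u b| <= C * w (b - a)) ->
  (forall l r x y, gap l r -> l <= x -> x <= y -> y <= r -> `|u x - u y| <= C * w (y - x)) ->
  forall x y, `|u x - u y| <= 3 * C * w `|x - y|.
Proof.
move=> wm C0 HK Hg.
suff main x y : x <= y -> `|u x - u y| <= 3 * C * w (y - x).
  move=> x y; have [xy|/ltW yx] := leP x y.
    by rewrite (distrC x y) (ger0_norm (_ : 0 <= y - x)) ?subr_ge0// main.
  by rewrite distrC (ger0_norm (_ : 0 <= x - y)) ?subr_ge0// main.
move=> xy.
have HK' a b : K a -> K b -> a <= b -> `|u a - u b| <= C * w (b - a).
  move=> Ka Kb; rewrite le_eqVlt => /predU1P[->|]; last exact: HK.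
  by rewrite subrr normr0 mulr_ge0// modulus_ge0// subrr.
have mono s : 0 <= s -> s <= y - x -> C * w s <= C * w (y - x).
  by move=> s0 sy; rewrite ler_wpM2l// modulus_le.
have W0 : 0 <= C * w (y - x) by rewrite mulr_ge0// modulus_ge0// subr_ge0.
(* In the first alternative x and y lie in the closure of one gap and the estimate is already
   complete; otherwise [rx] is x itself or the right end of its gap. *)
have [rx [hrx|[Krx xrx H1]]] : exists r, (y <= r /\ `|u x - u y| <= C * w (y - x)) \/
    [/\ K r, x <= r <= y & `|u x - u r| <= C * w (y - x)].
  have [Kx|[l [r [g xlr]]]] := K_or_gap x.
    by exists x; right; split; rewrite ?lexx ?subrr ?normr0.
  have [yr|/ltW ry] := leP y r.
    by exists r; left; split => //; apply: (Hg l r) => //; lra.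
  exists r; right; split; [by case: g|lra|].
  apply: le_trans (Hg l r x r g _ _ _) _ => //; try lra.
  by apply: mono; lra.
- by case: hrx => _ h; apply: le_trans h _; lra.
have [ly [Kly yly H2]] : exists l, [/\ K l, rx <= l <= y & `|u l - u y| <= C * w (y - x)].
  have [Ky|[l [r [g ylr]]]] := K_or_gap y.
    by exists y; split; rewrite ?lexx ?subrr ?normr0//; lra.
  have rl : rx <= l.
    rewrite leNgt; apply/negP => lx; case: g => _ _ _ N; apply: N Krx; lra.
  exists l; split; [by case: g|lra|].
  apply: le_trans (Hg l r l y g _ _ _) _ => //; try lra.
  by apply: mono; lra.
have H3 : `|u rx - u ly| <= C * w (y - x).
  apply: le_trans (HK' _ _ Krx Kly _) _; first lra.
  by apply: mono; lra.
rewrite (_ : u x - u y = (u x - u rx) + (u rx - u ly) + (u ly - u y)); last by ring.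
apply: le_trans (ler_normD _ _) _; apply: le_trans (lerD (ler_normD _ _) (lexx _)) _.
lra.
Qed.

End Glue.

(** * Extending the Taylor field of one function *)

Section Extension.
Variable R : realType.
Variables (m : nat) (w : R -> R) (K : set R).
Hypothesis m_gt0 : (0 < m)%N.
Hypothesis w_mod : modulus w.
Hypothesis K_closed : closed K.
Hypothesis K_below : forall x, exists2 l, K l & l <= x.
Hypothesis K_above : forall x, exists2 r, K r & x <= r.

Lemma derivn_size_const (p : {poly R}) x y : (size p <= m.+1)%N -> p^`(m).[x] = p^`(m).[y].
Proof.
move=> sp; apply: (@const_of_deriv0 R (horner p^`(m))) => z.
have := has_deriv_poly p^`(m) z.
by rewrite -derivnS (derivn_poly0 sp) horner0.
Qed.

Lemma scaled_size (p : {poly R}) (a b A : R) : 0 <= A -> (size p <= m.+1)%N ->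
  scaled m a b A p -> scaled m.+1 a b A p.
Proof.
move=> A0 sp H k; rewrite leq_eqVlt => /predU1P[->|km]; last exact: H.
by move=> x _; rewrite derivn_poly0// horner0 normr0 mul0r.
Qed.

Lemma scaledE n (a b A x : R) (p : {poly R}) k : a < b -> (k <= n)%N -> (n <= m)%N ->
  a <= x <= b -> scaled n a b (A * (b - a) ^+ m) p ->
  `|p^`(k).[x]| <= A * (b - a) ^+ (m - k).
Proof.
move=> ab kn nm xab H; have l0 : 0 < b - a by lra.
rewrite -(ler_pM2r (_ : 0 < (b - a) ^+ k)) ?exprn_gt0//.
rewrite -mulrA -exprD subnK ?(leq_trans kn)//; exact: H.
Qed.

Definition taylor_field (C : R) (T : R -> {poly R}) :=
  (forall a, K a -> (size (T a) <= m.+1)%N) /\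
  (forall a b, K a -> K b -> a < b ->
     scaled m a b (C * (w (b - a) * (b - a) ^+ m)) (T b - T a)).

(** The order m+1 in [scaled] is one more than the jets prescribe: it makes the m-th derivative
    Lipschitz across the gap, with constant O(w(l) / l). *)
Definition gap_family (C : R) (T : R -> {poly R}) (P : R -> R -> {poly R}) :=
  forall l r, gap K l r -> [/\ flat m (P l r - T l) l, flat m (P l r - T r) r &
    scaled m.+1 l r (C * (w (r - l) * (r - l) ^+ m)) (P l r - T l)].

Definition glued (T : R -> {poly R}) (P : R -> R -> {poly R}) k : R -> R :=
  glue_fun K (fun x => (T x)^`(k).[x]) (fun l r => (P l r)^`(k)).

Section OneField.
Variables (C C' : R) (T : R -> {poly R}) (P : R -> R -> {poly R}).
Hypotheses (C0 : 0 <= C) (C'0 : 0 <= C').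
Hypothesis T_field : taylor_field C T.
Hypothesis P_gap : gap_family C' T P.

Lemma flatBE (p q : {poly R}) x k : flat m (p - q) x -> (k <= m)%N -> p^`(k).[x] = q^`(k).[x].
Proof.
move=> H km; have := H k km; rewrite derivnB hornerD hornerN => /eqP.
by rewrite subr_eq0 => /eqP.
Qed.

(** Between points of K this is the top order of the Taylor field. Inside a gap the bound C' w(l) /
    l on the derivative of order m+1 becomes a bound by w through [modulus_chord]. *)
Lemma glued_modulus : exists2 C2 : R, 0 <= C2 &
  forall x y, `|glued T P m x - glued T P m y| <= C2 * w `|x - y|.
Proof.
have [sT hT] := T_field.
have CC : 0 <= Num.max C C' by rewrite le_max C0.
exists (3 * Num.max C C'); first by rewrite mulr_ge0.
apply: (@glue_modulus R K K_closed K_below K_above) => //.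
- move=> a b Ka Kb ab; rewrite /glued !glue_in// distrC.
  rewrite (derivn_size_const a b (sT a Ka)).
  have := hT a b Ka Kb ab; rewrite mulrA => h.
  have {}h := @scaledE m a b _ b _ m ab (leqnn m) (leqnn m) _ h.
  rewrite derivnB hornerD hornerN subnn expr0 mulr1 in h.
  apply: le_trans (h _) _; first by rewrite lexx ltW.
  have w0 : 0 <= w (b - a) by rewrite (modulus_ge0 w_mod)// subr_ge0 ltW.
  by rewrite ler_wpM2r// le_max lexx.
- move=> l r x y g lx xy yr; have [f0 f1 sc] := P_gap g.
  have [Kl Kr lr _] := g; have l0 : 0 < r - l by lra.
  rewrite /glued !(glue_gap g) ?(flatBE f0) ?(flatBE f1)//; try lra.
  have d1 z : l <= z <= r -> `|(P l r)^`(m.+1).[z]| <= C' * w (r - l) / (r - l).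
    move=> zlr; have := sc m.+1 (leqnn _) z zlr.
    rewrite derivnB (derivn_poly0 (sT l Kl)) subr0 exprSr !mulrA => h.
    by rewrite ler_pdivlMr// -(ler_pM2r (_ : 0 < (r - l) ^+ m)) ?exprn_gt0// mulrAC.
  have := @deriv_bound R (horner (P l r)^`(m)) (horner (P l r)^`(m.+1)) l r _ x y _ d1 _ _.
  move=> h; apply: le_trans (h _ _ _) _; try lra.
    by move=> z _; rewrite derivnS; exact: has_deriv_poly.
  rewrite distrC ger0_norm ?subr_ge0//.
  have := @modulus_chord R w w_mod (y - x) (r - l).
  rewrite subr_ge0 => /(_ xy _ l0) h2.
  rewrite -mulrA -mulrA; apply: (@le_trans _ _ (C' * w (y - x))).
    by rewrite ler_wpM2l//; apply: le_trans (h2 _); lra.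
  by rewrite ler_wpM2r ?le_max ?lexx ?orbT// (modulus_ge0 w_mod)// subr_ge0.
Qed.

Lemma modulus_continuous (u : R -> R) (C2 : R) : 0 <= C2 ->
  (forall x y, `|u x - u y| <= C2 * w `|x - y|) -> continuous u.
Proof.
move=> C20 H x; apply/continuousP_eps => e e0.
have [|d d0 Hd] := modulus_small w_mod (_ : 0 < e / (C2 + 1)).
  by apply: divr_gt0; lra.
exists d => // y yx; apply: le_trans (H y x) _.
have h : w `|y - x| <= e / (C2 + 1) by apply: Hd; rewrite normr_ge0 ltW.
apply: (@le_trans _ _ (C2 * (e / (C2 + 1)))); first by rewrite ler_wpM2l.
rewrite mulrA ler_pdivrMr; last by lra.
by rewrite mulrC ler_wpM2l//; lra.
Qed.

Lemma field_rel_deriv k (a e : R) : (k < m)%N -> K a -> 0 < e ->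
  exists2 dl : R, 0 < dl & forall y, K y -> `|y - a| < dl ->
    `|(T y)^`(k).[y] - (T a)^`(k).[a] - (T a)^`(k.+1).[a] * (y - a)| <= e * `|y - a|.
Proof.
move=> km Ka e0; have [sT hT] := T_field; have C_ge0 : 0 <= C := C0.
have e20 : 0 < e / 2 by lra.
have dp := has_deriv_poly (T a)^`(k) a; rewrite -derivnS in dp.
have /has_derivP/(_ _ e20)[d1 d10 H1] := dp.
have [|d2 d20 H2] := modulus_small w_mod (_ : 0 < e / 2 / (C + 1)).
  by apply: divr_gt0; lra.
exists (Num.min 1 (Num.min d1 d2)); first by rewrite !lt_min ltr01 d10.
move=> y Ky; rewrite !lt_min => /and3P[y1 yd1 yd2].
have -> : (T y)^`(k).[y] - (T a)^`(k).[a] - (T a)^`(k.+1).[a] * (y - a) =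
   (T y - T a)^`(k).[y] + ((T a)^`(k).[y] - (T a)^`(k).[a] - (T a)^`(k.+1).[a] * (y - a)).
  by rewrite derivnB hornerD hornerN; ring.
apply: le_trans (ler_normD _ _) _.
have h1 := H1 y yd1.
suff h2 : `|(T y - T a)^`(k).[y]| <= C * w `|y - a| * `|y - a|.
  have : C * w `|y - a| <= e / 2.
    apply: (@le_trans _ _ (C * (e / 2 / (C + 1)))).
      by rewrite ler_wpM2l// H2// normr_ge0 ltW.
    rewrite mulrA ler_pdivrMr; last by lra.
    by rewrite mulrC ler_wpM2l//; lra.
  move=> h3; have := ler_wpM2r (normr_ge0 (y - a)) h3; lra.
(* Since k < m there remains a factor |y - a|; the other factors are at most 1. *)
have pw (s : R) : 0 <= s -> s <= 1 -> s ^+ (m - k) <= s.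
  move=> s0 s1; rewrite -(subnSK km) exprS ler_piMr// exprn_ile1//.
have [ya|ay|->] := ltgtP y a.
- have := hT y a Ky Ka ya; rewrite mulrA => h.
  have {}h := @scaledE m y a _ y _ k ya (ltnW km) (leqnn m) _ h.
  rewrite -opprB derivnN hornerN normrN (distrC y a) (ger0_norm (_ : 0 <= a - y)); last by lra.
  apply: le_trans (h _) _; first by rewrite lexx ltW.
  rewrite ler_wpM2l ?mulr_ge0 ?(modulus_ge0 w_mod)//; try lra.
  by apply: pw; rewrite ltr_norml in y1; lra.
- have := hT a y Ka Ky ay; rewrite mulrA => h.
  have {}h := @scaledE m a y _ y _ k ay (ltnW km) (leqnn m) _ h.
  rewrite (ger0_norm (_ : 0 <= y - a)); last by lra.
  apply: le_trans (h _) _; first by rewrite lexx ltW.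
  rewrite ler_wpM2l ?mulr_ge0 ?(modulus_ge0 w_mod)//; try lra.
  by apply: pw; rewrite ltr_norml in y1; lra.
by rewrite !subrr linear0 horner0 normr0 mulr0.
Qed.

(** The induction descends from order m: [glue_deriv] at order k requires continuity at order k+1,
    and at the top this comes from the modulus. *)
Lemma glued_family : deriv_family m (glued T P).
Proof.
suff H j : (j <= m)%N -> continuous (glued T P (m - j)) /\
    ((0 < j)%N -> forall x, has_deriv (glued T P (m - j)) x (glued T P (m - j).+1 x)).
  move=> k km x; have [_] := H (m - k)%N (leq_subr _ _).
  by rewrite subKn ?(ltnW km)// subn_gt0; exact.
elim: j => [|j IH] jm.
  split => //; rewrite subn0; have [C2 C20 H] := glued_modulus.
  exact: modulus_continuous H.
have [cj _] := IH (ltnW jm).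
have km : (m - j.+1 < m)%N by rewrite ltn_subrL.
have E : (m - j.+1).+1 = (m - j)%N by rewrite subnSK.
have D x : has_deriv (glued T P (m - j.+1)) x (glued T P (m - j.+1).+1 x).
  apply: (@glue_deriv R K K_closed K_below K_above) => //.
  - move=> l r g; have [f0 f1 _] := P_gap g.
    by split; [apply: flatBE f0 _|apply: flatBE f1 _]; exact: ltnW.
  - move=> l r z g zlr; have [f0 f1 _] := P_gap g.
    rewrite /glued (glue_gap g) ?derivnS//.
    + by rewrite -derivnS (flatBE f0).
    + by rewrite -derivnS (flatBE f1).
  - by rewrite E.
  - move=> a Ka e e0; rewrite /glued glue_in//.
    exact: field_rel_deriv.
by split => // x; exact: has_deriv_cont (D x).
Qed.

Lemma glued_continuous k : (k <= m)%N -> continuous (glued T P k).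
Proof.
rewrite leq_eqVlt => /predU1P[->|km] x; last exact: has_deriv_cont (glued_family km x).
by have [C2 C20 H] := glued_modulus; exact: modulus_continuous H x.
Qed.

(** All derivatives of the difference vanish at a, so [family_bound] applies with A = 0. *)
Lemma glued_close : exists2 C2 : R, 0 <= C2 & forall a b, K a -> a < b ->
  forall k, (k <= m)%N -> forall x, a <= x <= b ->
    `|glued T P k x - (T a)^`(k).[x]| <= C2 * w (b - a) * (b - a) ^+ (m - k).
Proof.
have [sT hT] := T_field; have [C2 C20 H] := glued_modulus; exists C2 => //.
move=> a b Ka ab k km x xab.
have := @family_bound R m (fun k x => glued T P k x - (T a)^`(k).[x]) a b 0 (C2 * w (b - a)).
rewrite mulr0 addr0; apply => //; last 2 first.
- move=> y z yab zab; rewrite (derivn_size_const y z (sT a Ka)).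
  rewrite (_ : _ - _ = glued T P m y - glued T P m z); last by ring.
  apply: le_trans (H y z) _; rewrite ler_wpM2l// modulus_le//.
  by rewrite ler_norml; lra.
- move=> j jm; exists a; first by rewrite lexx ltW.
  by rewrite /glued glue_in// subrr normr0 mul0r.
- by apply: deriv_familyB; [exact: glued_family|exact: deriv_family_poly].
- exact: ltW.
Qed.

End OneField.
End Extension.

(** * Extending the planar curve together with its height *)

Section CurveExtension.
Variable R : realType.
Variables (m : nat) (w : R -> R) (K : set R).
Hypothesis m_gt0 : (0 < m)%N.
Hypothesis w_mod : modulus w.
Hypothesis K_closed : closed K.
Hypothesis K_below : forall x, exists2 l, K l & l <= x.
Hypothesis K_above : forall x, exists2 r, K r & x <= r.

(** The polynomials T1 and T2 may differ from the jets at a, since the area bound is available for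
    the Taylor polynomials of an interpolant that varies with the pair (a, b). Quantifying over
    every bound B of their derivatives replaces the integral in the w-velocity. *)
Definition area_field (C D0 : R) (Tf Tg : R -> {poly R}) (h : R -> R) :=
  forall a b, K a -> K b -> a < b -> b - a <= D0 ->
  let th := w (b - a) * (b - a) ^+ m in
  exists T1 T2 : {poly R},
    [/\ (size T1 <= m.+1)%N /\ (size T2 <= m.+1)%N,
        (Tf a).[a] = T1.[a] /\ (Tg a).[a] = T2.[a],
        scaled m a b (C * th) (Tf a - T1) /\ scaled m a b (C * th) (Tg a - T2) &
        forall (J : {poly R}) (B : R), J^`() = area T1 T2 ->
          (forall x, a <= x <= b -> `|T1^`().[x]| <= B /\ `|T2^`().[x]| <= B) ->
          `|h b - h a - (J.[b] - J.[a]) + 2 * T1.[a] * ((Tg b).[b] - T2.[b])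
            - 2 * T2.[a] * ((Tf b).[b] - T1.[b])|
             <= C * (th ^+ 2 + th * B * (b - a))].

Section Fields.
Variables (C D0 : R) (Tf Tg : R -> {poly R}) (h : R -> R).
Hypotheses (C0 : 0 <= C) (D00 : 0 < D0).
Hypothesis Tf_field : taylor_field m w K C Tf.
Hypothesis Tg_field : taylor_field m w K C Tg.
Hypothesis h_area : area_field C D0 Tf Tg h.
Hypothesis gap_le : forall l r, gap K l r -> r - l <= D0.

Lemma modulus_power_gt0 a b : a < b -> 0 < w (b - a) * (b - a) ^+ m.
Proof.
move=> ab; have l0 : 0 < b - a by lra.
by rewrite mulr_gt0 ?exprn_gt0// (modulus_gt0 w_mod).
Qed.

Lemma gap_polys : exists2 C' : R, 0 <= C' & exists Pf Pg E : R -> R -> {poly R},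
  [/\ gap_family m w K C' Tf Pf, gap_family m w K C' Tg Pg &
    forall l r, gap K l r -> [/\ (E l r)^`() = area (Pf l r) (Pg l r),
      (E l r).[l] = h l & (E l r).[r] = h r]].
Proof.
have [C' C'0 H] := gap_poly m C0; exists C' => //.
have ex (lr : R * R) : exists PQE : {poly R} * {poly R} * {poly R}, gap K lr.1 lr.2 ->
  let l := lr.1 in let r := lr.2 in
  let: (P, Q, E) := PQE in
  [/\ flat m (P - Tf l) l /\ flat m (Q - Tg l) l,
      flat m (P - Tf r) r /\ flat m (Q - Tg r) r,
      scaled m.+1 l r (C' * (w (r - l) * (r - l) ^+ m)) (P - Tf l) /\
      scaled m.+1 l r (C' * (w (r - l) * (r - l) ^+ m)) (Q - Tg l),
      E^`() = area P Q & E.[r] - E.[l] = h r - h l].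
  case: lr => l r /=; have [g|ng] := pselect (gap K l r); last by exists (0, 0, 0).
  have [Kl Kr lr _] := g.
  have th0 := modulus_power_gt0 lr.
  have [T1 [T2 [[s1 s2] [e1 e2] [c1 c2] hA]]] := h_area Kl Kr lr (gap_le g).
  have [sf hf] := Tf_field; have [sg hg] := Tg_field.
  have A0 : 0 <= C * (w (r - l) * (r - l) ^+ m) by rewrite mulr_ge0// ltW.
  have sz (p q : {poly R}) : (size p <= m.+1)%N -> (size q <= m.+1)%N -> (size (p - q)%R <= m.+1)%N.
    by move=> sp sq; rewrite (leq_trans (size_polyD _ _))// size_polyN geq_max sp.
  have [||||P [Q [E HE]]] := H l r _ (Tf l) (Tf r) (Tg l) (Tg r) T1 T2 (h r - h l) lr th0 s1 s2 _ _ _ _ e1 e2 hA.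
  - by apply: scaled_size => //; [apply: sz; exact: sf|exact: hf].
  - by apply: scaled_size => //; [apply: sz; exact: sg|exact: hg].
  - by apply: scaled_size => //; apply: sz => //; exact: sf.
  - by apply: scaled_size => //; apply: sz => //; exact: sg.
  by exists (P, Q, E) => _.
have [F HF] := choice ex.
exists (fun l r => (F (l, r)).1.1), (fun l r => (F (l, r)).1.2),
  (fun l r => (F (l, r)).2 + (h l - (F (l, r)).2.[l])%:P); split.
- by move=> l r g; have := HF (l, r) g; case: (F (l, r)) => [[P Q] E] /= [[? _] [? _] [? _] _ _]; split.
- by move=> l r g; have := HF (l, r) g; case: (F (l, r)) => [[P Q] E] /= [[_ ?] [_ ?] [_ ?] _ _]; split.
- move=> l r g; have := HF (l, r) g; case: (F (l, r)) => [[P Q] E] /= [_ _ _ dE eE].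
  by split; rewrite ?derivD ?derivC ?addr0// hornerD hornerC; [ring|rewrite addrCA eE; ring].
Qed.

Variables (f g : nat -> R -> R) (c : R).
Hypotheses (f_fam : deriv_family m f) (g_fam : deriv_family m g).
Hypotheses (f_cont : continuous (f 1%N)) (g_cont : continuous (g 1%N)).
Hypothesis f_jet : forall k x, (k <= m)%N -> K x -> f k x = (Tf x)^`(k).[x].
Hypothesis g_jet : forall k x, (k <= m)%N -> K x -> g k x = (Tg x)^`(k).[x].
Hypothesis c_ge : C <= c.
Hypothesis f_close : forall a b, K a -> a < b -> forall k, (k <= m)%N ->
  forall x, a <= x <= b ->
    `|f k x - (Tf a)^`(k).[x]| <= (c - C) * w (b - a) * (b - a) ^+ (m - k).
Hypothesis g_close : forall a b, K a -> a < b -> forall k, (k <= m)%N ->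
  forall x, a <= x <= b ->
    `|g k x - (Tg a)^`(k).[x]| <= (c - C) * w (b - a) * (b - a) ^+ (m - k).

Let u x := 2 * (f 1%N x * g 0%N x - g 1%N x * f 0%N x).

(** The increments of h and of U are both compared with the area of (T1, T2), the first by
    [area_field] and the second by [area_stability]. With m >= 1 the difference is o(b - a), which
    determines the derivative of h along K. *)
Lemma area_increment (a b B : R) (U : R -> R) : K a -> K b -> a < b -> b - a <= D0 -> b - a <= 1 ->
  (forall x, a <= x <= b -> `|f 1%N x| <= B /\ `|g 1%N x| <= B) ->
  (forall x, a <= x <= b -> has_deriv U x (u x)) ->
  `|h b - h a - (U b - U a)| <=
    (13 * c * B + (17 * c ^+ 2 + c) * w 1) * w (b - a) * (b - a).
Proof.
move=> Ka Kb ab lD l1 hB dU; have C_ge0 : 0 <= C := C0; have cC : C <= c := c_ge.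
have c0 : 0 <= c by exact: le_trans cC.
have [T1 [T2 [[s1 s2] [e1 e2] [c1 c2] hA]]] := h_area Ka Kb ab lD.
have th0 := modulus_power_gt0 ab; set th := w (b - a) * _ in th0 c1 c2 hA.
have l0 : 0 < b - a by lra.
have W0 : 0 < w (b - a) by exact: modulus_gt0.
have m1 : (m - 1).+1 = m by rewrite subn1 prednK.
have close (F : nat -> R -> R) (T T' : {poly R}) k x : (k <= 1)%N -> a <= x <= b ->
    (forall k, (k <= m)%N -> forall x, a <= x <= b -> `|F k x - T^`(k).[x]| <= (c - C) * w (b - a) * (b - a) ^+ (m - k)) ->
    scaled m a b (C * th) (T - T') -> `|F k x - T'^`(k).[x]| <= c * w (b - a) * (b - a) ^+ (m - k).
  move=> k1 xab h1 h2; have km : (k <= m)%N by exact: leq_trans m_gt0.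
  rewrite -(subrK T^`(k).[x] (F k x)) -addrA.
  apply: le_trans (ler_normD _ _) _.
  have {}h1 := h1 k km x xab.
  have := @scaledE R m m a b (C * w (b - a)) x (T - T') k ab km (leqnn m) xab.
  rewrite -mulrA -/th derivnB hornerD hornerN => /(_ h2) {}h2.
  lra.
have E1 : c * w (b - a) * (b - a) ^+ (m - 1) = c * th / (b - a).
  by rewrite /th -[in RHS]m1 exprS; field; rewrite gt_eqF.
have f0 x : a <= x <= b -> `|f 0%N x - T1.[x]| <= c * th /\ `|g 0%N x - T2.[x]| <= c * th.
  move=> xab; split.
    have := close f (Tf a) T1 0%N x isT xab (f_close Ka ab) c1.
    by rewrite subn0 derivn0 -mulrA.
  have := close g (Tg a) T2 0%N x isT xab (g_close Ka ab) c2.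
  by rewrite subn0 derivn0 -mulrA.
have f1 x : a <= x <= b -> `|f 1%N x - T1^`().[x]| <= c * th / (b - a) /\ `|g 1%N x - T2^`().[x]| <= c * th / (b - a).
  move=> xab; rewrite -E1 -!derivn1; split.
    exact: close (f_close Ka ab) c1.
  exact: close (g_close Ka ab) c2.
pose B' := B + c * th / (b - a).
have hB' x : a <= x <= b -> `|T1^`().[x]| <= B' /\ `|T2^`().[x]| <= B'.
  move=> xab; have [h1 h2] := hB x xab; have [h3 h4] := f1 x xab; split.
    have := ler_normB (f 1%N x) (f 1%N x - T1^`().[x]); rewrite subKr /B'; lra.
  have := ler_normB (g 1%N x) (g 1%N x - T2^`().[x]); rewrite subKr /B'; lra.
have [J dJ] := poly_primitive (area T1 T2).
have {}hA := hA J B' dJ hB'.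
have aab : a <= a <= b by rewrite lexx ltW.
have fa : f 0%N a = T1.[a] by rewrite f_jet// derivn0.
have ga : g 0%N a = T2.[a] by rewrite g_jet// derivn0.
have fb : f 0%N b = (Tf b).[b] by rewrite f_jet// derivn0.
have gb : g 0%N b = (Tg b).[b] by rewrite g_jet// derivn0.
have H := @area_stability R (f 0%N) (g 0%N) (f 1%N) (g 1%N) U (horner J)
  (fun x => (2 * B') * x) (fun=> 2 * B') T1 T2 a b (c * th) ab
  (fun x _ => f_fam m_gt0 x) (fun x _ => g_fam m_gt0 x) dU
  (fun x _ => has_deriv_area_primitive x dJ).
have {}H : `|U b - U a - (J.[b] - J.[a]) + 2 * T1.[a] * (g 0%N b - T2.[b])
   - 2 * T2.[a] * (f 0%N b - T1.[b])| <= 6 * (c * th) * (2 * B' * b - 2 * B' * a) + 4 * (c * th) ^+ 2.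
  apply: H => //.
  - by move=> x _; have := has_derivZ (2 * B') (has_deriv_id x); rewrite mulr1.
  - by move=> x /hB'[]; lra.
rewrite fb gb in H.
set X := 2 * T1.[a] * ((Tg b).[b] - T2.[b]) in hA H.
set Y := 2 * T2.[a] * ((Tf b).[b] - T1.[b]) in hA H.
rewrite (_ : h b - h a - (U b - U a) = (h b - h a - (J.[b] - J.[a]) + X - Y)
  - (U b - U a - (J.[b] - J.[a]) + X - Y)); last by ring.
apply: le_trans (ler_normB _ _) _; apply: le_trans (lerD hA H) _.
have B0 : 0 <= B by have [h1 _] := hB a aab; exact: le_trans h1.
have Bl : B' * (b - a) = B * (b - a) + c * th by rewrite /B'; field; rewrite gt_eqF.
have thl : th <= w (b - a) * (b - a).
  by rewrite /th -m1 exprS ler_wpM2l ?(ltW W0)// ler_piMr ?(ltW l0)// exprn_ile1 ?(ltW l0).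
have w1 : w (b - a) <= w 1 by rewrite (modulus_le w_mod)// ltW.
have w10 : 0 <= w 1 by exact: modulus_ge0.
have e3 : C * (th ^+ 2 + th * B' * (b - a)) <= c * (th ^+ 2 + th * B' * (b - a)).
  rewrite ler_wpM2r// addr_ge0 ?sqr_ge0// -mulrA Bl mulr_ge0 ?(ltW th0)//.
  by apply: addr_ge0; apply: mulr_ge0 => //; exact: ltW.
(* With B' (b - a) = B (b - a) + c th, stability contributes 12 c B (b - a) + 16 c^2 th and the
   hypothesis on h contributes c B (b - a) + (c^2 + c) th, each times th. *)
apply: (@le_trans _ _ (th * (13 * c * B * (b - a) + (17 * c ^+ 2 + c) * th))).
  have -> : 6 * (c * th) * (2 * B' * b - 2 * B' * a) = 12 * c * th * (B' * (b - a)) by ring.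
  apply: le_trans (lerD e3 (lexx _)) _.
  rewrite -[th * B' * (b - a)]mulrA Bl; apply: le_of_eq; ring.
apply: (@le_trans _ _ (th * (13 * c * B + (17 * c ^+ 2 + c) * w 1))).
  rewrite (ler_wpM2l (ltW th0))// lerD//.
    by rewrite ler_piMr// !mulr_ge0.
  rewrite ler_wpM2l ?addr_ge0 ?mulr_ge0 ?sqr_ge0//.
  apply: le_trans thl _; apply: le_trans w1; rewrite ler_piMr// ltW//.
rewrite -[leRHS]mulrA mulrC; apply: ler_wpM2l => //.
by rewrite addr_ge0 ?mulr_ge0// addr_ge0// mulr_ge0// sqr_ge0.
Qed.

Lemma u_continuous : continuous u.
Proof.
move=> x.
have f0 : {for x, continuous (f 0%N)} := has_deriv_cont (f_fam m_gt0 x).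
have g0 : {for x, continuous (g 0%N)} := has_deriv_cont (g_fam m_gt0 x).
apply: cvgM; first exact: cvg_cst.
by apply: cvgB; apply: cvgM => //; [exact: f_cont|exact: g_cont].
Qed.

(** Adds two errors: that of replacing h by a primitive of u, and that of freezing u at a0 by
    continuity. *)
Lemma height_rel_deriv (a0 e : R) : K a0 -> 0 < e ->
  exists2 dl : R, 0 < dl & forall y, K y -> `|y - a0| < dl ->
    `|h y - h a0 - u a0 * (y - a0)| <= e * `|y - a0|.
Proof.
move=> Ka0 e0; have e20 : 0 < e / 2 by lra.
have C_ge0 : 0 <= C := C0; have cC : C <= c := c_ge; have D0_gt0 : 0 < D0 := D00.
have [d1 d10 H1] := (continuousP_eps u a0).1 (@u_continuous a0) _ e20.
have [d2 d20 H2] := (continuousP_eps (f 1%N) a0).1 (@f_cont a0) _ ltr01.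
have [d3 d30 H3] := (continuousP_eps (g 1%N) a0).1 (@g_cont a0) _ ltr01.
pose B := `|f 1%N a0| + `|g 1%N a0| + 1.
have B0 : 0 <= B by rewrite !addr_ge0.
pose M := 13 * c * B + (17 * c ^+ 2 + c) * w 1.
have M0 : 0 <= M.
  have c0 : 0 <= c by lra.
  by rewrite addr_ge0 ?mulr_ge0 ?addr_ge0 ?mulr_ge0 ?sqr_ge0 ?(modulus_ge0 w_mod).
have [|d4 d40 H4] := modulus_small w_mod (_ : 0 < e / 2 / (M + 1)).
  by apply: divr_gt0; lra.
exists (Num.min 1 (Num.min D0 (Num.min d1 (Num.min d2 (Num.min d3 d4))))).
  by rewrite !lt_min ltr01 D0_gt0 d10 d20 d30.
move=> y Ky; rewrite !lt_min => /and5P[y1 yD yd1 yd2 /andP[yd3 yd4]].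
have key a b : K a -> K b -> a < b -> b - a = `|y - a0| ->
    (forall x, a <= x <= b -> `|x - a0| <= `|y - a0|) ->
    `|h b - h a - u a0 * (b - a)| <= e * (b - a).
  move=> Ka Kb ab lE near0.
  have [U [dU _]] := primitive_exists u_continuous ab.
  have n1 x : a <= x <= b -> `|f 1%N x| <= B /\ `|g 1%N x| <= B.
    move=> xab; have xa := near0 x xab; rewrite /B.
    have h1 := H2 x (le_lt_trans xa yd2); have h2 := H3 x (le_lt_trans xa yd3).
    have h3 := ler_normD (f 1%N x - f 1%N a0) (f 1%N a0).
    have h4 := ler_normD (g 1%N x - g 1%N a0) (g 1%N a0).
    rewrite !subrK in h3 h4.
    have := normr_ge0 (f 1%N a0); have := normr_ge0 (g 1%N a0); lra.
  have inc := @area_increment a b B U Ka Kb ab _ _ n1 dU.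
  rewrite lE in inc; have {}inc := inc (ltW yD) (ltW y1); rewrite -/M in inc.
  have hw : M * w `|y - a0| <= e / 2.
    apply: (@le_trans _ _ (M * (e / 2 / (M + 1)))).
      by rewrite ler_wpM2l// H4// normr_ge0 ltW.
    rewrite mulrA ler_pdivrMr; last by lra.
    by rewrite mulrC ler_wpM2l//; lra.
  have dV : `|(U b - u a0 * b) - (U a - u a0 * a)| <= e / 2 * `|b - a|.
    apply: (@deriv_bound R (fun t => U t - u a0 * t) (fun t => u t - u a0) a b).
    - move=> t tab; apply: has_derivB; first exact: dU.
      by have := has_derivZ (u a0) (has_deriv_id t); rewrite mulr1.
    - by move=> t tab; apply: H1; apply: le_lt_trans yd1; exact: near0.
    - by rewrite lexx ltW.
    - by rewrite lexx ltW.
  rewrite (_ : h b - h a - u a0 * (b - a) = (h b - h a - (U b - U a)) +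
     ((U b - u a0 * b) - (U a - u a0 * a))); last by ring.
  apply: le_trans (ler_normD _ _) _.
  rewrite (ger0_norm (_ : 0 <= b - a)) in dV; last by lra.
  rewrite -lE in hw inc.
  have := ler_wpM2r (_ : 0 <= b - a) hw; rewrite subr_ge0 (ltW ab) => /(_ isT); lra.
have [ya|ay|->] := ltgtP y a0.
- have dE : `|y - a0| = a0 - y by rewrite distrC ger0_norm; lra.
  have := key y a0 Ky Ka0 ya; rewrite dE => /(_ erefl) H.
  rewrite (_ : _ - _ = - (h a0 - h y - u a0 * (a0 - y))); last by ring.
  rewrite normrN; apply: H => x xab; rewrite distrC ger0_norm; lra.
- have dE : `|y - a0| = y - a0 by rewrite ger0_norm; lra.
  have := key a0 y Ka0 Ky ay; rewrite dE => /(_ erefl); apply.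
  by move=> x xab; rewrite ger0_norm; lra.
- by rewrite !subrr mulr0 subrr normr0 mulr0.
Qed.

End Fields.

(** The height is glued only to first order: in the gaps from the primitives E, on K from h.
    [glue_deriv] then yields horizontality everywhere, points of K included. *)
Theorem curve_extension (C D0 : R) (Tf Tg : R -> {poly R}) (h : R -> R) :
  0 <= C -> 0 < D0 -> taylor_field m w K C Tf -> taylor_field m w K C Tg ->
  area_field C D0 Tf Tg h -> (forall l r, gap K l r -> r - l <= D0) ->
  exists (f g : nat -> R -> R) (v : R -> R) (C2 : R),
    [/\ deriv_family m f /\ deriv_family m g,
        (forall x, has_deriv v x (2 * (f 1%N x * g 0%N x - g 1%N x * f 0%N x))),
        0 <= C2 /\ (forall x y, `|f m x - f m y| <= C2 * w `|x - y| /\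
                   `|g m x - g m y| <= C2 * w `|x - y|),
        (forall k x, (k <= m)%N -> K x -> f k x = (Tf x)^`(k).[x] /\ g k x = (Tg x)^`(k).[x]) &
        (forall x, K x -> v x = h x)].
Proof.
move=> C0 D00 hf hg hA hgap.
have [C' C'0 [Pf [Pg [E [gf gg gE]]]]] := gap_polys C0 hf hg hA hgap.
pose f := glued K Tf Pf; pose g := glued K Tg Pg.
have ff : deriv_family m f by move=> k km x; exact: (glued_family m_gt0 w_mod K_closed K_below K_above C0 C'0 hf gf km x).
have fg : deriv_family m g by move=> k km x; exact: (glued_family m_gt0 w_mod K_closed K_below K_above C0 C'0 hg gg km x).
have cf : continuous (f 1%N) by move=> x; exact: (glued_continuous m_gt0 w_mod K_closed K_below K_above C0 C'0 hf gf m_gt0).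
have cg : continuous (g 1%N) by move=> x; exact: (glued_continuous m_gt0 w_mod K_closed K_below K_above C0 C'0 hg gg m_gt0).
have [c1 c10 close1] := glued_close m_gt0 w_mod K_closed K_below K_above C0 C'0 hf gf.
have [c2 c20 close2] := glued_close m_gt0 w_mod K_closed K_below K_above C0 C'0 hg gg.
have [C1 C10 mf] := glued_modulus w_mod K_closed K_below K_above C0 C'0 hf gf.
have [C2 C20 mg] := glued_modulus w_mod K_closed K_below K_above C0 C'0 hg gg.
have jf k x : (k <= m)%N -> K x -> f k x = (Tf x)^`(k).[x] by move=> _ Kx; rewrite /f /glued glue_in.
have jg k x : (k <= m)%N -> K x -> g k x = (Tg x)^`(k).[x] by move=> _ Kx; rewrite /g /glued glue_in.
pose u x := 2 * (f 1%N x * g 0%N x - g 1%N x * f 0%N x).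
have wp (p q : R) (a b : R) k : a < b -> p <= q -> p * w (b - a) * (b - a) ^+ k <= q * w (b - a) * (b - a) ^+ k.
  move=> ab pq; have l0 : 0 <= b - a by lra.
  by rewrite ler_wpM2r ?exprn_ge0// ler_wpM2r// (modulus_ge0 w_mod).
(* c1 and c2 bound the distance from the glued functions to the jets, C that from the jets to T1 and
   T2. *)
pose c := c1 + c2 + C.
have cC : C <= c by rewrite lerDr addr_ge0.
have cc : c - C = c1 + c2 by rewrite addrK.
have cl1 a b : K a -> a < b -> forall k, (k <= m)%N -> forall x, a <= x <= b ->
    `|f k x - (Tf a)^`(k).[x]| <= (c - C) * w (b - a) * (b - a) ^+ (m - k).
  move=> Ka ab k km x xab; apply: le_trans (close1 a b Ka ab k km x xab) _.
  by apply: wp => //; rewrite cc lerDl.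
have cl2 a b : K a -> a < b -> forall k, (k <= m)%N -> forall x, a <= x <= b ->
    `|g k x - (Tg a)^`(k).[x]| <= (c - C) * w (b - a) * (b - a) ^+ (m - k).
  move=> Ka ab k km x xab; apply: le_trans (close2 a b Ka ab k km x xab) _.
  by apply: wp => //; rewrite cc lerDr.
exists f, g, (glue_fun K h E), (C1 + C2); split => //.
- apply: (@glue_deriv R K K_closed K_below K_above h u E).
  + by move=> l r gp; have [_ -> ->] := gE l r gp.
  + move=> l r x gp xlr; have [dE _ _] := gE l r gp.
    have [f0 f1 _] := gf l r gp; have [g0 g1 _] := gg l r gp.
    have fE k : (k <= m)%N -> f k x = (Pf l r)^`(k).[x].
      by move=> km; rewrite /f /glued (glue_gap gp) ?(flatBE f0) ?(flatBE f1).
    have gE' k : (k <= m)%N -> g k x = (Pg l r)^`(k).[x].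
      by move=> km; rewrite /g /glued (glue_gap gp) ?(flatBE g0) ?(flatBE g1).
    rewrite /u dE !fE// !gE'// !derivn0 !derivn1 /area hornerZ hornerD hornerN !hornerM.
    by [].
  + exact: u_continuous.
  + by move=> a Ka e e0; exact: (height_rel_deriv C0 D00 hA ff fg cf cg jf jg cC cl1 cl2).
- split; first by rewrite addr_ge0.
  move=> x y; have W : 0 <= w `|x - y| by rewrite (modulus_ge0 w_mod).
  split; [apply: le_trans (mf x y) _|apply: le_trans (mg x y) _]; rewrite ler_wpM2r//.
    by rewrite lerDl.
  by rewrite lerDr.
- by move=> k x km Kx; rewrite jf// jg.
- by move=> x Kx; rewrite glue_in.
Qed.

End CurveExtension.

(** * Jets from interpolation on finite sets *)

Section Jets.
Variable R : realType.
Variables (m : nat) (w : R -> R) (K : set R) (M : R).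
Hypothesis w_mod : modulus w.
Hypothesis M_ge0 : 0 <= M.

Definition limit_pt (a : R) := K a /\
  forall d : R, 0 < d -> exists y, [/\ K y, y != a & `|y - a| < d].

(** The induction carries a distance [eta] from a to the points already chosen; a point of K closer
    than [eta] is new. *)
Lemma limit_points a n (d : R) : limit_pt a -> 0 < d ->
  exists X : {fset R}, [/\ #|` X| = n.+1, a \in X &
    forall x, x \in X -> K x /\ `|x - a| < d].
Proof.
move=> [Ka acc] d0.
suff [X [cX aX HX _]] : exists X : {fset R}, [/\ #|` X| = n.+1, a \in X,
    (forall x, x \in X -> K x /\ `|x - a| < d) &
    exists2 eta : R, 0 < eta & forall x, x \in X -> x != a -> eta <= `|x - a|].
  by exists X.
elim: n => [|n [X [cX aX HX [eta eta0 He]]]].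
  exists [fset a]%fset; rewrite cardfs1 inE eqxx; split => //.
    by move=> x; rewrite inE => /eqP ->; rewrite subrr normr0.
  by exists 1 => // x; rewrite inE => ->.
have [|y [Ky ya yd]] := acc (Num.min d eta); first by rewrite lt_min d0.
move: yd; rewrite lt_min => /andP[yd ye].
have yX : y \notin X by apply/negP => yX; have := He y yX ya; rewrite leNgt ye.
exists (y |` X)%fset; rewrite cardfsU1 yX cX inE aX orbT; split => //.
  by move=> x; rewrite !inE => /predU1P[->|/HX].
exists `|y - a|; first by rewrite normr_gt0 subr_eq0.
move=> x; rewrite !inE => /predU1P[->//|xX] xa.
exact: le_trans (ltW ye) (He x xX xa).
Qed.

Lemma limit_points2 a b n (d : R) : limit_pt a -> K b -> b != a -> 0 < d ->
  exists X : {fset R}, [/\ #|` X| = n.+2, a \in X, b \in X &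
    forall x, x \in X -> K x /\ (x = b \/ `|x - a| < d)].
Proof.
move=> acc Kb ba d0.
have [|X [cX aX HX]] := @limit_points a n (Num.min d `|b - a|) acc.
  by rewrite lt_min d0 normr_gt0 subr_eq0.
have bX : b \notin X.
  by apply/negP => /HX[_]; rewrite lt_min ltxx andbF.
exists (b |` X)%fset; rewrite cardfsU1 bX cX !inE eqxx aX orbT; split => //.
move=> x; rewrite !inE => /predU1P[->|/HX[Kx]]; first by split => //; left.
by rewrite lt_min => /andP[xd _]; split => //; right.
Qed.

Variables (f : R -> R) (phi : {fset R} -> nat -> R -> R).

Definition admissible (X : {fset R}) := (forall x, x \in X -> K x) /\ #|` X| = m.+2.

Hypothesis phi_family : forall X, admissible X -> deriv_family m (phi X).
Hypothesis phi_modulus : forall X, admissible X ->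
  forall x y, `|phi X m x - phi X m y| <= M * w `|x - y|.
Hypothesis phi_value : forall X, admissible X -> forall x, x \in X -> phi X 0%N x = f x.

Definition inside (c d : R) (X : {fset R}) := forall x, x \in X -> c <= x <= d.

(** The difference vanishes at the m+1 common points, so every derivative of order at most m has a
    zero in [c, d]; then [family_bound] applies with A = 0. *)
Lemma swap_bound X Y c d : c < d -> admissible X -> admissible Y -> inside c d X ->
  (m < #|` X `&` Y|%fset)%N ->
  forall k, (k <= m)%N -> forall x, c <= x <= d ->
    `|phi X k x - phi Y k x| <= 2 * M * w (d - c) * (d - c) ^+ (m - k).
Proof.
move=> cd aX aY iX card k km x xcd.
have fam := deriv_familyB (phi_family aX) (phi_family aY).
have := @family_bound R m (fun k x => phi X k x - phi Y k x) c d 0 (2 * M * w (d - c)) fam (lexx 0) (ltW cd).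
rewrite mulr0 addr0; apply => //; last first.
  move=> j jm; have [|||xi xicd xi0] := @rolle_family R m _ (X `&` Y)%fset c d fam _ _ _ j jm.
  - exact: card.
  - exact: fset_uniq.
  - move=> y; rewrite inE => /andP[yX yY]; split; first exact: iX.
    by rewrite !phi_value// subrr.
  by exists xi => //; rewrite xi0 normr0 mul0r.
move=> y z ycd zcd.
have yz : w `|y - z| <= w (d - c) by rewrite (modulus_le w_mod)// ler_norml; lra.
have h1 := phi_modulus aX y z; have h2 := phi_modulus aY y z.
rewrite (_ : _ - _ = (phi X m y - phi X m z) - (phi Y m y - phi Y m z)); last by ring.
apply: le_trans (ler_normB _ _) _.
have := ler_wpM2l M_ge0 yz; lra.
Qed.

(** Induction on the number of points of X outside Y: one of them is exchanged for a point of Y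
    outside X, which keeps m+1 points. At most m+2 exchanges occur. *)
Lemma chain_bound X Y c d : c < d -> admissible X -> admissible Y ->
  inside c d X -> inside c d Y ->
  forall k, (k <= m)%N -> forall x, c <= x <= d ->
    `|phi X k x - phi Y k x| <= m.+2%:R * (2 * M * w (d - c) * (d - c) ^+ (m - k)).
Proof.
move=> cd aX aY iX iY k km x xcd.
have B0 : 0 <= 2 * M * w (d - c) * (d - c) ^+ (m - k).
  have l0 : 0 <= d - c by lra.
  by rewrite mulr_ge0 ?exprn_ge0// mulr_ge0 ?(modulus_ge0 w_mod)// mulr_ge0.
suff H n Z : admissible Z -> inside c d Z -> (#|` Z `\` Y|%fset <= n)%N ->
    `|phi Z k x - phi Y k x| <= n%:R * (2 * M * w (d - c) * (d - c) ^+ (m - k)).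
  apply: H => //; have [_ <-] := aX; exact: fsubset_leq_card (fsubsetDl _ _).
elim: n Z => [|n IH] Z aZ iZ cn.
  suff -> : Z = Y by rewrite subrr normr0 mul0r.
  apply/eqP; rewrite eqEfcard; have [_ ->] := aZ; have [_ ->] := aY.
  by rewrite leqnn andbT -fsetD_eq0 -cardfs_eq0 -leqn0.
have [Z0|] := eqVneq (Z `\` Y)%fset fset0.
  apply: le_trans (IH Z aZ iZ _) _; first by rewrite Z0 cardfs0.
  by rewrite ler_wpM2r// ler_nat.
case/fset0Pn => x0; rewrite inE => /andP[x0Y x0Z].
have cE : #|` Y `\` Z|%fset = #|` Z `\` Y|%fset.
  by rewrite !cardfsD (proj2 aZ) (proj2 aY) fsetIC.
have [y0] : exists y0, y0 \in (Y `\` Z)%fset.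
  apply/fset0Pn; rewrite -cardfs_eq0 cE cardfs_eq0; apply/fset0Pn; exists x0.
  by rewrite inE x0Y.
rewrite inE => /andP[y0Z y0Y].
pose Z' := (y0 |` (Z `\ x0))%fset.
have c1 : #|` Z `\ x0|%fset = m.+1.
  by have := cardfsD1 x0 Z; rewrite x0Z (proj2 aZ) => -[].
have aZ' : admissible Z'.
  split; last by rewrite cardfsU1 c1 !inE (negbTE y0Z) andbF.
  by move=> z; rewrite !inE => /predU1P[->|/andP[_ zZ]]; [exact: (proj1 aY)|exact: (proj1 aZ)].
have iZ' : inside c d Z'.
  by move=> z; rewrite !inE => /predU1P[->|/andP[_ zZ]]; [exact: iY|exact: iZ].
have h1 : `|phi Z k x - phi Z' k x| <= 2 * M * w (d - c) * (d - c) ^+ (m - k).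
  apply: swap_bound => //; rewrite -c1; apply: fsubset_leq_card; apply/fsubsetP => z.
  by rewrite !inE => /andP[-> ->]; rewrite orbT.
have h2 : `|phi Z' k x - phi Y k x| <= n%:R * (2 * M * w (d - c) * (d - c) ^+ (m - k)).
  apply: IH => //; rewrite -ltnS; apply: leq_trans cn.
  have x0D : x0 \in (Z `\` Y)%fset by rewrite inE x0Y.
  rewrite [leqRHS](cardfsD1 x0) x0D ltnS; apply: fsubset_leq_card; apply/fsubsetP => z.
  rewrite !inE => /andP[zY /predU1P[zy|/andP[zx zZ]]]; last by rewrite zx zY zZ.
  by rewrite zy y0Y in zY.
rewrite -(subrK (phi Z' k x) (phi Z k x)) -addrA; apply: le_trans (ler_normD _ _) _.
by rewrite -[n.+1%:R]natr1 mulrDl mul1r [leRHS]addrC; exact: lerD.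
Qed.

(** Written as a composition with 1 X - a so that [derivn_comp_affine] computes its derivatives. *)
Definition taylor_poly (z : nat -> R) (a : R) : {poly R} :=
  (\poly_(k < m.+1) (z k / k`!%:R)) \Po (1 *: 'X + (- a)%:P).

Lemma size_taylor_poly z a : (size (taylor_poly z a) <= m.+1)%N.
Proof.
rewrite /taylor_poly size_comp_poly2 ?size_poly//.
by rewrite scale1r size_XaddC.
Qed.

Lemma derivn_taylor_poly z a k : (k <= m)%N -> (taylor_poly z a)^`(k).[a] = z k.
Proof.
move=> km; rewrite derivn_comp_affine expr1n scale1r horner_comp.
rewrite hornerD hornerZ hornerX hornerC mul1r subrr horner_coef0 coef_derivn addn0 ffactnn.
by rewrite coef_poly ltnS km -[LHS]mulr_natr divfK// pnatr_eq0 -lt0n fact_gt0.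
Qed.

(** Each X and each interval around a give a segment centred at [phi X k a] that should contain the
    limit. Any two such segments meet, so the supremum of their left ends lies in all of them; no
    sequence of sets is chosen. *)
Lemma limit_jet a : limit_pt a -> exists z : nat -> R, forall k, (k <= m)%N ->
  forall X c d, admissible X -> inside c d X -> c < a < d ->
    `|phi X k a - z k| <= m.+2%:R * (2 * M * w (d - c) * (d - c) ^+ (m - k)).
Proof.
move=> acc.
pose be (k : nat) (c d : R) := m.+2%:R * (2 * M * w (d - c) * (d - c) ^+ (m - k)).
have two k X c d Y c' d' : (k <= m)%N -> admissible X -> inside c d X -> c < a < d ->
    admissible Y -> inside c' d' Y -> c' < a < d' ->
    phi X k a - be k c d <= phi Y k a + be k c' d'.
  move=> km aX iX acd aY iY acd'.
  (* A third set within e of a lies in both intervals, so [chain_bound] compares it with X and with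
     Y. *)
  pose e := Num.min (Num.min (a - c) (d - a)) (Num.min (a - c') (d' - a)).
  have e0 : 0 < e by rewrite !lt_min; lra.
  have [Z [cZ aZ HZ]] := limit_points m.+1 acc e0.
  have adZ : admissible Z by split => // x /HZ[].
  have HZ' x : x \in Z -> (c <= x <= d) /\ (c' <= x <= d').
    by move=> /HZ[_]; rewrite !lt_min !ltr_norml; lra.
  have h1 : `|phi X k a - phi Z k a| <= be k c d.
    by apply: chain_bound => //; [lra|move=> x /HZ'[]|lra].
  have h2 : `|phi Y k a - phi Z k a| <= be k c' d'.
    by apply: chain_bound => //; [lra|move=> x /HZ'[]|lra].
  by move: h1 h2; rewrite !ler_norml; lra.
pose S k := [set y | exists X c d, [/\ admissible X, inside c d X, c < a < d & y = phi X k a - be k c d]].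
exists (fun k => sup (S k)) => k km X c d aX iX acd.
have Sub : ubound (S k) (phi X k a + be k c d).
  by move=> y [Y [c' [d' [aY iY acd' ->]]]]; exact: two.
have SX : S k (phi X k a - be k c d) by exists X, c, d.
have h1 : sup (S k) <= phi X k a + be k c d by apply: ge_sup; [exists (phi X k a - be k c d)|].
have h2 : phi X k a - be k c d <= sup (S k).
  by apply: ub_le_sup SX; exists (phi X k a + be k c d).
by rewrite ler_norml -/(be k c d); lra.
Qed.

(** M is the oscillation of the m-th derivative. The rest is m+1 times the bound of [limit_jet] on
    an interval of length 2 l, where w(2 l) <= 2 w(l) and (2 l)^(m-k) <= 2^m l^(m-k). *)
Definition jet_const : R := M + m.+1%:R * (m.+2%:R * (2 * M * 2) * 2 ^+ m).

(** The margin (d - c) / 2 on each side places a strictly inside an interval containing X, as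
    [limit_jet] demands, even when a is an endpoint of [c, d]. *)
Lemma jets_exist : exists T : R -> {poly R},
  [/\ forall a, (size (T a) <= m.+1)%N,
      forall a, (T a).[a] = f a,
      forall a, ~ limit_pt a -> T a = (f a)%:P &
      forall a c d X, limit_pt a -> c < d -> c <= a <= d -> admissible X ->
        inside (c - (d - c) / 2) (d + (d - c) / 2) X ->
        forall k, (k <= m)%N -> forall x, c <= x <= d ->
          `|phi X k x - (T a)^`(k).[x]| <= jet_const * w (d - c) * (d - c) ^+ (m - k)].
Proof.
have ex a : exists z : nat -> R, limit_pt a -> forall k, (k <= m)%N ->
    forall X c d, admissible X -> inside c d X -> c < a < d ->
    `|phi X k a - z k| <= m.+2%:R * (2 * M * w (d - c) * (d - c) ^+ (m - k)).
  have [acc|nacc] := pselect (limit_pt a); last by exists (fun=> 0).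
  by have [z Hz] := limit_jet acc; exists z.
have [z Hz] := choice ex.
pose T a := if `[< limit_pt a >] then taylor_poly (z a) a else (f a)%:P.
have TA a : limit_pt a -> T a = taylor_poly (z a) a by move=> acc; rewrite /T asboolT.
exists T; split.
- by move=> a; rewrite /T; case: ifP => _; [exact: size_taylor_poly|exact: leq_trans (size_polyC_leq1 _) _].
- move=> a; have [acc|nacc] := pselect (limit_pt a); last by rewrite /T asboolF// hornerC.
  rewrite TA// -[taylor_poly _ _]derivn0 derivn_taylor_poly//.
  apply/eqP; rewrite eq_sym -subr_eq0 -normr_le0; apply/ler_addgt0Pr => e e0; rewrite add0r.
  (* For the value at a: a set containing a and lying within r of it gives |f a - z 0| <= c w(2 r)
     as 2 r <= 1, and the right-hand side tends to 0. *)
  pose c := m.+2%:R * (2 * M) + 1.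
  have c0 : 0 < c by rewrite ltr_wpDl// !mulr_ge0.
  have [|d d0 Hd] := modulus_small w_mod (_ : 0 < e / c); first by rewrite divr_gt0.
  pose r := Num.min d 1 / 2.
  have r0 : 0 < r by rewrite divr_gt0// lt_min d0 ltr01.
  have [rd r1] : 2 * r <= d /\ 2 * r <= 1.
    have /andP[h1 h2] : (Num.min d 1 <= d) && (Num.min d 1 <= 1) by rewrite !ge_min !lexx orbT.
    by rewrite /r; split; lra.
  have [X [cX aX HX]] := limit_points m.+1 acc r0.
  have adX : admissible X by split => // x /HX[].
  have inX : inside (a - r) (a + r) X by move=> x /HX[_]; rewrite ltr_norml; lra.
  have := Hz a acc 0%N (leq0n _) X (a - r) (a + r) adX inX.
  rewrite (phi_value adX aX) subn0 (_ : a + r - (a - r) = 2 * r); last by ring.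
  move=> h; apply: le_trans (h _) _; first lra.
  have hw : w (2 * r) <= e / c by apply: Hd; lra.
  have w0 : 0 <= w (2 * r) by rewrite (modulus_ge0 w_mod)//; lra.
  apply: (@le_trans _ _ (m.+2%:R * (2 * M * w (2 * r)))).
    rewrite ler_wpM2l// ler_piMr// ?mulr_ge0//.
    by rewrite exprn_ile1//; lra.
  have k0 : 0 <= m.+2%:R * (2 * M) by rewrite !mulr_ge0.
  rewrite mulrA; apply: (@le_trans _ _ (m.+2%:R * (2 * M) * (e / c))).
    by rewrite ler_wpM2l.
  by rewrite mulrC mulrAC ler_pdivrMr// ler_wpM2l ?(ltW e0)// lerDl.
- by move=> a nacc; rewrite /T asboolF.
move=> a c d X acc cd acd aX iX k km x xcd; rewrite TA//.
have l0 : 0 < d - c by lra.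
have w0 : 0 <= w (d - c) by rewrite (modulus_ge0 w_mod) ?ltW.
have fam := deriv_familyB (phi_family aX) (deriv_family_poly (m := m) (taylor_poly (z a) a)).
pose A := m.+2%:R * (2 * M * 2) * 2 ^+ m * w (d - c).
have A0 : 0 <= A by rewrite !mulr_ge0 ?exprn_ge0.
have := @family_bound R m _ c d A (M * w (d - c)) fam A0 (ltW cd).
rewrite (_ : M * w (d - c) + m.+1%:R * A = jet_const * w (d - c)); last by rewrite /A /jet_const; ring.
apply => //.
- move=> y y' ycd ycd'; rewrite (derivn_size_const y y' (size_taylor_poly _ _)).
  rewrite (_ : _ - _ = phi X m y - phi X m y'); last by ring.
  apply: le_trans (phi_modulus aX y y') _; rewrite ler_wpM2l// (modulus_le w_mod)//.
  by rewrite ler_norml; lra.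
- move=> j jm; exists a => //; rewrite derivn_taylor_poly//.
  have := Hz a acc j jm X _ _ aX iX.
  rewrite (_ : d + (d - c) / 2 - (c - (d - c) / 2) = 2 * (d - c)); last by field.
  move=> h; apply: le_trans (h _) _; first lra.
  rewrite exprMn /A.
  have e1 : w (2 * (d - c)) <= 2 * w (d - c) by apply: modulus_double => //; exact: ltW.
  have e2 : 2 ^+ (m - j) <= 2 ^+ m :> R by rewrite ler_eXn2l ?leq_subr// ltr1n.
  have P0 : 0 <= (d - c) ^+ (m - j) by rewrite exprn_ge0// ltW.
  have w20 : 0 <= w (2 * (d - c)) by rewrite (modulus_ge0 w_mod)// mulr_ge0// ltW.
  have := ler_pM w20 (exprn_ge0 (m - j) (_ : 0 <= 2)) e1 e2; rewrite ler0n => /(_ isT) h2.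
  have := ler_wpM2r P0 h2.
  have M20 : 0 <= m.+2%:R * (2 * M) by rewrite !mulr_ge0.
  move=> /(ler_wpM2l M20); lra.
Qed.

End Jets.

(** * Extension from a compact set *)

Section Completion.
Variable R : realType.
Variables (m : nat) (w : R -> R) (K : set R) (M N dl Bv : R).
Hypothesis m_gt0 : (0 < m)%N.
Hypothesis w_mod : modulus w.
Hypothesis M_ge0 : 0 <= M.
Hypothesis K_closed : closed K.
Hypothesis N_ge0 : 0 <= N.
Hypothesis K_bound : forall a, K a -> `|a| <= N.
Hypothesis dl01 : 0 < dl <= 1.
Hypothesis K_sep : forall p y, K p -> ~ limit_pt K p -> K y -> y != p -> dl <= `|y - p|.

(* K together with two rays, so that every point outside lies in a bounded gap; the fields are
   extended by 0 on the rays. *)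
Definition completed : set R := [set x | K x \/ x <= - (N + 1) \/ N + 1 <= x].

Lemma completed_closed : closed completed.
Proof.
apply: closedU => //; apply: closedU; [exact: closed_le|exact: closed_ge].
Qed.

Lemma completed_below x : exists2 l, completed l & l <= x.
Proof.
by exists (Num.min x (- (N + 1))); [right; left; rewrite ge_min lexx orbT|rewrite ge_min lexx].
Qed.

Lemma completed_above x : exists2 r, completed r & x <= r.
Proof.
by exists (Num.max x (N + 1)); [right; right; rewrite le_max lexx orbT|rewrite le_max lexx].
Qed.

Lemma completed_gap l r : gap completed l r -> r - l <= 2 * N + 2.
Proof.
move=> [Kl Kr lr H].
have h1 : - (N + 1) <= l.
  rewrite leNgt; apply/negP => h.
  pose y := (l + Num.min r (- (N + 1))) / 2.
  have /andP[m1 m2] : (Num.min r (- (N + 1)) <= r) && (Num.min r (- (N + 1)) <= - (N + 1)).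
    by rewrite !ge_min !lexx orbT.
  have m3 : l < Num.min r (- (N + 1)) by rewrite lt_min lr.
  by apply: (H y); [rewrite /y; lra|right; left; rewrite /y; lra].
have h2 : r <= N + 1.
  rewrite leNgt; apply/negP => h.
  pose y := (r + Num.max l (N + 1)) / 2.
  have /andP[m1 m2] : (l <= Num.max l (N + 1)) && (N + 1 <= Num.max l (N + 1)).
    by rewrite !le_max !lexx orbT.
  have m3 : Num.max l (N + 1) < r by rewrite gt_max lr.
  by apply: (H y); [rewrite /y; lra|right; right; rewrite /y; lra].
lra.
Qed.

Lemma notK_ray a : a <= - (N + 1) \/ N + 1 <= a -> ~ K a.
Proof. by move=> h /K_bound; rewrite ler_norml; case: h; lra. Qed.

(** Only pairs of limit points need the estimates by interpolants. Two points outside K carry zero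
    data, and all remaining pairs are at least dl apart, where a large constant suffices; a point of
    K and a ray are at least 1 apart, whence dl <= 1. *)
Lemma completed_pair a b : completed a -> completed b -> a < b ->
  [\/ limit_pt K a /\ limit_pt K b,
      ~ K a /\ ~ K b | dl <= b - a].
Proof.
move=> Ka Kb ab; have /andP[dl0 dl1] := dl01.
have [ka|nka] := pselect (K a); have [kb|nkb] := pselect (K b).
- have [aa|naa] := pselect (limit_pt K a); last first.
    constructor 3; have := K_sep ka naa kb; rewrite gt_eqF// => /(_ isT).
    by rewrite ger0_norm ?subr_ge0// ltW.
  have [bb|nbb] := pselect (limit_pt K b); first by constructor 1.
  constructor 3; have := K_sep kb nbb ka; rewrite lt_eqF// => /(_ isT).
  by rewrite distrC ger0_norm ?subr_ge0// ltW.
- case: Kb => [//|Kb]; constructor 3; have := K_bound ka; rewrite ler_norml.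
  by case: Kb; lra.
- case: Ka => [//|Ka]; constructor 3; have := K_bound kb; rewrite ler_norml.
  by case: Ka; lra.
- by constructor 2.
Qed.

Lemma scaledI (p : {poly R}) (a b A : R) :
  (forall k, (k <= m)%N -> forall x, a <= x <= b -> `|p^`(k).[x]| <= A * (b - a) ^+ (m - k)) ->
  a < b -> scaled m a b (A * (b - a) ^+ m) p.
Proof.
move=> H ab k km x xab; rewrite -[X in _ <= A * _ ^+ X](subnK km) exprD mulrA.
by rewrite ler_wpM2r ?H// exprn_ge0// subr_ge0 ltW.
Qed.

(** [family_bound] with A = B0 / e^m, since (d - c)^(m-k) >= e^m; the m-th derivative is constant,
    so L = 0. *)
Lemma poly_growth (p : {poly R}) (a c d B0 e : R) : 0 < e <= 1 -> e <= d - c ->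
  c <= a <= d -> (size p <= m.+1)%N -> 0 <= B0 ->
  (forall k, (k <= m)%N -> `|p^`(k).[a]| <= B0) ->
  forall k, (k <= m)%N -> forall x, c <= x <= d ->
    `|p^`(k).[x]| <= m.+1%:R * (B0 / e ^+ m) * (d - c) ^+ (m - k).
Proof.
move=> /andP[e0 e1] el acd sp B00 hB k km x xcd.
have A0 : 0 <= B0 / e ^+ m by rewrite divr_ge0// exprn_ge0// ltW.
have cd : c <= d by lra.
have := @family_bound R m _ c d (B0 / e ^+ m) 0 (deriv_family_poly (m := m) p) A0 cd.
rewrite add0r; apply => // [y z _ _|j jm].
  by rewrite (derivn_size_const y z sp) subrr normr0.
exists a => //; apply: le_trans (hB j jm) _.
rewrite -mulrA ler_peMr// mulrC ler_pdivlMr ?exprn_gt0// mul1r.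
apply: (@le_trans _ _ (e ^+ (m - j))).
  by apply: ler_wiXn2l; rewrite ?leq_subr// ltW.
by apply: lerXn2r; rewrite ?nnegrE; lra.
Qed.

Definition extend0 (F : R -> {poly R}) (a : R) : {poly R} := if `[< K a >] then F a else 0.

Lemma extend0_in F a : K a -> extend0 F a = F a.
Proof. by move=> Ka; rewrite /extend0 asboolT. Qed.

Lemma extend0_out F a : ~ K a -> extend0 F a = 0.
Proof. by move=> Ka; rewrite /extend0 asboolF. Qed.

Let J := jet_const m M.

Definition jet_field (f : R -> R) (phi : {fset R} -> nat -> R -> R) (T : R -> {poly R}) :=
  [/\ forall a, (size (T a) <= m.+1)%N,
      forall a, (T a).[a] = f a,
      forall a, ~ limit_pt K a -> T a = (f a)%:P &
      forall a c d X, limit_pt K a -> c < d -> c <= a <= d -> admissible m K X ->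
        inside (c - (d - c) / 2) (d + (d - c) / 2) X ->
        forall k, (k <= m)%N -> forall x, c <= x <= d ->
          `|phi X k x - (T a)^`(k).[x]| <= J * w (d - c) * (d - c) ^+ (m - k)].

Lemma J_ge0 : 0 <= J.
Proof. by rewrite /J /jet_const addr_ge0 ?mulr_ge0 ?exprn_ge0 ?mulr_ge0. Qed.

Lemma size_extend0 f phi T a : jet_field f phi T -> (size (extend0 T a) <= m.+1)%N.
Proof.
move=> [sT _ _ _]; have [Ka|nKa] := pselect (K a); first by rewrite extend0_in.
by rewrite extend0_out// size_poly0.
Qed.

(** A single interpolant, on a set near one limit point a0, is compared on [-(N+1), N+1] with the
    jets at all limit points, so these stay within a bounded distance of the jet at a0. Elsewhere
    the jets are constants or 0. *)
Lemma jets_bounded f phi T : jet_field f phi T -> (forall a, K a -> `|f a| <= Bv) -> 0 <= Bv ->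
  exists2 B0 : R, 0 <= B0 & forall a k, (k <= m)%N -> `|(extend0 T a)^`(k).[a]| <= B0.
Proof.
move=> [sT vT cT jT] fB Bv0; have NN : 0 <= N := N_ge0.
have J0 := J_ge0.
have cst_case a k : ~ limit_pt K a -> `|(extend0 T a)^`(k).[a]| <= Bv.
  move=> na; have [Ka|nKa] := pselect (K a); last by rewrite extend0_out// linear0 horner0 normr0.
  rewrite extend0_in// cT//; case: k => [|k]; first by rewrite derivn0 hornerC fB.
  by rewrite derivSn derivC linear0 horner0 normr0.
have [[a0 acc0]|nacc] := pselect (exists a0, limit_pt K a0); last first.
  by exists Bv => // a k _; apply: cst_case => aa; apply: nacc; exists a.
pose D := 2 * N + 2.
have D1 : 1 <= D by rewrite /D; lra.
pose B00 := \sum_(k < m.+1) `|(T a0)^`(k).[a0]|.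
have B000 : 0 <= B00 by apply: sumr_ge0.
have B00le k : (k <= m)%N -> `|(T a0)^`(k).[a0]| <= B00.
  move=> km; rewrite /B00 (bigD1 (Ordinal (km : (k < m.+1)%N)))//= lerDl.
  by apply: sumr_ge0.
have [X [cX aX HX]] := limit_points m.+1 acc0 ltr01.
have adX : admissible m K X by split => // x /HX[].
have DE : N + 1 - (- (N + 1)) = D by rewrite /D; ring.
have inX : inside (- (N + 1) - (N + 1 - (- (N + 1))) / 2) (N + 1 + (N + 1 - (- (N + 1))) / 2) X.
  by move=> x /HX[Kx _]; have := K_bound Kx; rewrite ler_norml; lra.
have wD : 0 <= w D by rewrite (modulus_ge0 w_mod)//; lra.
have powD k : (k <= m)%N -> D ^+ (m - k) <= D ^+ m by move=> km; rewrite ler_weXn2l// leq_subr.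
have Ic a : K a -> - (N + 1) <= a <= N + 1 by move=> /K_bound; rewrite ler_norml; lra.
exists (Bv + 2 * (J * w D * D ^+ m) + m.+1%:R * (B00 / 1 ^+ m) * D ^+ m).
  have D0 : 0 <= D by lra.
  by rewrite !addr_ge0 ?mulr_ge0 ?exprn_ge0 ?divr_ge0 ?exprn_ge0.
move=> a k km.
have P1 : 0 <= J * w D * D ^+ m by rewrite !mulr_ge0 ?exprn_ge0//; lra.
have P2 : 0 <= m.+1%:R * (B00 / 1 ^+ m) * D ^+ m.
  by rewrite !mulr_ge0 ?exprn_ge0 ?invr_ge0 ?exprn_ge0//; lra.
have [acc|na] := pselect (limit_pt K a); last first.
  by apply: le_trans (cst_case a k na) _; lra.
have Ka : K a by case: acc.
rewrite extend0_in//.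
have cd : - (N + 1) < N + 1 by lra.
have h1 := jT a _ _ X acc cd (Ic a Ka) adX inX k km a (Ic a Ka).
have h2 := jT a0 _ _ X acc0 cd (Ic a0 (proj1 acc0)) adX inX k km a (Ic a Ka).
have h3 : `|(T a0)^`(k).[a]| <= m.+1%:R * (B00 / 1 ^+ m) * D ^+ (m - k).
  rewrite -DE; apply: (@poly_growth (T a0) a0) => //; rewrite ?DE ?lexx ?ltr01//.
  - by apply: Ic; case: acc0.
  - exact: Ic.
rewrite DE in h1 h2.
have e1 : J * w D * D ^+ (m - k) <= J * w D * D ^+ m by rewrite ler_wpM2l ?powD// mulr_ge0.
have e2 : m.+1%:R * (B00 / 1 ^+ m) * D ^+ (m - k) <= m.+1%:R * (B00 / 1 ^+ m) * D ^+ m.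
  by rewrite ler_wpM2l ?powD// mulr_ge0// divr_ge0// exprn_ge0.
rewrite (_ : (T a)^`(k).[a] = (phi X k a - (T a0)^`(k).[a]) - (phi X k a - (T a)^`(k).[a]) + (T a0)^`(k).[a]); last by ring.
apply: le_trans (ler_normD _ _) _; apply: le_trans (lerD (ler_normB _ _) (lexx _)) _.
lra.
Qed.

Lemma pair_bound T B0 a b x k : 0 <= B0 -> (forall a, (size (extend0 T a) <= m.+1)%N) ->
  (forall a k, (k <= m)%N -> `|(extend0 T a)^`(k).[a]| <= B0) ->
  dl <= b - a -> (k <= m)%N -> a <= x <= b ->
  `|(extend0 T a)^`(k).[x]| <= m.+1%:R * (B0 / dl ^+ m) * (b - a) ^+ (m - k) /\
  `|(extend0 T b)^`(k).[x]| <= m.+1%:R * (B0 / dl ^+ m) * (b - a) ^+ (m - k).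
Proof.
move=> B00 sT hB lab km xab; have /andP[dl0 dl1] := dl01.
split; [apply: (@poly_growth _ a)|apply: (@poly_growth _ b)] => //; try lra;
  by move=> j jm; exact: hB.
Qed.

Lemma completed_field f phi T : jet_field f phi T -> (forall a, K a -> `|f a| <= Bv) -> 0 <= Bv ->
  exists2 C : R, 0 <= C & taylor_field m w completed C (extend0 T).
Proof.
move=> jf fB Bv0; have [B0 B00 hB] := jets_bounded jf fB Bv0.
have [sT vT cT jT] := jf; have J0 := J_ge0; have /andP[dl0 dl1] := dl01.
have wd : 0 < w dl by exact: modulus_gt0.
(* For pairs at least dl apart: dividing by w dl compensates for w(b - a) >= w dl. *)
pose C1 := 2 * (m.+1%:R * (B0 / dl ^+ m)) / w dl.
have C10 : 0 <= C1 by rewrite divr_ge0 ?(ltW wd)// !mulr_ge0 ?invr_ge0 ?exprn_ge0// ltW.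
have sT' a := size_extend0 a jf.
exists (2 * J + C1); first by rewrite addr_ge0// mulr_ge0.
split => // a b Ka Kb ab; have l0 : 0 < b - a by lra.
have W0 : 0 < w (b - a) by exact: modulus_gt0.
rewrite mulrA; apply: scaledI => // k km x xab; rewrite derivnB hornerD hornerN.
have P0 : 0 <= (b - a) ^+ (m - k) by rewrite exprn_ge0// ltW.
have [[accA accB]|[na nb]|lab] := completed_pair Ka Kb ab.
(* A set clustered near a serves both jets: it only has to lie in [a, b] enlarged by half its
   length. *)
- have [|X [cX aX HX]] := limit_points m.+1 accA (_ : 0 < (b - a) / 2); first lra.
  have adX : admissible m K X by split => // y /HX[].
  have inX : inside (a - (b - a) / 2) (b + (b - a) / 2) X.
    by move=> y /HX[_]; rewrite ltr_norml; lra.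
  have aab : a <= a <= b by rewrite lexx ltW.
  have bab : a <= b <= b by rewrite lexx ltW.
  have h1 := jT a a b X accA ab aab adX inX k km x xab.
  have h2 := jT b a b X accB ab bab adX inX k km x xab.
  rewrite !extend0_in; [|by case: accA|by case: accB].
  rewrite (_ : _ - _ = (phi X k x - (T a)^`(k).[x]) - (phi X k x - (T b)^`(k).[x])); last by ring.
  apply: le_trans (ler_normB _ _) _.
  have : 0 <= C1 * w (b - a) * (b - a) ^+ (m - k) := mulr_ge0 (mulr_ge0 C10 (ltW W0)) P0.
  lra.
- rewrite !extend0_out// linear0 horner0 subrr normr0.
  by rewrite !mulr_ge0 ?(ltW W0)// addr_ge0// mulr_ge0.
- have [h1 h2] := pair_bound B00 sT' hB lab km xab.
  apply: le_trans (ler_normB _ _) _.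
  have wl : w dl <= w (b - a) by rewrite (modulus_le w_mod)// ltW.
  have e : 2 * (m.+1%:R * (B0 / dl ^+ m)) <= C1 * w (b - a).
    rewrite /C1 mulrAC ler_pdivlMr// ler_wpM2l// !mulr_ge0 ?invr_ge0 ?exprn_ge0//.
    exact: ltW.
  have := ler_wpM2r P0 e.
  have : 0 <= 2 * J * w (b - a) * (b - a) ^+ (m - k).
    by rewrite mulr_ge0// mulr_ge0 ?(ltW W0)// mulr_ge0.
  lra.
Qed.

Variables (f g h : R -> R) (phi psi : {fset R} -> nat -> R -> R) (Tf Tg : R -> {poly R}) (M2 : R).
Hypothesis M2_ge0 : 0 <= M2.
Hypothesis Bv_ge0 : 0 <= Bv.
Hypotheses (f_bound : forall a, K a -> `|f a| <= Bv) (g_bound : forall a, K a -> `|g a| <= Bv)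
  (h_bound : forall a, K a -> `|h a| <= Bv).
Hypotheses (Tf_jet : jet_field f phi Tf) (Tg_jet : jet_field g psi Tg).
Hypothesis phi_family : forall X, admissible m K X -> deriv_family m (phi X).
Hypothesis phi_modulus : forall X, admissible m K X ->
  forall x y, `|phi X m x - phi X m y| <= M * w `|x - y|.
Hypothesis phi_value : forall X, admissible m K X -> forall x, x \in X -> phi X 0%N x = f x.
Hypothesis psi_family : forall X, admissible m K X -> deriv_family m (psi X).
Hypothesis psi_modulus : forall X, admissible m K X ->
  forall x y, `|psi X m x - psi X m y| <= M * w `|x - y|.
Hypothesis psi_value : forall X, admissible m K X -> forall x, x \in X -> psi X 0%N x = g x.

Let T1 X a := taylor_poly m ((phi X)^~ a) a.
Let T2 X a := taylor_poly m ((psi X)^~ a) a.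

Hypothesis area_hyp : forall X a b, admissible m K X -> a \in X -> b \in X -> a < b ->
  forall (E : {poly R}) (B : R), E^`() = area (T1 X a) (T2 X a) ->
    (forall x, a <= x <= b -> `|(T1 X a)^`().[x]| <= B /\ `|(T2 X a)^`().[x]| <= B) ->
    let th := w (b - a) * (b - a) ^+ m in
    `|h b - h a - (E.[b] - E.[a]) + 2 * (T1 X a).[a] * (g b - (T2 X a).[b])
      - 2 * (T2 X a).[a] * (f b - (T1 X a).[b])| <= M2 * (th ^+ 2 + th * B * (b - a)).

Definition extend0r (u : R -> R) (a : R) : R := if `[< K a >] then u a else 0.

Lemma taylor_close u a b k x : deriv_family m u ->
  (forall x y, `|u m x - u m y| <= M * w `|x - y|) -> a < b -> (k <= m)%N -> a <= x <= b ->
  `|u k x - (taylor_poly m (u^~ a) a)^`(k).[x]| <= M * w (b - a) * (b - a) ^+ (m - k).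
Proof.
move=> hu mu ab km xab.
have fam := deriv_familyB hu (deriv_family_poly (m := m) (taylor_poly m (u^~ a) a)).
have := @family_bound R m _ a b 0 (M * w (b - a)) fam (lexx 0) (ltW ab).
rewrite mulr0 addr0; apply => // [y z yab zab|j jm].
  rewrite (derivn_size_const y z (size_taylor_poly _ _ _)).
  rewrite (_ : _ - _ = u m y - u m z); last by ring.
  apply: le_trans (mu y z) _; rewrite ler_wpM2l// (modulus_le w_mod)// ler_norml; lra.
by exists a; rewrite ?lexx ?(ltW ab)// derivn_taylor_poly// subrr normr0 mul0r.
Qed.

(** For limit points a and b, T1 and T2 are Taylor polynomials at a of an interpolant through both
    points; they are near the jets because both are near the interpolant. For distant pairs the jets
    themselves are used, since the left-hand side is bounded and th is bounded below. *)
Lemma completed_area_field : exists2 C : R, 0 <= C &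
  area_field m w completed C (2 * N + 2) (extend0 Tf) (extend0 Tg) (extend0r h).
Proof.
have [Bf Bf0 hBf] := jets_bounded Tf_jet f_bound Bv_ge0.
have [Bg Bg0 hBg] := jets_bounded Tg_jet g_bound Bv_ge0.
have sTf a := size_extend0 a Tf_jet; have sTg a := size_extend0 a Tg_jet.
have [_ vf cf jf] := Tf_jet; have [_ vg cg jg] := Tg_jet.
have J0 := J_ge0; have /andP[dl0 dl1] := dl01.
have M20 : 0 <= M2 := M2_ge0; have Bv0 : 0 <= Bv := Bv_ge0; have M0 : 0 <= M := M_ge0.
have N0 : 0 <= N := N_ge0.
have wd : 0 < w dl by exact: modulus_gt0.
pose B0 := Bf + Bg; have B00 : 0 <= B0 by rewrite addr_ge0.
pose D := 2 * N + 2; have D1 : 1 <= D by rewrite /D; lra.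
pose Bp := m.+1%:R * (B0 / dl ^+ m) * D ^+ m.
have Bp0 : 0 <= Bp by rewrite !mulr_ge0 ?invr_ge0 ?exprn_ge0//; lra.
(* 2 Bv bounds the difference of heights, 4 Bp^2 D the area over a length at most D, and 4 Bp^2 each
   of the two cross terms. *)
pose Bt := 2 * Bv + 4 * Bp ^+ 2 * D + 8 * Bp ^+ 2.
have Bt0 : 0 <= Bt.
  have h1 := sqr_ge0 Bp.
  have h2 : 0 <= Bp ^+ 2 * D by apply: mulr_ge0 => //; lra.
  by rewrite /Bt; lra.
pose th0 := w dl * dl ^+ m.
have th00 : 0 < th0 by rewrite mulr_gt0// exprn_gt0.
have Bt1 : 0 <= Bt / th0 ^+ 2 by rewrite divr_ge0// sqr_ge0.
have CC : 0 <= M + J + M2 + Bt / th0 ^+ 2 := addr_ge0 (addr_ge0 (addr_ge0 M0 J0) M20) Bt1.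
exists (M + J + M2 + Bt / th0 ^+ 2) => //.
move=> a b Ka Kb ab lD th.
have l0 : 0 < b - a by lra.
have W0 : 0 < w (b - a) by exact: modulus_gt0.
have thp : 0 < th by rewrite mulr_gt0// exprn_gt0.
have aab : a <= a <= b by rewrite lexx ltW.
have bab : a <= b <= b by rewrite lexx ltW.
have Bpos (B : R) (p q : {poly R}) : (forall x, a <= x <= b -> `|p.[x]| <= B /\ `|q.[x]| <= B) -> 0 <= B.
  by move=> /(_ a aab)[h1 _]; exact: le_trans h1.
have [[accA accB]|[na nb]|lab] := completed_pair Ka Kb ab.
- have KA : K a by case: accA.
  have KB : K b by case: accB.
  have ba : b != a by rewrite gt_eqF.
  have e0 : 0 < (b - a) / 2 by lra.
  (* X must contain both a and b, as the area hypothesis involves the prescribed values of all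
     components at both ends. *)
  have [X [cX aX bX HX]] := limit_points2 m accA KB ba e0.
  have adX : admissible m K X by split => // y /HX[].
  have inX : inside (a - (b - a) / 2) (b + (b - a) / 2) X.
    by move=> y /HX[_ [->|]]; rewrite ?ltr_norml; lra.
  rewrite !extend0_in//.
  exists (T1 X a), (T2 X a); split.
  + by split; exact: size_taylor_poly.
  + rewrite vf vg -[T1 X a]derivn0 -[T2 X a]derivn0 !derivn_taylor_poly//.
    by rewrite (phi_value adX aX) (psi_value adX aX).
  + have s (u : {fset R} -> nat -> R -> R) (T : R -> {poly R}) :
       deriv_family m (u X) -> (forall x y, `|u X m x - u X m y| <= M * w `|x - y|) ->
       (forall k, (k <= m)%N -> forall x, a <= x <= b ->
          `|u X k x - (T a)^`(k).[x]| <= J * w (b - a) * (b - a) ^+ (m - k)) ->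
       scaled m a b ((M + J + M2 + Bt / th0 ^+ 2) * th) (T a - taylor_poly m ((u X)^~ a) a).
      move=> hu mu ju; rewrite /th mulrA; apply: scaledI => // k km x xab.
      rewrite derivnB hornerD hornerN.
      have h1 := taylor_close hu mu ab km xab; have h2 := ju k km x xab.
      rewrite (_ : _ - _ = (u X k x - (taylor_poly m ((u X)^~ a) a)^`(k).[x]) - (u X k x - (T a)^`(k).[x])); last by ring.
      apply: le_trans (ler_normB _ _) _.
      have P0 : 0 <= (b - a) ^+ (m - k) by rewrite exprn_ge0// ltW.
      have := mulr_ge0 (mulr_ge0 M20 (ltW W0)) P0.
      have := mulr_ge0 (mulr_ge0 Bt1 (ltW W0)) P0.
      lra.
    split; apply: s.
    * exact: phi_family.
    * exact: phi_modulus.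
    * exact: (jf a a b X accA ab aab adX inX).
    * exact: psi_family.
    * exact: psi_modulus.
    * exact: (jg a a b X accA ab aab adX inX).
  + move=> E B dE hB; rewrite vf vg /extend0r !asboolT//.
    apply: le_trans (area_hyp adX aX bX ab dE hB) _.
    rewrite ler_wpM2r//; last by lra.
    have B1 := Bpos _ _ _ hB.
    exact: addr_ge0 (sqr_ge0 _) (mulr_ge0 (mulr_ge0 (ltW thp) B1) (ltW l0)).
- rewrite !extend0_out//; exists 0, 0; split.
  + by rewrite size_poly0.
  + by [].
  + by split=> k km x _; rewrite subrr linear0 horner0 normr0 mul0r mulr_ge0// ltW.
  + move=> E B dE hB; rewrite /extend0r !asboolF// !horner0.
    have -> : E.[b] - E.[a] = 0.
      apply/eqP; rewrite subr_eq0; apply/eqP; apply: (@const_of_deriv0 R (horner E)) => x.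
      have := has_deriv_poly E x; rewrite dE /area !deriv0 !mul0r subrr scaler0 horner0.
      by [].
    rewrite !(mulr0, mul0r, subr0, addr0) normr0 mulr_ge0// addr_ge0 ?sqr_ge0//.
    exact: mulr_ge0 (mulr_ge0 (ltW thp) (Bpos _ _ _ hB)) (ltW l0).
- exists (extend0 Tf a), (extend0 Tg a); split.
  + by split; [exact: sTf|exact: sTg].
  + by [].
  + by split=> k km x _; rewrite subrr linear0 horner0 normr0 mul0r mulr_ge0// ltW.
  + move=> E B dE hB.
    have bnd (T : R -> {poly R}) (Bq : R) k x : 0 <= Bq -> Bq <= B0 ->
        (forall a, (size (extend0 T a) <= m.+1)%N) ->
        (forall a k, (k <= m)%N -> `|(extend0 T a)^`(k).[a]| <= Bq) ->
        (k <= m)%N -> a <= x <= b -> `|(extend0 T a)^`(k).[x]| <= Bp /\ `|(extend0 T b)^`(k).[x]| <= Bp.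
      move=> Bq0 BqB sT hT km xab.
      have hT' a' j : (j <= m)%N -> `|(extend0 T a')^`(j).[a']| <= B0 by move=> jm; apply: le_trans (hT a' j jm) BqB.
      have [h1 h2] := pair_bound B00 sT hT' lab km xab.
      have P : m.+1%:R * (B0 / dl ^+ m) * (b - a) ^+ (m - k) <= Bp.
        rewrite ler_wpM2l ?mulr_ge0 ?invr_ge0 ?exprn_ge0 ?(ltW dl0)//.
        apply: (@le_trans _ _ (D ^+ (m - k))); last by rewrite ler_weXn2l// leq_subr.
        by apply: lerXn2r; rewrite ?nnegrE ?(ltW l0)//; exact: le_trans (ltW l0) lD.
      by split; [exact: le_trans P|exact: le_trans P].
    have BfB : Bf <= B0 by rewrite lerDl.
    have BgB : Bg <= B0 by rewrite lerDr.
    have bf k x := @bnd Tf Bf k x Bf0 BfB sTf hBf.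
    have bg k x := @bnd Tg Bg k x Bg0 BgB sTg hBg.
    have hb y : `|extend0r h y| <= Bv.
      rewrite /extend0r; case: asboolP => Ky; [exact: h_bound|by rewrite normr0].
    have [fa _] := bf 0%N a (leq0n _) aab; have [ga _] := bg 0%N a (leq0n _) aab.
    have [fb fb'] := bf 0%N b (leq0n _) bab; have [gb gb'] := bg 0%N b (leq0n _) bab.
    rewrite !derivn0 in fa ga fb gb fb' gb'.
    have Ed : `|E.[b] - E.[a]| <= 4 * Bp ^+ 2 * D.
      apply: (@le_trans _ _ (4 * Bp ^+ 2 * `|b - a|)).
        apply: (@deriv_bound R (horner E) (horner E^`()) a b) => //.
          by move=> z _; exact: has_deriv_poly.
        move=> z zab; rewrite dE hornerZ hornerD hornerN !hornerM normrM (normr_nat R 2).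
        have [f0 _] := bf 0%N z (leq0n _) zab; have [g0 _] := bg 0%N z (leq0n _) zab.
        have [f1 _] := bf 1%N z m_gt0 zab; have [g1 _] := bg 1%N z m_gt0 zab.
        rewrite !derivn0 !derivn1 in f0 g0 f1 g1.
        have p1 := ler_pM (normr_ge0 _) (normr_ge0 _) f1 g0.
        have p2 := ler_pM (normr_ge0 _) (normr_ge0 _) g1 f0.
        rewrite -!normrM -!expr2 in p1 p2.
        have := ler_normB ((extend0 Tf a)^`().[z] * (extend0 Tg a).[z]) ((extend0 Tg a)^`().[z] * (extend0 Tf a).[z]).
        lra.
      by rewrite ger0_norm ?(ltW l0)// ler_wpM2l// mulr_ge0// sqr_ge0.
    have X1 : `|2 * (extend0 Tf a).[a] * ((extend0 Tg b).[b] - (extend0 Tg a).[b])| <= 4 * Bp ^+ 2.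
      rewrite !normrM (normr_nat R 2).
      have := ler_normB (extend0 Tg b).[b] (extend0 Tg a).[b] => hh.
      have h2 : `|(extend0 Tg b).[b] - (extend0 Tg a).[b]| <= 2 * Bp by lra.
      have := ler_pM (normr_ge0 _) (normr_ge0 _) fa h2; lra.
    have X2 : `|2 * (extend0 Tg a).[a] * ((extend0 Tf b).[b] - (extend0 Tf a).[b])| <= 4 * Bp ^+ 2.
      rewrite !normrM (normr_nat R 2).
      have := ler_normB (extend0 Tf b).[b] (extend0 Tf a).[b] => hh.
      have h2 : `|(extend0 Tf b).[b] - (extend0 Tf a).[b]| <= 2 * Bp by lra.
      have := ler_pM (normr_ge0 _) (normr_ge0 _) ga h2; lra.
    apply: (@le_trans _ _ Bt).
      apply: le_trans (ler_normB _ _) _; apply: le_trans (lerD (ler_normD _ _) (lexx _)) _.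
      apply: le_trans (lerD (lerD (ler_normB _ _) (lexx _)) (lexx _)) _.
      have := ler_normB (extend0r h b) (extend0r h a); have := hb a; have := hb b.
      rewrite /Bt; lra.
    have tt : th0 <= th.
      apply: ler_pM; rewrite ?(ltW wd) ?exprn_ge0 ?(ltW dl0)//.
        by rewrite (modulus_le w_mod)// ltW.
      by apply: lerXn2r; rewrite ?nnegrE ?(ltW dl0) ?(ltW l0).
    have B1 := Bpos _ _ _ hB.
    apply: (@le_trans _ _ (Bt / th0 ^+ 2 * th ^+ 2)).
      rewrite mulrAC ler_pdivlMr ?exprn_gt0// ler_wpM2l//.
      by apply: lerXn2r tt; rewrite nnegrE ltW.
    apply: ler_pM; rewrite ?sqr_ge0//.
      by rewrite lerDr; exact: addr_ge0 (addr_ge0 M0 J0) M20.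
    by rewrite lerDl; exact: mulr_ge0 (mulr_ge0 (ltW thp) B1) (ltW l0).
Qed.

Theorem compact_curve_extension : exists (F G : nat -> R -> R) (v : R -> R) (C2 : R),
  [/\ deriv_family m F /\ deriv_family m G,
      (forall x, has_deriv v x (2 * (F 1%N x * G 0%N x - G 1%N x * F 0%N x))),
      0 <= C2 /\ (forall x y, `|F m x - F m y| <= C2 * w `|x - y| /\
                 `|G m x - G m y| <= C2 * w `|x - y|),
      (forall k x, (k <= m)%N -> N + 1 <= `|x| -> F k x = 0 /\ G k x = 0) &
      (forall x, K x -> [/\ F 0%N x = f x, G 0%N x = g x & v x = h x])].
Proof.
have [Cf Cf0 hf] := completed_field Tf_jet f_bound Bv_ge0.
have [Cg Cg0 hg] := completed_field Tg_jet g_bound Bv_ge0.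
have [Ch Ch0 hh] := completed_area_field.
have N0 : 0 <= N := N_ge0.
have [_ vf _ _] := Tf_jet; have [_ vg _ _] := Tg_jet.
pose C := Cf + Cg + Ch.
have [c1 [c2 [c3 c4]]] : 0 <= C /\ Cf <= C /\ Cg <= C /\ Ch <= C by rewrite /C; lra.
have weak (C0 : R) T : C0 <= C -> taylor_field m w completed C0 T -> taylor_field m w completed C T.
  move=> le [sT hT]; split => // a b Ka Kb ab k km x xab.
  apply: le_trans (hT a b Ka Kb ab k km x xab) _.
  by rewrite ler_wpM2r// mulr_ge0 ?exprn_ge0 ?(modulus_ge0 w_mod)// subr_ge0 ltW.
have hA : area_field m w completed C (2 * N + 2) (extend0 Tf) (extend0 Tg) (extend0r h).
  move=> a b Ka Kb ab lD th; have thp : 0 <= th.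
    by rewrite mulr_ge0 ?exprn_ge0 ?(modulus_ge0 w_mod)// subr_ge0 ltW.
  have [P [Q [s e [sc1 sc2] H]]] := hh a b Ka Kb ab lD.
  exists P, Q; split => //.
    by split=> k km x xab; [apply: le_trans (sc1 k km x xab) _|apply: le_trans (sc2 k km x xab) _]; rewrite ler_wpM2r.
  move=> E B dE hB; apply: le_trans (H E B dE hB) _; rewrite ler_wpM2r//.
  have aab : a <= a <= b by rewrite lexx ltW.
  have B1 : 0 <= B by have [h1 _] := hB a aab; exact: le_trans h1.
  have l0 : 0 <= b - a by lra.
  exact: addr_ge0 (sqr_ge0 _) (mulr_ge0 (mulr_ge0 thp B1) l0).
have D0 : 0 < 2 * N + 2 by lra.
have [F [G [v [C2 [fam dv mod' jets vh]]]]] := curve_extension m_gt0 w_mod completed_closed completed_below completed_above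
  c1 D0 (weak _ _ c2 hf) (weak _ _ c3 hg) hA completed_gap.
exists F, G, v, C2; split => //.
- move=> k x km xN.
  have ray : x <= - (N + 1) \/ N + 1 <= x.
    by move: xN; rewrite ler_normr => /orP[]; [right|left; lra].
  have Kx : completed x by right.
  have [-> ->] := jets k x km Kx; rewrite !extend0_out; try exact: notK_ray.
  by rewrite linear0 horner0.
- move=> x Kx; have K1x : completed x by left.
  have [-> ->] := jets 0%N x (leq0n _) K1x; rewrite !derivn0 !extend0_in// vf vg vh//.
  by rewrite /extend0r asboolT.
Qed.

End Completion.

(** * Curves with a given modulus of continuity *)

Section HolderFamilies.
Variable R : realType.
Implicit Types (m k : nat) (f : R -> R) (u : nat -> R -> R) (omega : \bar R -> \bar R).

Lemma taylorE m f (a : R) : taylor m f a = taylor_poly m (fun k => derive1n k f a) a.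
Proof.
rewrite /taylor /taylor_poly poly_def linear_sum /=; apply: eq_bigr => i _.
by rewrite comp_polyZ comp_Xn_poly scale1r polyCN.
Qed.

Lemma Cm_family m f : Cm m f -> deriv_family m (fun k => derive1n k f).
Proof.
move=> [D _] k km x; rewrite /has_deriv /derive1n iterS -/(derive1n k f) derive1E.
exact: derivableP (D k km x).
Qed.

Lemma has_deriv_derive1 f (d : R -> R) : (forall x, has_deriv f x (d x)) -> derive1 f = d.
Proof. by move=> H; apply/funext => x; rewrite derive1E; case: (H x). Qed.

Lemma family_derive1n m u k : deriv_family m u -> (k <= m)%N -> derive1n k (u 0%N) = u k.
Proof.
move=> hu; elim: k => [//|k IH] km.
rewrite /derive1n iterS -/(derive1n k _) IH; last exact: ltnW.
by apply: has_deriv_derive1; exact: hu.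
Qed.

Lemma Cmo_seminorm_ge0 m omega f : modulus (modval omega) -> (0 <= Cmo_seminorm m omega f)%E.
Proof.
move=> wm; apply: (@le_trans _ _ (`|derive1n m f 0 - derive1n m f 1| / modval omega `|0 - 1|)%:E).
  by rewrite lee_fin divr_ge0// (modulus_ge0 wm).
by apply: ereal_sup_ubound; exists (0, 1) => //=; rewrite eq_sym oner_eq0.
Qed.

Lemma Cmo_seminormP m omega f (C : R) : modulus (modval omega) ->
  (Cmo_seminorm m omega f <= C%:E)%E <->
  (forall x y, `|derive1n m f x - derive1n m f y| <= C * modval omega `|x - y|).
Proof.
move=> wm; split=> [H x y|H].
  have [->|xy] := eqVneq x y.
    by rewrite !subrr normr0; case: wm => -> _ _ _ _; rewrite mulr0.
  have w0 : 0 < modval omega `|x - y| by rewrite modulus_gt0// normr_gt0 subr_eq0.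
  rewrite -ler_pdivrMr// -lee_fin; apply: le_trans H.
  by apply: ereal_sup_ubound; exists (x, y).
apply: ge_ereal_sup => _ [[x y] /= xy <-].
have w0 : 0 < modval omega `|x - y| by rewrite modulus_gt0// normr_gt0 subr_eq0.
by rewrite lee_fin ler_pdivrMr.
Qed.

Lemma Cmo_of_family m omega u (C : R) : modulus (modval omega) -> 0 <= C -> deriv_family m u ->
  (forall x y, `|u m x - u m y| <= C * modval omega `|x - y|) -> Cmo m omega (u 0%N).
Proof.
move=> wm C0 hu H; split; last first.
  apply: (@le_lt_trans _ _ C%:E); last exact: ltry.
  by apply/Cmo_seminormP => // x y; rewrite (family_derive1n hu).
split=> [k km x|]; first by rewrite (family_derive1n hu (ltnW km)); case: (hu k km x).
rewrite (family_derive1n hu)//; exact: (modulus_continuous wm C0 H).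
Qed.

Lemma Cmo_bound m omega f : modulus (modval omega) -> Cmo m omega f -> exists2 C : R, 0 <= C &
  (Cmo_seminorm m omega f <= C%:E)%E.
Proof.
move=> wm [_ H]; have h0 := Cmo_seminorm_ge0 m f wm.
exists (fine (Cmo_seminorm m omega f)); first exact: fine_ge0.
by rewrite fineK// ge0_fin_numE.
Qed.

End HolderFamilies.

(** * Algebra of bounded functions with a given modulus *)

Section HolderAlgebra.
Variables (R : realType) (w : R -> R).
Hypothesis w_mod : modulus w.
Implicit Types (u v f g : R -> R) (n k m : nat).

Definition bounded_holder u := exists2 C : R, 0 <= C &
  forall x y, `|u x| <= C /\ `|u x - u y| <= C * w `|x - y|.

(** Boundedness is required at every order because otherwise products leave the class. The recursion
    on a first derivative makes Leibniz' rule a plain induction. *)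
Fixpoint holder n u : Prop := bounded_holder u /\
  if n is n'.+1 then exists2 u', (forall x, has_deriv u x (u' x)) & holder n' u' else True.

Lemma holder_bounded n u : holder n u -> bounded_holder u.
Proof. by case: n => [|n] []. Qed.

Lemma holder_pred n u : holder n.+1 u -> holder n u.
Proof.
elim: n u => [|n IH] u [bu [u' du hu']]; first by split.
by split => //; exists u' => //; exact: IH.
Qed.

Lemma bounded_holderB u v : bounded_holder u -> bounded_holder v ->
  bounded_holder (fun x => u x - v x).
Proof.
move=> [C C0 hu] [D D0 hv]; exists (C + D) => [|x y]; first exact: addr_ge0.
have [u1 u2] := hu x y; have [v1 v2] := hv x y; split.
  by apply: le_trans (ler_normB _ _) _; exact: lerD.
rewrite (_ : _ - _ = (u x - u y) - (v x - v y)); last by ring.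
by rewrite mulrDl; apply: le_trans (ler_normB _ _) _; exact: lerD.
Qed.

Lemma bounded_holderM u v : bounded_holder u -> bounded_holder v ->
  bounded_holder (fun x => u x * v x).
Proof.
move=> [C C0 hu] [D D0 hv]; exists (2 * (C * D)) => [|x y]; first by rewrite !mulr_ge0.
have CD : 0 <= C * D by exact: mulr_ge0.
have [u1 u2] := hu x y; have [v1 v2] := hv x y; have [v3 _] := hv y y.
split; first by rewrite normrM; have := ler_pM (normr_ge0 _) (normr_ge0 _) u1 v1; lra.
rewrite (_ : _ - _ = (u x - u y) * v y + u x * (v x - v y)); last by ring.
apply: le_trans (ler_normD _ _) _; rewrite !normrM.
have := ler_pM (normr_ge0 _) (normr_ge0 _) u2 v3.
have := ler_pM (normr_ge0 _) (normr_ge0 _) u1 v2.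
lra.
Qed.

Lemma bounded_holder_cst (c : R) : bounded_holder (fun=> c).
Proof.
exists `|c| => // x y; rewrite subrr normr0; split => //.
by rewrite mulr_ge0// (modulus_ge0 w_mod).
Qed.

Lemma holderB n u v : holder n u -> holder n v -> holder n (fun x => u x - v x).
Proof.
elim: n u v => [|n IH] u v [bu hu] [bv hv]; split => //; try exact: bounded_holderB.
have [u' du hu'] := hu; have [v' dv hv'] := hv.
by exists (fun x => u' x - v' x) => [x|]; [exact: has_derivB|exact: IH].
Qed.

Lemma holder_cst n (c : R) : holder n (fun=> c).
Proof.
elim: n c => [|n IH] c; split => //; try exact: bounded_holder_cst.
by exists (fun=> 0) => // x; exact: has_deriv_cst.
Qed.

Lemma holderD n u v : holder n u -> holder n v -> holder n (fun x => u x + v x).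
Proof.
move=> hu hv; rewrite (_ : (fun x => _) = (fun x => u x - (0 - v x))); last first.
  by apply/funext => x; rewrite sub0r opprK.
by apply: holderB => //; apply: holderB => //; exact: holder_cst.
Qed.

Lemma holderM n u v : holder n u -> holder n v -> holder n (fun x => u x * v x).
Proof.
elim: n u v => [|n IH] u v hu hv; move: (hu) (hv) => [bu eu] [bv ev]; split => //;
  try exact: bounded_holderM.
have [u' du hu'] := eu; have [v' dv hv'] := ev.
exists (fun x => u' x * v x + u x * v' x) => [x|]; first exact: has_derivM.
by apply: holderD; apply: IH => //; exact: holder_pred.
Qed.

Lemma holder_family n u : holder n u -> exists U, [/\ U 0%N = u, deriv_family n U &
  exists2 C : R, 0 <= C & forall x y, `|U n x - U n y| <= C * w `|x - y|].
Proof.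
elim: n u => [|n IH] u [bu hu].
  have [C C0 H] := bu; exists (fun=> u); split => //.
  by exists C => // x y; have [] := H x y.
have [u' du /IH[U [U0 dU mU]]] := hu.
exists (fun k => if k is j.+1 then U j else u); split => // -[_ x|k km x]; first by rewrite U0.
exact: dU.
Qed.

Lemma family_holder m (u : nat -> R -> R) : deriv_family m u ->
  (forall k, (k <= m)%N -> bounded_holder (u k)) -> holder m (u 0%N).
Proof.
move=> hu bu.
suff H j : forall k, (k + j)%N = m -> holder j (u k) by exact: H.
elim: j => [|j IH] k kj; split => //; try (by apply: bu; lia).
by exists (u k.+1); [apply: hu; lia|apply: IH; lia].
Qed.

(** At distances up to 1 concavity gives w t >= w 1 * t; beyond 1 the sup bound is enough. *)
Lemma lipschitz_bounded_holder u (B : R) : 0 <= B -> (forall x, `|u x| <= B) ->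
  (forall x y, `|u x - u y| <= B * `|x - y|) -> bounded_holder u.
Proof.
move=> B0 hB hL; have w1 : 0 < w 1 by exact: modulus_gt0.
pose D := 2 * B / w 1.
have D0 : 0 <= D by rewrite divr_ge0 ?mulr_ge0// ltW.
exists (B + D) => [|x y]; first exact: addr_ge0.
split; first by rewrite (le_trans (hB x))// lerDl.
have W0 : 0 <= w `|x - y| by exact: modulus_ge0.
apply: (@le_trans _ _ (D * w `|x - y|)); last by rewrite ler_wpM2r// lerDr.
rewrite /D mulrAC ler_pdivlMr//.
have [xy1|xy1] := leP `|x - y| 1.
  have := modulus_chord w_mod (normr_ge0 (x - y)) xy1 ltr01; rewrite divr1 => h.
  apply: (@le_trans _ _ (B * `|x - y| * w 1)); first by rewrite ler_wpM2r// ltW.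
  have := ler_wpM2l B0 h; have : 0 <= B * w `|x - y| by exact: mulr_ge0.
  lra.
have h := modulus_le w_mod ler01 (ltW xy1).
apply: ler_pM => //; first exact: ltW.
by apply: le_trans (ler_normB _ _) _; have := hB x; have := hB y; lra.
Qed.

(** All derivatives vanish at -L, so [family_bound] on [-L, L] bounds them; below order m each is
    then bounded and Lipschitz. *)
Lemma compact_family_bounded_holder m (u : nat -> R -> R) (C L : R) : deriv_family m u -> 0 <= C -> 0 < L ->
  (forall x y, `|u m x - u m y| <= C * w `|x - y|) ->
  (forall k x, (k <= m)%N -> L <= `|x| -> u k x = 0) ->
  forall k, (k <= m)%N -> bounded_holder (u k).
Proof.
move=> hu C0 L0 mu out.
have LL : - L <= L by lra.
have W0 : 0 <= w (2 * L) by rewrite (modulus_ge0 w_mod)// mulr_ge0// ltW.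
have bnd k : (k <= m)%N -> exists2 B : R, 0 <= B & forall x, `|u k x| <= B.
  move=> km; exists (C * w (2 * L) * (2 * L) ^+ (m - k)).
    by rewrite mulr_ge0 ?exprn_ge0 ?mulr_ge0 ?(ltW L0).
  move=> x; have [xL|Lx] := leP L `|x|.
    by rewrite out// normr0 mulr_ge0 ?exprn_ge0 ?mulr_ge0 ?(ltW L0).
  have e2 : L - - L = 2 * L by ring.
  have := @family_bound R m u (- L) L 0 (C * w (2 * L)) hu (lexx 0) LL.
  rewrite mulr0 addr0 e2; apply => //.
  - move=> y z yL zL; apply: le_trans (mu y z) _; rewrite ler_wpM2l// (modulus_le w_mod)//.
    by rewrite ler_norml; lra.
  - move=> j jm; exists (- L); first by rewrite lexx.
    by rewrite out// ?normr0 ?mul0r// normrN ger0_norm// ltW.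
  - by move: Lx; rewrite ltr_norml; lra.
move=> k; rewrite leq_eqVlt => /predU1P[->|km].
  have [B B0 hB] := bnd m (leqnn m).
  exists (B + C) => [|x y]; first exact: addr_ge0.
  split; first by rewrite (le_trans (hB x))// lerDl.
  by apply: le_trans (mu x y) _; rewrite ler_wpM2r ?(modulus_ge0 w_mod)// lerDr.
have [B B0 hB] := bnd k (ltnW km); have [B' B'0 hB'] := bnd k.+1 km.
apply: (@lipschitz_bounded_holder _ (B + B')); first exact: addr_ge0.
  by move=> x; rewrite (le_trans (hB x))// lerDl.
move=> x y; apply: (@le_trans _ _ (B' * `|x - y|)); last by rewrite ler_wpM2r// lerDr.
apply: (@deriv_bound R (u k) (u k.+1) (Num.min x y) (Num.max x y)).
- by move=> z _; exact: hu.
- by move=> z _; exact: hB'.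
- by rewrite ge_min le_max !lexx.
- by rewrite ge_min le_max !lexx !orbT.
Qed.

End HolderAlgebra.

(** * Horizontality in terms of the components *)

Section HorizontalCurves.
Variable R : realType.

Lemma derivable_pair (V W : normedModType R) (f : R -> V) (g : R -> W) (x : R) :
  derivable f x 1 -> derivable g x 1 ->
  derivable (fun t => (f t, g t)) x 1 /\
  derive1 (fun t => (f t, g t)) x = (derive1 f x, derive1 g x).
Proof.
move=> /derivable1_diffP df /derivable1_diffP dg.
have d := differentiable_pair df dg; split; first exact/derivable1_diffP.
by rewrite !derive1E'// diff_pair.
Qed.

Lemma curve_deriv (G : R -> R * R * R) (t f1 g1 h1 : R) :
  has_deriv (cx G) t f1 -> has_deriv (cy G) t g1 -> has_deriv (cz G) t h1 ->
  derivable G t 1 /\ derive1 G t = (f1, g1, h1).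
Proof.
move=> [df ef] [dg eg] [dh eh].
have -> : G = (fun t => ((cx G t, cy G t), cz G t)).
  by apply/funext => s; rewrite /cx /cy /cz; case: (G s) => [[]].
have [d1 e1] := derivable_pair df dg; have [d2 e2] := derivable_pair d1 dh.
by split => //; rewrite e2 e1 !derive1E ef eg eh.
Qed.

Lemma heisE (p : R * R * R) (u v : R) :
  u *: heisX p + v *: heisY p = (u, v, 2 * (u * p.1.2 - v * p.1.1)).
Proof.
apply: injective_projections; first apply: injective_projections.
all: by rewrite /= /GRing.scale /=; ring.
Qed.

(** Bounded derivatives make the curve Lipschitz for the max norm of the product, hence absolutely
    continuous. *)
Lemma horizontal_curve (G : R -> R * R * R) (f1 g1 : R -> R) (B : R) :
  0 <= B ->
  (forall t, has_deriv (cx G) t (f1 t)) -> (forall t, has_deriv (cy G) t (g1 t)) ->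
  (forall t, has_deriv (cz G) t (2 * (f1 t * cy G t - g1 t * cx G t))) ->
  (forall t, [/\ `|f1 t| <= B, `|g1 t| <= B & `|2 * (f1 t * cy G t - g1 t * cx G t)| <= B]) ->
  horizontal G.
Proof.
move=> B0 df dg dh bnd; split => [a b _ e e0|].
  have lip (u u1 : R -> R) s t : (forall z, has_deriv u z (u1 z)) -> (forall z, `|u1 z| <= B) ->
      s <= t -> `|u t - u s| <= B * (t - s).
    move=> du hu st; rewrite -[X in B * X]ger0_norm; last by rewrite subr_ge0.
    by apply: (@deriv_bound R u u1 s t) => //; rewrite lexx st.
  exists (e / (B + 1)) => [|n s t st _ sd]; first by apply: divr_gt0 => //; lra.
  apply: (@le_lt_trans _ _ (\sum_(i < n) B * (t i - s i))).
    apply: ler_sum => i _; have [_ [sti _]] := st i.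
    rewrite !prod_normE !ge_max /=; apply/andP; split; last first.
      by apply: (lip (cz G) _ _ _ dh) => // z; have [] := bnd z.
    apply/andP; split.
      by apply: (lip (cx G) _ _ _ df) => // z; have [] := bnd z.
    by apply: (lip (cy G) _ _ _ dg) => // z; have [] := bnd z.
  have S0 : 0 <= \sum_(i < n) (t i - s i).
    by apply: sumr_ge0 => i _; have [_ [sti _]] := st i; rewrite subr_ge0.
  rewrite -mulr_sumr; move: sd; rewrite ltr_pdivlMr; last lra.
  by lra.
apply: aeW => t; have [d e] := curve_deriv (df t) (dg t) (dh t); split => //.
by exists (f1 t), (g1 t); rewrite e heisE.
Qed.

(** A nonzero value would persist on an open interval, which has positive measure. *)
Lemma ae_eq0_continuous (D : R -> R) : continuous D ->
  {ae lebesgue_measure, forall t, D t = 0} -> forall t, D t = 0.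
Proof.
move=> cD [A [mA A0 HA]] t; apply/eqP/negPn/negP => Dt.
have [d d0 Hd] : exists2 d : R, 0 < d & forall y, `|y - t| < d -> D y != 0.
  have /continuousP_eps := cD t.
  move=> /(_ (`|D t| / 2)) []; first by rewrite divr_gt0 ?normr_gt0.
  move=> d d0 Hd; exists d => // y yt; apply/eqP => Dy.
  have := Hd y yt; rewrite Dy sub0r normrN; have : 0 < `|D t| by rewrite normr_gt0.
  by lra.
have sub : `]t - d, t + d[ `<=` A.
  move=> y /=; rewrite in_itv /= => yt; apply: HA => /= Dy.
  suff /Hd : `|y - t| < d by rewrite Dy eqxx.
  by rewrite ltr_norml; lra.
have ab : t - d < t + d by lra.
have : (lebesgue_measure [set` `](t - d)%R, (t + d)%R[] <= 0)%E.
  have h0 : lebesgue_measure A = 0%E := A0.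
  rewrite -h0; apply: (le_measure lebesgue_measure) sub; apply: mem_set => //.
rewrite lebesgue_measure_itv /= lte_fin ab -EFinB lee_fin; lra.
Qed.

Lemma horizontal_area (G : R -> R * R * R) (f1 g1 h1 : R -> R) : horizontal G ->
  (forall t, has_deriv (cx G) t (f1 t)) -> (forall t, has_deriv (cy G) t (g1 t)) ->
  (forall t, has_deriv (cz G) t (h1 t)) ->
  continuous f1 -> continuous g1 -> continuous h1 ->
  forall t, h1 t = 2 * (f1 t * cy G t - g1 t * cx G t).
Proof.
move=> [_ hz] df dg dh cf1 cg1 ch1 t; apply/eqP; rewrite -subr_eq0; apply/eqP.
pose D s := h1 s - 2 * (f1 s * cy G s - g1 s * cx G s).
apply: (@ae_eq0_continuous D) => [s|].
  have cf := has_deriv_cont (df s); have cg := has_deriv_cont (dg s).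
  apply: cvgB; first exact: ch1.
  apply: cvgM; first exact: cvg_cst.
  by apply: cvgB; apply: cvgM; [exact: cf1|exact: cg|exact: cg1|exact: cf].
have D0 (s : R) : (exists u v : R, derive1 G s = u *: heisX (G s) + v *: heisY (G s)) -> D s = 0.
  have [_ ->] := curve_deriv (df s) (dg s) (dh s).
  by move=> [u [v]]; rewrite heisE => -[e1 e2 e3]; rewrite /D e1 e2 e3 /cx /cy; ring.
by have [A [mA A0 HA]] := hz; exists A; split => // s ns; apply: HA => -[_ /D0].
Qed.

End HorizontalCurves.

(** * Area discrepancy and velocity *)

Section AreaDiscrepancy.
Variable R : realType.
Implicit Types (G : R -> R * R * R) (m : nat) (a b : R).

Lemma horner_continuous (p : {poly R}) : continuous (horner p).
Proof. by move=> x; exact: has_deriv_cont (has_deriv_poly p x). Qed.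

Lemma area_discrepancyE m G a b (E : {poly R}) : a < b ->
  E^`() = area (taylor m (cx G) a) (taylor m (cy G) a) ->
  area_discrepancy m G a b = cz G b - cz G a - (E.[b] - E.[a])
    + 2 * cx G a * (cy G b - (taylor m (cy G) a).[b])
    - 2 * cy G a * (cx G b - (taylor m (cx G) a).[b]).
Proof.
move=> ab dE; rewrite /area_discrepancy.
set p := taylor m (cx G) a in dE *; set q := taylor m (cy G) a in dE *.
have [|I [dI ->]] := @primitive_exists R (fun x => p^`().[x] * q.[x] - q^`().[x] * p.[x]) a b _ ab.
  by move=> x; apply: cvgB; apply: cvgM; exact: horner_continuous.
suff -> : E.[b] - E.[a] = 2 * (I b - I a) by ring.
have H := @deriv_bound R (fun x => E.[x] - 2 * I x) (fun=> 0) a b 0 b a.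
have : `|E.[b] - 2 * I b - (E.[a] - 2 * I a)| <= 0.
  rewrite -(mul0r `|b - a|); apply: H; rewrite ?lexx ?(ltW ab)// => x xab; last by rewrite normr0.
  have := has_derivB (has_deriv_area_primitive x dE) (has_derivZ 2 (dI x xab)).
  by rewrite subrr.
rewrite normr_le0 subr_eq0 => /eqP; lra.
Qed.

Lemma omega_velocityE m omega G a b : a < b -> exists S : R -> R,
  let p := taylor m (cx G) a in let q := taylor m (cy G) a in
  let th := modval omega (b - a) * (b - a) ^+ m in
  (forall x, a <= x <= b -> has_deriv S x (`|p^`().[x]| + `|q^`().[x]|)) /\
  omega_velocity m omega G a b = th ^+ 2 + th * (S b - S a).
Proof.
move=> ab; have [|S [dS eS]] := @primitive_exists R
    (fun x => `|(taylor m (cx G) a)^`().[x]| + `|(taylor m (cy G) a)^`().[x]|) a b _ ab.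
  by move=> x; apply: cvgD; apply: cvg_norm; exact: horner_continuous.
exists S; split => //.
by rewrite /omega_velocity eS exprMn -exprM mulnC.
Qed.

Lemma omega_velocity_ge0 m omega G a b : modulus (modval omega) -> a < b ->
  0 <= omega_velocity m omega G a b.
Proof.
move=> wm ab; have [S [dS ->]] := omega_velocityE m omega G ab.
apply: addr_ge0; first exact: sqr_ge0.
apply: mulr_ge0; first by rewrite mulr_ge0 ?exprn_ge0 ?(modulus_ge0 wm)// subr_ge0 ltW.
have := @deriv_le R (fun=> 0) S (fun=> 0) _ a b (ltW ab) _ dS.
rewrite subrr; apply; first by move=> x _; exact: has_deriv_cst.
by move=> x _; exact: addr_ge0.
Qed.

Lemma Cm_continuous m (f : R -> R) k : Cm m f -> (k <= m)%N -> continuous (derive1n k f).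
Proof.
move=> Cf; rewrite leq_eqVlt => /predU1P[->|km x]; first by case: Cf.
exact: has_deriv_cont (Cm_family Cf km x).
Qed.

Lemma taylor_value m (f : R -> R) a : (taylor m f a).[a] = f a.
Proof. by rewrite taylorE -[taylor_poly _ _ _]derivn0 derivn_taylor_poly. Qed.

(** This is [area_stability] with U the height itself, p and q the Taylor polynomials at a, and C
    w(l) l^m as distance, l = b - a; 6 C and 4 C^2 come from its two terms. *)
Lemma horizontal_area_discrepancy m omega G (C : R) : (0 < m)%N -> modulus (modval omega) ->
  0 <= C -> horizontal G -> Cm m (cx G) -> Cm m (cy G) -> Cm m (cz G) ->
  (Cmo_seminorm m omega (cx G) <= C%:E)%E -> (Cmo_seminorm m omega (cy G) <= C%:E)%E ->
  forall a b, a < b ->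
    `|area_discrepancy m G a b| <= (6 * C + 4 * C ^+ 2) * omega_velocity m omega G a b.
Proof.
move=> m0 wm C0 hG Cx Cy Cz /(Cmo_seminormP _ _ _ wm) sx /(Cmo_seminormP _ _ _ wm) sy a b ab.
have dx := Cm_family Cx; have dy := Cm_family Cy; have dz := Cm_family Cz.
have hz := horizontal_area hG (dx 0%N m0) (dy 0%N m0) (dz 0%N m0)
  (Cm_continuous Cx m0) (Cm_continuous Cy m0) (Cm_continuous Cz m0).
have [E dE] := poly_primitive (area (taylor m (cx G) a) (taylor m (cy G) a)).
have [S [dS eV]] := omega_velocityE m omega G ab.
rewrite (area_discrepancyE ab dE) eV.
set th0 := _ * _ ^+ m in eV *; set p := taylor m (cx G) a in dE dS *; set q := taylor m (cy G) a in dE dS *.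
have l0 : 0 < b - a by lra.
have W0 : 0 <= modval omega (b - a) by exact: modulus_ge0 (ltW l0).
have close (f : R -> R) k x : Cm m f ->
    (forall x y, `|derive1n m f x - derive1n m f y| <= C * modval omega `|x - y|) ->
    (k <= m)%N -> a <= x <= b ->
    `|derive1n k f x - (taylor m f a)^`(k).[x]| <= C * modval omega (b - a) * (b - a) ^+ (m - k).
  move=> Cf sf km xab; rewrite taylorE.
  exact: (taylor_close wm C0 (Cm_family Cf) sf ab km xab).
have th00 : 0 <= th0 by rewrite mulr_ge0// exprn_ge0// ltW.
have SS : 0 <= S b - S a.
  have := @deriv_le R (fun=> 0) S (fun=> 0) _ a b (ltW ab) _ dS.
  rewrite subrr; apply; first by move=> x _; exact: has_deriv_cst.
  by move=> x _; exact: addr_ge0.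
have th1 : C * modval omega (b - a) * (b - a) ^+ (m - 1) = C * th0 / (b - a).
  by rewrite /th0 -{2}(subnK m0) addn1 exprS; field; rewrite gt_eqF.
have := @area_stability R (cx G) (cy G) (derive1n 1 (cx G)) (derive1n 1 (cy G)) (cz G)
  (horner E) S (fun x => `|p^`().[x]| + `|q^`().[x]|) p q a b (C * th0) ab.
rewrite /p /q !taylor_value -/p -/q => H; apply: le_trans (H _ _ _ _ _ _ _ _ _ _) _ => //.
- by move=> x _; exact: (dx 0%N m0).
- by move=> x _; exact: (dy 0%N m0).
- by move=> x _; rewrite -hz; exact: (dz 0%N m0).
- by move=> x _; exact: has_deriv_area_primitive.
- move=> x xab; have := close _ 0%N x Cx sx (leq0n _) xab; have := close _ 0%N x Cy sy (leq0n _) xab.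
  by rewrite !derivn0 subn0 -mulrA.
- move=> x xab; have := close _ 1%N x Cx sx m0 xab; have := close _ 1%N x Cy sy m0 xab.
  by rewrite !derivn1 th1.
have := mulr_ge0 C0 (mulr_ge0 th00 th00).
have := mulr_ge0 (sqr_ge0 C) (mulr_ge0 th00 SS).
rewrite expr2; lra.
Qed.

(** The integral of |Tf'| + |Tg'| is at most 2 B (b - a), whence the factor 2. *)
Lemma area_discrepancy_bound m omega G (M : R) a b (E : {poly R}) (B : R) :
  modulus (modval omega) -> 0 <= M -> a < b ->
  `|area_discrepancy m G a b| <= M * omega_velocity m omega G a b ->
  E^`() = area (taylor m (cx G) a) (taylor m (cy G) a) ->
  (forall x, a <= x <= b -> `|(taylor m (cx G) a)^`().[x]| <= B /\
                            `|(taylor m (cy G) a)^`().[x]| <= B) ->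
  let th := modval omega (b - a) * (b - a) ^+ m in
  `|cz G b - cz G a - (E.[b] - E.[a]) + 2 * cx G a * (cy G b - (taylor m (cy G) a).[b])
    - 2 * cy G a * (cx G b - (taylor m (cx G) a).[b])| <=
    2 * M * (th ^+ 2 + th * B * (b - a)).
Proof.
move=> wm M0 ab hA dE hB /=; set th := _ * _ ^+ m; rewrite -(area_discrepancyE ab dE).
have [S [dS eV]] := omega_velocityE m omega G ab.
apply: le_trans hA _; rewrite eV -/th.
have th0 : 0 <= th.
  by rewrite mulr_ge0 ?exprn_ge0 ?(modulus_ge0 wm)// subr_ge0 ltW.
have SB : S b - S a <= 2 * B * (b - a).
  have := @deriv_le R S (fun x => 2 * B * x) _ (fun=> 2 * B * 1) a b (ltW ab) dS.
  rewrite mulrBr; apply; first by move=> x _; apply: has_derivZ; exact: has_deriv_id.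
  by move=> x xab; have [] := hB x xab; lra.
have h1 := mulr_ge0 M0 (sqr_ge0 th).
have h2 := ler_wpM2l (mulr_ge0 M0 th0) SB.
lra.
Qed.

End AreaDiscrepancy.

(** Every point of K that is not a limit point is isolated and has its own distance to the rest of
    K; finiteness of the isolated points gives a positive minimum, capped at 1. *)
Lemma isolated_separation (R : realType) (K : set R) : finite_set (isolated K) ->
  exists2 dl : R, 0 < dl <= 1 &
    forall p y, K p -> ~ limit_pt K p -> K y -> y != p -> dl <= `|y - p|.
Proof.
move=> /finite_seqP[s Es].
have sep p : exists2 d : R, 0 < d & K p -> ~ limit_pt K p ->
    p \in s /\ forall y, K y -> y != p -> d <= `|y - p|.
  have [Kp|nK] := pselect (K p); last by exists 1.
  have [|nl] := pselect (limit_pt K p); first by exists 1.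
  have [d d0 Hd] : exists2 d : R, 0 < d & forall y, K y -> y != p -> d <= `|y - p|.
    apply: contrapT => H; apply: nl; split => // d d0.
    apply: contrapT => H'; apply: H; exists d => // y Ky yp.
    by rewrite leNgt; apply/negP => yd; apply: H'; exists y.
  exists d => // _ _; split => //.
  have : isolated K p.
    split; first exact: mem_set.
    exists (ball p d); first exact: nbhsx_ballx.
    apply/seteqP; split => [y [yp Ky]|_ ->]; last by split => //; exact: ballxx.
    apply/eqP/negPn/negP => yp'; have := Hd y Ky yp'.
    by move: yp; rewrite /ball /= distrC ltNge => /negP.
  by rewrite Es.
pose dd p := s2val (cid2 (sep p)).
have dd0 p : 0 < dd p by rewrite /dd; case: cid2.
have ddP p : K p -> ~ limit_pt K p -> p \in s /\ forall y, K y -> y != p -> dd p <= `|y - p|.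
  by rewrite /dd; case: cid2.
have [dl dl01 Hdl] : exists2 dl : R, 0 < dl <= 1 & forall p, p \in s -> dl <= dd p.
  elim: (s) => [|p t [dl /andP[dl0 dl1] IH]]; first by exists 1; rewrite ?ltr01 ?lexx.
  exists (Num.min dl (dd p)); first by rewrite lt_min dl0 dd0 ge_min dl1.
  by move=> q; rewrite inE ge_min => /predU1P[->|/IH ->//]; rewrite lexx orbT.
exists dl => // p y Kp np Ky yp; have [ps Hp] := ddP p Kp np.
exact: le_trans (Hdl p ps) (Hp y Ky yp).
Qed.

Lemma compact_norm_bound (R : realType) (V : normedModType R) (A : set V) : compact A ->
  exists2 N : R, 0 <= N & forall x, A x -> `|x| <= N.
Proof.
move=> /compact_bounded[M [_ HM]]; exists (`|M| + 1); first exact: addr_ge0.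
by move=> x Ax; apply: (HM (`|M| + 1)) => //; rewrite (le_lt_trans (ler_norm M))// ltrDl.
Qed.

(** * Assembling the curve in the Heisenberg group *)

Section Main.
Variable R : realType.
Variables (m : nat) (omega : \bar R -> \bar R) (K : set R).
Hypothesis m_gt0 : (0 < m)%N.
Hypothesis omega_mod : modulus (modval omega).

Lemma Cmo3_seminorm_le (G : R -> R * R * R) (M : R) : (Cmo3_seminorm m omega G <= M%:E)%E ->
  (Cmo_seminorm m omega (cx G) <= M%:E)%E /\ (Cmo_seminorm m omega (cy G) <= M%:E)%E.
Proof.
have h f := Cmo_seminorm_ge0 m f omega_mod.
move=> H; split; apply: le_trans H; rewrite /Cmo3_seminorm -addeA.
  by rewrite leeDl// adde_ge0.
by rewrite addeA (addeC (Cmo_seminorm _ _ (cx G))) -addeA leeDl// adde_ge0.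
Qed.

(** The derivative of v is a polynomial in F, G, F', G', all bounded with modulus up to order m-1;
    hence v gains the m-th order. *)
Lemma horizontal_of_family (F G : nat -> R -> R) (v : R -> R) (C L : R) :
  deriv_family m F -> deriv_family m G ->
  (forall x, has_deriv v x (2 * (F 1%N x * G 0%N x - G 1%N x * F 0%N x))) ->
  0 <= C -> (forall x y, `|F m x - F m y| <= C * modval omega `|x - y| /\
                         `|G m x - G m y| <= C * modval omega `|x - y|) ->
  0 < L -> (forall k x, (k <= m)%N -> L <= `|x| -> F k x = 0 /\ G k x = 0) ->
  horizontal (fun t => (F 0%N t, G 0%N t, v t)) /\
  Cmo3 m omega (fun t => (F 0%N t, G 0%N t, v t)).
Proof.
move=> dF dG dv C0 mFG L0 out.
have bF := compact_family_bounded_holder omega_mod dF C0 L0 (fun x y => (mFG x y).1)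
  (fun k x km xL => (out k x km xL).1).
have bG := compact_family_bounded_holder omega_mod dG C0 L0 (fun x y => (mFG x y).2)
  (fun k x km xL => (out k x km xL).2).
(* With m = n+1, the first derivatives F', G' are of class [holder] n, and so is v'. *)
case: m m_gt0 dF dG bF bG mFG {out} => // n _ dF dG bF bG mFG.
have hF := family_holder dF bF; have hG := family_holder dG bG.
have hF1 : holder (modval omega) n (F 1%N).
  apply: (@family_holder _ _ n (fun k => F k.+1)) => k kn; first exact: dF.
  exact: bF.
have hG1 : holder (modval omega) n (G 1%N).
  apply: (@family_holder _ _ n (fun k => G k.+1)) => k kn; first exact: dG.
  exact: bG.
have hv : holder (modval omega) n (fun x => 2 * (F 1%N x * G 0%N x - G 1%N x * F 0%N x)).
  apply: (holderM omega_mod); first exact: holder_cst.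
  by apply: holderB => //; apply: holderM => //; exact: holder_pred.
have [U [U0 dU [D D0 mU]]] := holder_family hv.
split.
  have [B1 B10 h1] := bF 1%N isT; have [B2 B20 h2] := bG 1%N isT.
  have [B3 B30 h3] := holder_bounded hv.
  apply: (@horizontal_curve _ _ (F 1%N) (G 1%N) (B1 + B2 + B3)).
  - by rewrite !addr_ge0.
  - by move=> t; exact: (dF 0%N isT).
  - by move=> t; exact: (dG 0%N isT).
  - exact: dv.
  - move=> t; have [e1 _] := h1 t t; have [e2 _] := h2 t t; have [e3 _] := h3 t t.
    by split; [apply: le_trans e1 _|apply: le_trans e2 _|apply: le_trans e3 _]; lra.
split.
- by apply: (Cmo_of_family omega_mod C0 dF) => x y; have [] := mFG x y.
- by apply: (Cmo_of_family omega_mod C0 dG) => x y; have [] := mFG x y.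
- apply: (@Cmo_of_family R n.+1 omega (fun k => if k is j.+1 then U j else v) D) => //.
  by move=> [_|k kn] x; [rewrite U0; exact: dv|exact: dU].
Qed.

End Main.

Local Open Scope card_scope.
Local Open Scope ring_scope.

Theorem theorem3p2 (R : realType) (m : nat) (omega : \bar R -> \bar R)
    (K : set R) (gamma : R -> R * R * R)
    (m_gt0 : (0 < m)%N)
    (omega_modulus : modulus_of_continuity omega)
    (K_compact : compact K)
    (K_isolated : finite_set (isolated K))
    (K_card : `I_(m.+2) #<= K)
    (gamma_cont : {within K, continuous gamma}) :
  (exists Gamma : R -> R * R * R,
     [/\ horizontal Gamma, Cmo3 m omega Gamma &
         forall t, K t -> Gamma t = gamma t])
  <->
  (exists M : R, 0 < M /\
     forall X : set R, X `<=` K -> X #= `I_(m.+2) ->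
       exists GammaX : R -> R * R * R,
         [/\ Cmo3 m omega GammaX,
             (forall t, X t -> GammaX t = gamma t),
             (Cmo3_seminorm m omega GammaX <= M%:E)%E &
             forall a b, K a -> K b -> a < b ->
               `|area_discrepancy m GammaX a b|
                 <= M * omega_velocity m omega GammaX a b]).
Proof.
have wm := modval_modulus omega_modulus; split.
  move=> [G [hG [Cx Cy Cz] GK]].
  have [c1 c10 s1] := Cmo_bound wm Cx; have [c2 c20 s2] := Cmo_bound wm Cy.
  have [c3 c30 s3] := Cmo_bound wm Cz.
  pose C := c1 + c2 + c3.
  have C0 : 0 <= C by rewrite !addr_ge0.
  have D0 : 0 <= 6 * C + 4 * C ^+ 2 by rewrite addr_ge0 ?mulr_ge0 ?sqr_ge0.
  exists (C + (6 * C + 4 * C ^+ 2) + 1); split; first by lra.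
  (* The given horizontal curve serves as the interpolant for every X. *)
  move=> X XK _; exists G; split => //.
  - by move=> t /XK; exact: GK.
  - apply: (@le_trans _ _ C%:E); last by rewrite lee_fin; lra.
    by rewrite /Cmo3_seminorm /C !EFinD; apply: leeD => //; exact: leeD.
  - move=> a b _ _ ab.
    have e1 : (Cmo_seminorm m omega (cx G) <= C%:E)%E.
      by apply: le_trans s1 _; rewrite lee_fin /C; lra.
    have e2 : (Cmo_seminorm m omega (cy G) <= C%:E)%E.
      by apply: le_trans s2 _; rewrite lee_fin /C; lra.
    apply: le_trans (horizontal_area_discrepancy m_gt0 wm C0 hG Cx.1 Cy.1 Cz.1 e1 e2 ab) _.
    by rewrite ler_wpM2r ?(omega_velocity_ge0 _ _ wm)//; lra.
move=> [M [M0 HM]].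
(* One curve is chosen for each finite set, so that the interpolants become functions of X; sets
   that are not admissible get the zero curve. *)
have ex (X : {fset R}) : exists G : R -> R * R * R, admissible m K X ->
    [/\ Cmo3 m omega G, (forall t, t \in X -> G t = gamma t),
        (Cmo3_seminorm m omega G <= M%:E)%E &
        forall a b, K a -> K b -> a < b ->
          `|area_discrepancy m G a b| <= M * omega_velocity m omega G a b].
  have [[XK cX]|] := pselect (admissible m K X); last by exists (fun=> 0).
  have [//||G [h1 h2 h3 h4]] := HM [set` X]; first exact/card_eq_fsetP.
  by exists G.
have [GX HX] := choice ex.
pose phi X k := derive1n k (cx (GX X)); pose psi X k := derive1n k (cy (GX X)).
have phi_family X : admissible m K X -> deriv_family m (phi X).
  by move=> /HX[[[Cx _] _ _] _ _ _]; exact: Cm_family.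
have psi_family X : admissible m K X -> deriv_family m (psi X).
  by move=> /HX[[_ [Cy _] _] _ _ _]; exact: Cm_family.
have phi_modulus X : admissible m K X -> forall x y,
    `|phi X m x - phi X m y| <= M * modval omega `|x - y|.
  by move=> /HX[_ _ /(Cmo3_seminorm_le wm)[h _] _]; exact/(Cmo_seminormP _ _ _ wm).
have psi_modulus X : admissible m K X -> forall x y,
    `|psi X m x - psi X m y| <= M * modval omega `|x - y|.
  by move=> /HX[_ _ /(Cmo3_seminorm_le wm)[_ h] _]; exact/(Cmo_seminormP _ _ _ wm).
have phi_value X : admissible m K X -> forall x, x \in X -> phi X 0%N x = cx gamma x.
  by move=> /HX[_ h _ _] x /h e; rewrite /phi /= /cx e.
have psi_value X : admissible m K X -> forall x, x \in X -> psi X 0%N x = cy gamma x.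
  by move=> /HX[_ h _ _] x /h e; rewrite /psi /= /cy e.
have [Tf HTf] := jets_exist wm (ltW M0) phi_family phi_modulus phi_value.
have [Tg HTg] := jets_exist wm (ltW M0) psi_family psi_modulus psi_value.
have [N N0 HN] := compact_norm_bound K_compact.
have [Bv Bv0 HBv] := compact_norm_bound (continuous_compact gamma_cont K_compact).
have Bgamma a : K a -> [/\ `|cx gamma a| <= Bv, `|cy gamma a| <= Bv & `|cz gamma a| <= Bv].
  move=> Ka; have := HBv (gamma a) (imageP _ Ka).
  by rewrite !prod_normE !ge_max => /andP[/andP[]].
have [dl dl01 sep] := isolated_separation K_isolated.
have K_closed : closed K by apply: compact_closed => //; exact: Rhausdorff.
have [] := @compact_curve_extension R m (modval omega) K M N dl Bv m_gt0 wm (ltW M0) K_closed N0 HN dl01 sep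
  (cx gamma) (cy gamma) (cz gamma) phi psi Tf Tg (2 * M) _ Bv0 _ _ _ HTf HTg
  phi_family phi_modulus phi_value psi_family psi_modulus psi_value.
- by rewrite mulr_ge0// ltW.
- by move=> a /Bgamma[].
- by move=> a /Bgamma[].
- by move=> a /Bgamma[].
(* At points of X the components of the interpolant are those of gamma, so its discrepancy bound
   becomes a statement about the prescribed data. *)
- move=> X a b aX Xa Xb ab E B; rewrite -!taylorE => dE hB.
  have [_ GXv _ hA] := HX X aX.
  have := area_discrepancy_bound wm (ltW M0) ab (hA a b (aX.1 a Xa) (aX.1 b Xb) ab) dE hB.
  by rewrite !taylor_value /cx /cy /cz !GXv.
move=> F [G [v [C [[dF dG] dv [C0 mFG] out val]]]].
have L0 : 0 < N + 1 by lra.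
have [hz hC] := horizontal_of_family m_gt0 wm dF dG dv C0 mFG L0 out.
exists (fun t => (F 0%N t, G 0%N t, v t)); split => // t /val[-> -> ->].
by rewrite /cx /cy /cz; case: (gamma t) => [[]].
Qed.
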